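(* The $3$-minimal stick number ($3$-rotational stick number) of $\widetilde{B}_3$ is $42$, i.e. the minimal length of a threefold rotationally symmetric gallery in $\widetilde{B}_3$ that knots in a nontrivial way is $42$, and it is achieved by a symmetric trefoil. Thus $l_3(3_1)=14$, i.e. the minimal length of a word of order $3$ whose threefold repetition knots as a trefoil is $14$.
   Context: The tessellation $\widetilde{B}_3$: start from the standard tessellation of $\mathbb{R}^3$ by unit cubes and divide each cube into $24$ pyramids (tetrahedra), each being the convex hull of the center of the cube, the center of one of its faces, and the two endpoints of one edge of that face. Vertices are colored: cube centers have color $D$, centers of cube faces have color $C$, and vertices of the cubes have colors $A$ and $B$ in alternating fashion (the two endpoints of every cube edge have different colors). Every pyramid thus has exactly one vertex of each color $A,B,C,D$. A gallery is a path of pyramids such that consecutive pyramids share a (two-dimensional) face. Once a starting pyramid $\mathcal{C}$ is chosen, a gallery is encoded by a word $(s_1,\dots,s_k)$ with $s_i\in\{A,B,C,D\}$: at step $i$ one passes from the current pyramid to the adjacent pyramid across the face opposite to the vertex of color $s_i$. The length of the gallery is $k$. The letters $A,B,C,D$ also denote the reflections in the planes of the faces of $\mathcal{C}$ opposite to the vertices of the respective colors; these are symmetries of the colored tessellation, and the gallery $(s_1,\dots,s_k)$ starting at $\mathcal{C}$ ends at $s_1\circ\cdots\circ s_k(\mathcal{C})$. The order of the word $s_1\cdots s_k$ is the order of the isometry $s_1\circ\cdots\circ s_k$. A closed gallery knots as $K$ if the closed polygonal curve obtained by joining consecutive centers (barycenters) of its pyramids has no self-intersections and is a knot of the same type as $K$;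 it knots in a nontrivial way if this knot is not the unknot. A threefold rotationally symmetric gallery is a closed gallery of the form $(g,g,g)$, where $g=(s_1,\dots,s_k)$ and the word $s_1\cdots s_k$ has order $3$ (such an element is a rotation by $\pm120^\circ$); its length is $3k$. Here $3_1$ is the trefoil (either mirror image), and the value $l_3(3_1)$ is counted as the length $k$ of the repeated word $g$, minimized over all such galleries that knot as $3_1$. *)

(* Defs.v *)
From HB Require Import structures.
From mathcomp Require Import all_boot all_order all_algebra.
From mathcomp Require Import all_classical all_reals all_analysis.

Import Order.TTheory GRing.Theory Num.Theory.
Import numFieldNormedType.Exports.

Local Open Scope classical_set_scope.
Local Open Scope ring_scope.

Definition point3 {R : realType} (x y z : R) : 'rV[R]_3 :=
  \row_i nth 0 [:: x; y; z] i.

Definition dot {R : realType} (u v : 'rV[R]_3) : R := \sum_i u 0 i * v 0 i.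

Definition cross {R : realType} (u v : 'rV[R]_3) : 'rV[R]_3 :=
  let c i := u 0 (inord i) in let d i := v 0 (inord i) in
  point3 (c 1%N * d 2%N - c 2%N * d 1%N)
         (c 2%N * d 0%N - c 0%N * d 2%N)
         (c 0%N * d 1%N - c 1%N * d 0%N).

Definition plane_reflection {R : realType} (u v w x : 'rV[R]_3) : 'rV[R]_3 :=
  let n := cross (v - u) (w - u) in
  x - (2 * dot (x - u) n / dot n n) *: n.

Inductive color := colA | colB | colC | colD.

(* A pyramid is the convex hull of its four vertices and has one vertex of each
   color, so it is represented by the function sending a color to its vertex. *)
Definition pyramid (R : realType) := color -> 'rV[R]_3.

(* The unit cubes have corners in Z^3; [cube_vertex z a] says that a is a corner
   of the cube z + [0,1]^3. *)
Definition cube_vertex (z a : 'rV[int]_3) : Prop :=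
  forall k, a 0 k = z 0 k \/ a 0 k = z 0 k + 1.

(* The witnesses are a cube z + [0,1]^3, an edge ab of it parallel to the axis
   j, and the face through this edge that is orthogonal to the axis i <> j.  The
   alternating coloring of Z^3 gives color A to the points with even coordinate
   sum; the other endpoint of the edge then has odd sum, that is, color B. *)
Definition is_pyramid {R : realType} (p : pyramid R) : Prop :=
  exists (z a b : 'rV[int]_3) (i j : 'I_3),
    [/\ [/\ cube_vertex z a, cube_vertex z b, i != j &
            forall k, (a 0 k == b 0 k) = (k != j)],
        (2 %| \sum_k a 0 k)%Z &
        [/\ p colA = \row_k (a 0 k)%:~R,
            p colB = \row_k (b 0 k)%:~R,
            p colC = \row_k (if k == i then (a 0 k)%:~R
                             else (z 0 k)%:~R + 2^-1) &
            p colD = \row_k ((z 0 k)%:~R + 2^-1)]].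

(* q is the pyramid on the other side of the face of p opposite to color s. *)
Definition adjacent {R : realType} (s : color) (p q : pyramid R) : Prop :=
  [/\ is_pyramid p, is_pyramid q, p s <> q s &
      forall c, c <> s -> p c = q c].

(* The gallery p :: ps starts at p and is encoded by the word w. *)
Fixpoint is_gallery {R : realType} (w : seq color) (p : pyramid R)
    (ps : seq (pyramid R)) : Prop :=
  match w, ps with
  | [::], [::] => is_pyramid p
  | s :: w', q :: ps' => adjacent s p q /\ is_gallery w' q ps'
  | _, _ => False
  end.

Definition closed_gallery {R : realType} (w : seq color) (p : pyramid R)
    (ps : seq (pyramid R)) : Prop :=
  is_gallery w p ps /\ last p ps =1 p.

Definition face_reflection {R : realType} (p : pyramid R) (s : color) :
    'rV[R]_3 -> 'rV[R]_3 :=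
  match s with
  | colA => plane_reflection (p colB) (p colC) (p colD)
  | colB => plane_reflection (p colA) (p colC) (p colD)
  | colC => plane_reflection (p colA) (p colB) (p colD)
  | colD => plane_reflection (p colA) (p colB) (p colC)
  end.

Definition word_isometry {R : realType} (p : pyramid R) (w : seq color) :
    'rV[R]_3 -> 'rV[R]_3 :=
  foldr (fun s f => face_reflection p s \o f) id w.

Definition has_order {T : Type} (f : T -> T) (n : nat) : Prop :=
  [/\ (0 < n)%N, iter n f =1 id &
      forall m, (0 < m < n)%N -> ~ (iter m f =1 id)].

Definition threefold_gallery {R : realType} (g : seq color) (p : pyramid R)
    (ps : seq (pyramid R)) : Prop :=
  closed_gallery (g ++ g ++ g) p ps /\ has_order (word_isometry p g) 3.

Definition barycenter {R : realType} (p : pyramid R) : 'rV[R]_3 :=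
  4^-1 *: (p colA + p colB + p colC + p colD).

(* In a closed gallery the last pyramid repeats the first one: drop it. *)
Definition gallery_vertices {R : realType} (p : pyramid R)
    (ps : seq (pyramid R)) : seq 'rV[R]_3 :=
  map barycenter (belast p ps).

Definition polygon_point {R : realType} (v : seq 'rV[R]_3) (i : nat) (t : R) :
    'rV[R]_3 :=
  (1 - t) *: v`_i + t *: v`_(i.+1 %% size v).

Definition closed_polygon {R : realType} (v : seq 'rV[R]_3) : set 'rV[R]_3 :=
  [set x | exists (i : nat) (t : R),
     [/\ (i < size v)%N, 0 <= t <= 1 & x = polygon_point v i t]].

Definition simple_polygon {R : realType} (v : seq 'rV[R]_3) : Prop :=
  (0 < size v)%N /\
  forall (i j : nat) (s t : R), (i < size v)%N -> (j < size v)%N ->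
    0 <= s < 1 -> 0 <= t < 1 ->
    polygon_point v i s = polygon_point v j t -> i = j /\ s = t.

Definition homeomorphism {R : realType} (f : 'rV[R]_3 -> 'rV[R]_3) : Prop :=
  exists g : 'rV[R]_3 -> 'rV[R]_3,
    [/\ continuous f, continuous g, cancel f g & cancel g f].

Definition ambient_isotopic {R : realType} (K L : set 'rV[R]_3) : Prop :=
  exists H : 'rV[R]_3 * R -> 'rV[R]_3,
    [/\ {within [set xt | 0 <= xt.2 <= 1], continuous H},
        forall t, 0 <= t <= 1 -> homeomorphism (fun x => H (x, t)),
        forall x, H (x, 0) = x &
        (fun x => H (x, 1)) @` K = L].

Definition knots_as {R : realType} (v : seq 'rV[R]_3) (K : set 'rV[R]_3) :
    Prop :=
  simple_polygon v /\ ambient_isotopic (closed_polygon v) K.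

Definition unknot (R : realType) : set 'rV[R]_3 :=
  closed_polygon [:: point3 0 0 0; point3 1 0 0; point3 0 1 0].

(* A hexagonal trefoil, invariant under the cyclic permutation of coordinates.
   Projected along (1,1,1), the second, fourth and sixth edges cross pairwise,
   there are no other crossings, and the diagram is alternating. *)
Definition trefoil (R : realType) : set 'rV[R]_3 :=
  closed_polygon [:: point3 1 0 0; point3 0 (-1) 1;
                     point3 0 1 0; point3 1 0 (-1);
                     point3 0 0 1; point3 (-1) 1 0].

Definition mirror_trefoil (R : realType) : set 'rV[R]_3 := -%R @` trefoil R.

Definition knots_nontrivially {R : realType} (v : seq 'rV[R]_3) : Prop :=
  simple_polygon v /\ ~ ambient_isotopic (closed_polygon v) (unknot R).

Definition knots_as_trefoil {R : realType} (v : seq 'rV[R]_3) : Prop :=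
  knots_as v (trefoil R) \/ knots_as v (mirror_trefoil R).

Definition is_minimum (S : set nat) (n : nat) : Prop :=
  S n /\ forall m, S m -> (n <= m)%N.

(* Main.v *)
(* The idea: a closed polygon changes by an ambient isotopy when a corner is cut
   off along a triangle that no other edge meets, so sequences of such moves,
   checked over the integers, are certificates of equivalence of knots.

   In the frame of its first pyramid a gallery is a walk among the chambers of an
   affine Coxeter group.  Crossing a face reverses the orientation, hence 3k is
   even, and all the self-avoiding walks ggg with g of at most 12 letters can be
   enumerated: cutting off corners reduces each of them to a triangle.  For the
   word ABCADCDCDCABDC the moves lead to the mirror image of the hexagonal
   trefoil.

   The trefoil is not the unknot because its group maps onto the dihedral group
   of order 6.  Homomorphisms to a finite group G are replaced by G-valued local
   systems on the complement, a notion invariant under homeomorphisms.  Local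
   systems are trivial on convex open sets; the complement of a triangle is the
   union of two half-spaces, a prism over the interior, and three half-spaces
   outside the sides, glued by a single element of G, so its monodromy is cyclic.
   The 3-coloring of a grid diagram of the trefoil gives a noncyclic one. *)
Require Import Defs.
From Stdlib Require Import BinInt.
From HB Require Import structures.
From mathcomp Require Import all_boot all_order all_fingroup all_algebra.
From mathcomp Require Import all_classical all_reals all_analysis.
From mathcomp Require Import ring lra zify ssrZ.

Import Order.TTheory GRing.Theory Num.Theory.
Import numFieldNormedType.Exports.
Local Open Scope classical_set_scope.
Local Open Scope ring_scope.
Delimit Scope Z_scope with BinZ.

Set Implicit Arguments.
Unset Strict Implicit.
Unset Printing Implicit Defensive.

(** * Ambient isotopy and triangle moves *)

Section Isotopy.
Context {R : realType}.
Notation V := 'rV[R]_3.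
Implicit Types (K L M : set V).

(** Every certificate is a list of sign conditions on linear functionals, and such conditions
    survive a similarity, orientation-reversing or not. Hence one integer computation, in the frame
    of an abstract base chamber, covers every starting pyramid of the tessellation. There are two
    separators because the tasks differ: the exhaustive search has to treat very many walks, and
    nine fixed functionals suffice for it, whereas the explicit deformations leave the lattice
    directions and need the whole list of separating axes.

    Local systems avoid paths and homotopies: transport is compared between nearby points only, so
    that invariance under homeomorphisms is a substitution and lifting is needed along segments
    only. The noncyclic example lives on a grid diagram instead of the hexagon because there
    transport depends only on the position of the points relative to integer planes, which turns the
    cocycle condition into a finite check; triangle moves carry the conclusion over to the
    hexagon. *)

Lemma ambient_isotopic_refl K : ambient_isotopic K K.
Proof.
exists fst; split => //.
- by apply: continuous_subspaceT => x; apply: cvg_fst.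
- by move=> t _; exists id; split => // x; apply: cvg_id.
- exact: image_id.
Qed.

Lemma homeomorphism_comp (f g : V -> V) :
  homeomorphism f -> homeomorphism g -> homeomorphism (g \o f).
Proof.
move=> [f' [cf cf' fK f'K]] [g' [cg cg' gK g'K]]; exists (f' \o g').
split; [move=> x|move=> x|exact: can_comp|exact: can_comp].
- by apply: continuous_comp; [exact: cf|exact: cg].
- by apply: continuous_comp; [exact: cg'|exact: cf'].
Qed.

Lemma ambient_isotopic_trans K L M :
  ambient_isotopic K L -> ambient_isotopic L M -> ambient_isotopic K M.
Proof.
move=> [H [cH hH H0 HK]] [G [cG hG G0 GL]].
exists (fun xt => G (H xt, xt.2)); split.
- move/subspace_continuousP : cH => cH; move/subspace_continuousP : cG => cG.
  apply/subspace_continuousP => -[x t] /= t01.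
  have /= cGx := cG (H (x, t), t) t01.
  move=> A /cGx /=; rewrite /fmap /within /= => -[[A1 A2] /= [HA1 HA2] sA].
  have := cH (x, t) t01 _ HA1.
  case=> -[B1 B2] /= [HB1 HB2] sB.
  exists (B1, B2 `&` A2) => /=; first by split => //; exact: filterI.
  move=> [x' t'] /= [Bx' [Bt' At']] d; apply: (sA (H (x', t'), t')) => //=.
  by split => //; exact: (sB (x', t')).
- move=> t t01; exact: (homeomorphism_comp (hH t t01) (hG t t01)).
- by move=> x; rewrite /= H0 G0.
- by rewrite -GL -HK image_comp.
Qed.

(** The isotopy is run backwards after its last stage has been undone. This involves the inverse of
    that single stage; the definition gives no joint continuity for the inverses of all stages. *)
Lemma ambient_isotopic_sym K L : ambient_isotopic K L -> ambient_isotopic L K.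
Proof.
move=> [H [cH hH H0 HK]].
have i01 : 0 <= (1 : R) <= 1 by rewrite ler01 lexx.
have [G [cH1 cG HG GH]] := hH 1 i01.
exists (fun xt => H (G xt.1, 1 - xt.2)); split.
- move/subspace_continuousP : cH => cH.
  apply/subspace_continuousP => -[x t] /= t01.
  have t01' : 0 <= 1 - t <= 1 by move: t01 => /andP[? ?]; apply/andP; split; lra.
  have /= cHx := cH (G x, 1 - t) t01'.
  move=> A /cHx /=; rewrite /fmap /within /= => -[[A1 A2] /= [HA1 HA2] sA].
  have HB1 := cG x _ HA1.
  have HB2 : nbhs t ((fun t : R => 1 - t) @^-1` A2).
    have : (fun t : R => 1 - t) @ t --> 1 - t by apply: cvgB => //; exact: cvg_cst.
    exact.
  exists (G @^-1` A1, (fun t : R => 1 - t) @^-1` A2) => //= -[x' t'] /= [B1 B2] /andP[? ?].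
  by apply: (sA (G x', 1 - t')) => //=; apply/andP; split; lra.
- move=> t /andP[t0 t1].
  have t01' : 0 <= 1 - t <= 1 by apply/andP; split; lra.
  apply: (@homeomorphism_comp G (fun x => H (x, 1 - t))); last exact: hH.
  by exists (fun x => H (x, 1)).
- by move=> x; rewrite /= subr0; exact: GH.
- rewrite /= subrr; under eq_imagel do rewrite H0.
  rewrite -HK image_comp -[RHS]image_id; apply: eq_imagel => x _; exact: HG.
Qed.
End Isotopy.

(** * Coordinates, dot and cross products *)

Section Vectors.
Context {R : realType}.
Notation V := 'rV[R]_3.
Implicit Types (u v w : V).

Definition crd (k : nat) (u : V) : R := u 0 (inord k).

Lemma crdD k u v : crd k (u + v) = crd k u + crd k v. Proof. by rewrite /crd mxE. Qed.
Lemma crdN k u : crd k (- u) = - crd k u. Proof. by rewrite /crd mxE. Qed.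
Lemma crdZ k r u : crd k (r *: u) = r * crd k u. Proof. by rewrite /crd mxE. Qed.
Lemma crd0 k : crd k 0 = 0. Proof. by rewrite /crd mxE. Qed.

Lemma crd_point3 x y z :
  (crd 0 (point3 x y z) = x) * (crd 1 (point3 x y z) = y) * (crd 2 (point3 x y z) = z).
Proof. by rewrite /crd /point3 !mxE !inordK. Qed.

Lemma dotE u v : dot u v = crd 0 u * crd 0 v + crd 1 u * crd 1 v + crd 2 u * crd 2 v.
Proof.
rewrite /dot !big_ord_recl big_ord0 addr0 addrA /crd.
by do 3?[congr (_ + _)]; congr (u 0 _ * v 0 _); apply/val_inj; rewrite /= inordK.
Qed.

Lemma crd_cross u v :
  (crd 0 (cross u v) = crd 1 u * crd 2 v - crd 2 u * crd 1 v) *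
  (crd 1 (cross u v) = crd 2 u * crd 0 v - crd 0 u * crd 2 v) *
  (crd 2 (cross u v) = crd 0 u * crd 1 v - crd 1 u * crd 0 v).
Proof. by rewrite /cross !crd_point3. Qed.

Definition crdE := (crdD, crdN, crdZ, crd0, crd_point3, crd_cross).

Lemma vec3P u v : crd 0 u = crd 0 v -> crd 1 u = crd 1 v -> crd 2 u = crd 2 v -> u = v.
Proof.
move=> e0 e1 e2; apply/rowP => -[[|[|[|//]]] lti].
- by move: e0; rewrite /crd; congr (u 0 _ = v 0 _); apply/val_inj; rewrite /= inordK.
- by move: e1; rewrite /crd; congr (u 0 _ = v 0 _); apply/val_inj; rewrite /= inordK.
- by move: e2; rewrite /crd; congr (u 0 _ = v 0 _); apply/val_inj; rewrite /= inordK.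
Qed.

Lemma point3_crd u : point3 (crd 0 u) (crd 1 u) (crd 2 u) = u.
Proof. by apply: vec3P; rewrite crd_point3. Qed.

Lemma dotC u v : dot u v = dot v u. Proof. rewrite !dotE; ring. Qed.
Lemma dotDr u v w : dot u (v + w) = dot u v + dot u w.
Proof. rewrite !dotE !crdE; ring. Qed.
Lemma dotNr u v : dot u (- v) = - dot u v. Proof. rewrite !dotE !crdE; ring. Qed.
Lemma dotZr r u v : dot u (r *: v) = r * dot u v. Proof. rewrite !dotE !crdE; ring. Qed.
Definition dotRE := (dotDr, dotNr, dotZr).

Lemma dot_cross_l u v : dot (cross u v) u = 0. Proof. rewrite !dotE !crdE; ring. Qed.
Lemma dot_cross_r u v : dot (cross u v) v = 0. Proof. rewrite !dotE !crdE; ring. Qed.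
Lemma dot_cross_rot u v w : dot (cross u v) w = dot v (cross w u).
Proof. rewrite !dotE !crdE; ring. Qed.

Lemma dot_gt0 u : u != 0 -> 0 < dot u u.
Proof.
move=> u0; have : dot u u != 0.
  apply: contra_neq u0; rewrite dotE => e.
  by apply: vec3P; rewrite crd0; nra.
by rewrite dotE => d0; rewrite lt_neqAle eq_sym d0 /=; nra.
Qed.

(** Cramer's rule in polynomial form: without division it holds for dependent vectors too. *)
Lemma basis_expand (e v n w : V) :
  dot e (cross v n) *: w =
    dot w (cross v n) *: e + dot w (cross n e) *: v + dot w (cross e v) *: n.
Proof. by apply: vec3P; rewrite !dotE !crdE; ring. Qed.

Lemma crd_continuous k : continuous (crd k).
Proof. exact: coord_continuous. Qed.

Lemma dot_continuous u : continuous (dot u).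
Proof.
move=> x; have -> : dot u = fun x => crd 0 u * crd 0 x + crd 1 u * crd 1 x + crd 2 u * crd 2 x.
  by apply/funext => y; rewrite dotE.
have c k r : (fun y => r * crd k y) @ x --> r * crd k x.
  exact: (cvgMl_tmp (@crd_continuous k x)).
exact: (cvgD (cvgD (c _ _) (c _ _)) (c _ _)).
Qed.

End Vectors.

(** * Piecewise linear pushes along a fixed direction *)

Section Push.
Context {R : realType}.
Notation V := 'rV[R]_3.
Variables (s y z : V -> R) (v : V) (d : R).
Hypothesis d0 : 0 < d.
Hypothesis sv : forall x r, s (x + r *: v) = s x.
Hypothesis zv : forall x r, z (x + r *: v) = z x.
Hypothesis yv : forall x r, y (x + r *: v) = y x + r.
Hypotheses (cs : continuous s) (cy : continuous y) (cz : continuous z).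

Let k x := 1 - `|s x| - `|z x| / d.
(* The tent function of the bipyramid |s| + |z| / d + max (y / (1 + d), - y / d) <= 1:
   pushing along v by t times this function moves the base y = 0 towards the
   apex, and [inv] recovers y from its image because, along v, the push is the
   maximum of y and of the minimum of two increasing affine functions. *)
Definition bump x := Num.max 0 (Num.min (k x - y x / (1 + d)) (k x + y x / d)).

Let inv x t := Num.min (y x)
  (Num.max ((y x - t * k x) / (1 - t / (1 + d))) ((y x - t * k x) / (1 + t / d))).
Let fwd xt := xt.1 + (xt.2 * bump xt.1) *: v.
Let bwd t x := x + (inv x t - y x) *: v.

Let kv x r : k (x + r *: v) = k x. Proof. by rewrite /k sv zv. Qed.

(** This is why the apex of the support has height [1 + d] and not 1: at [t = 1] the slope of the
    upper affine piece is [d / (1 + d)], whereas an apex at height 1 would make it vanish and the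
    push would no longer be injective. *)
Let den1 t : 0 <= t <= 1 -> 0 < 1 - t / (1 + d).
Proof.
have d0' := d0; move=> /andP[t0 t1]; rewrite subr_gt0 ltr_pdivrMr; lra.
Qed.
Let den2 t : 0 <= t <= 1 -> 0 < 1 + t / d.
Proof. by move=> /andP[t0 t1]; have := divr_ge0 t0 (ltW d0); lra. Qed.

Let pushE (u kk t : R) : 0 <= t <= 1 ->
  u + t * Num.max 0 (Num.min (kk - u / (1 + d)) (kk + u / d)) =
  Num.max u (Num.min ((1 - t / (1 + d)) * u + t * kk) ((1 + t / d) * u + t * kk)).
Proof.
have d0' := d0; move=> /andP[t0 _].
rewrite maxr_pMr // minr_pMr // mulr0 addr_maxr addr0 addr_minr.
by congr (Num.max _ (Num.min _ _)); field; rewrite ?gt_eqF //; lra.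
Qed.

Let push_inv (u kk t : R) : 0 <= t <= 1 ->
  let u' := u + t * Num.max 0 (Num.min (kk - u / (1 + d)) (kk + u / d)) in
  Num.min u' (Num.max ((u' - t * kk) / (1 - t / (1 + d))) ((u' - t * kk) / (1 + t / d))) = u.
Proof.
move=> t01 u'; have a0 := den1 t01; have b0 := den2 t01.
have : u' = _ := pushE u kk t01.
move: u' (1 - _) (1 + t / d) (t * kk) a0 b0 => u' a b c a0 b0.
have : (u' - c) / a * a = u' - c by rewrite divfK // gt_eqF.
have : (u' - c) / b * b = u' - c by rewrite divfK // gt_eqF.
move: ((u' - c) / a) ((u' - c) / b) => g1 g2 e2 e1.
case: (ltP (a * u + c) (b * u + c)) => h; case: ltP => h' eu'.
- have -> : g1 = u by apply: (mulIf (lt0r_neq0 a0)); lra.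
  have g2u : g2 <= u by rewrite -(ler_pM2r b0); lra.
  by rewrite (max_idPl g2u); apply/min_idPr; lra.
- have g1u : u <= g1 by rewrite -(ler_pM2r a0); lra.
  by rewrite eu'; apply/min_idPl; rewrite le_max g1u.
- have -> : g2 = u by apply: (mulIf (lt0r_neq0 b0)); lra.
  have g1u : g1 <= u by rewrite -(ler_pM2r a0); lra.
  by rewrite (max_idPr g1u); apply/min_idPr; lra.
- have g2u : u <= g2 by rewrite -(ler_pM2r b0); lra.
  by rewrite eu'; apply/min_idPl; rewrite le_max g2u orbT.
Qed.

Let inv_push (u kk t : R) : 0 <= t <= 1 ->
  let u' := Num.min u (Num.max ((u - t * kk) / (1 - t / (1 + d))) ((u - t * kk) / (1 + t / d))) in
  u' + t * Num.max 0 (Num.min (kk - u' / (1 + d)) (kk + u' / d)) = u.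
Proof.
move=> t01 u'; have a0 := den1 t01; have b0 := den2 t01.
rewrite pushE // /u' {u'}.
move: (1 - _) (1 + t / d) (t * kk) a0 b0 => a b c a0 b0.
have : (u - c) / a * a = u - c by rewrite divfK // gt_eqF.
have : (u - c) / b * b = u - c by rewrite divfK // gt_eqF.
move: ((u - c) / a) ((u - c) / b) => g1 g2 e2 e1.
case: (ltP g1 g2) => h; [case: (ltP u g2) => h'|case: (ltP u g1) => h'].
- apply/max_idPl; rewrite ge_min; apply/orP; right.
  have : u * b <= g2 * b by rewrite ler_pM2r // ltW.
  lra.
- have : g1 * a <= g2 * a by rewrite ler_pM2r // ltW.
  by move=> ?; rewrite (_ : b * g2 + c = u); last lra;
    rewrite (min_idPr _); [apply/max_idPr|lra].
- apply/max_idPl; rewrite ge_min; apply/orP; left.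
  have : u * a <= g1 * a by rewrite ler_pM2r // ltW.
  lra.
- have : g2 * b <= g1 * b by rewrite ler_pM2r // ltW.
  by move=> ?; rewrite (_ : a * g1 + c = u); last lra;
    rewrite (min_idPl _); [apply/max_idPr|lra].
Qed.

Let ck : continuous k.
Proof.
move=> x.
have hs : `|s x'| @[x' --> x] --> `|s x|.
  by apply: (@continuous_comp _ _ _ s Num.norm); [exact: cs|exact: norm_continuous].
have hz : `|z x'| @[x' --> x] --> `|z x|.
  by apply: (@continuous_comp _ _ _ z Num.norm); [exact: cz|exact: norm_continuous].
exact: (cvgB (cvgB (cvg_cst _) hs) (cvgM hz (cvg_cst _))).
Qed.

Let cbump : continuous bump.
Proof.
move=> x; apply: (@continuous_max R V (fun=> 0)); last first.
- apply: (@continuous_min R V (fun x => k x - y x / (1 + d)) (fun x => k x + y x / d)).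
    exact: (cvgB (@ck x) (cvgM (@cy x) (cvg_cst _))).
  exact: (cvgD (@ck x) (cvgM (@cy x) (cvg_cst _))).
- have h := @cvg_cst R 0 V (nbhs x) _; exact: h.
Qed.

Let cinv t : continuous (inv ^~ t).
Proof.
have cyk x : y x' - t * k x' @[x' --> x] --> y x - t * k x.
  exact: (cvgB (@cy x) (cvgM (cvg_cst _) (@ck x))).
move=> x; apply: (@continuous_min R V y); first exact: cy.
by apply: (@continuous_max R V (fun x => (y x - t * k x) / (1 - t / (1 + d)))
                            (fun x => (y x - t * k x) / (1 + t / d)));
  exact: (cvgM (cyk x) (cvg_cst _)).
Qed.

Lemma push_isotopy (K : set V) :
  ambient_isotopic K ((fun x => x + bump x *: v) @` K).
Proof.
exists fwd; split.
- apply: continuous_subspaceT => -[x t]; rewrite /fwd /=.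
  apply: cvgD; first exact: cvg_fst.
  apply: cvgZr_tmp.
  apply: cvgM; first exact: cvg_snd.
  by apply: (@continuous_comp _ _ _ fst bump); [exact: cvg_fst|exact: cbump].
- move=> t t01; exists (bwd t); split.
  + move=> x; exact: (cvgD cvg_id (cvgZr_tmp (cvgM (cvg_cst _) (@cbump x)))).
  + move=> x; exact: (cvgD cvg_id (cvgZr_tmp (cvgB (@cinv t x) (@cy x)))).
  + move=> x; rewrite /bwd /fwd /= /inv yv kv (push_inv (y x) (k x) t01).
    by rewrite -addrA -scalerDl [X in X *: v](_ : _ = 0) ?scale0r ?addr0 //; ring.
  + move=> x; rewrite /bwd /fwd /= -addrA -scalerDl /bump kv yv.
    have := inv_push (y x) (k x) t01; rewrite -/(inv x t) /= => e.
    rewrite (_ : y x + (inv x t - y x) = inv x t); last by ring.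
    by rewrite [X in X *: v](_ : _ = 0) ?scale0r ?addr0 //; move: e; lra.
- by move=> x; rewrite /fwd /= mul0r scale0r addr0.
- by apply: eq_imagel => x _; rewrite /fwd /= mul1r.
Qed.
End Push.

Lemma basis_decomposition (R : realType) (e v n w : 'rV[R]_3) :
  dot e (cross v n) != 0 ->
  w = (dot (cross v n) w / dot e (cross v n)) *: e +
      (dot (cross n e) w / dot e (cross v n)) *: v +
      (dot (cross e v) w / dot e (cross v n)) *: n.
Proof.
move=> D0; apply: (scalerI D0).
rewrite {1}basis_expand !scalerDr !scalerA.
by congr (_ *: _ + _ *: _ + _ *: _); rewrite [RHS]mulrC divfK // dotC.
Qed.

(** * Replacing one side of a triangle by the two others *)

Section TriangleMove.
Context {R : realType}.
Notation V := 'rV[R]_3.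
Implicit Types (a b c p q x : V).

Definition seg p q : set V := [set x | exists2 t : R, 0 <= t <= 1 & x = (1 - t) *: p + t *: q].

Definition segs (es : seq (V * V)) : set V := [set x | exists2 e, e \in es & seg e.1 e.2 x].

(* An affine functional that is positive on the triangle abc, except possibly at
   one of the vertices a and b, separates the triangle from pq. *)
Definition avoids a b c p q := exists (n : V) (r : R),
  let l x := dot n x - r in
  [/\ 0 <= l a, 0 <= l b, 0 < l a + l b, 0 < l c & l p <= 0 /\ l q <= 0].

Section Move.
Variables a b c : V.
Hypothesis abc : cross (b - a) (c - a) != 0.
(** In the coordinates [(s, y, z)] defined from this origin and the directions [e], [v], [n], the
    points [a], [b], [c] are [(-1, 0, 0)], [(1, 0, 0)] and [(0, 1, 0)]. *)
Let m := 2^-1 *: (a + b).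
Let e := 2^-1 *: (b - a).
Let v := c - m.
Let n := cross e v.
Let N := dot e (cross v n).
Let s x := dot (cross v n) (x - m) / N.
Let y x := dot (cross n e) (x - m) / N.
Let z x := dot n (x - m) / N.

Let N0 : 0 < N.
Proof.
suff -> : N = 4^-1 * dot (cross (b - a) (c - a)) (cross (b - a) (c - a)).
  by apply: mulr_gt0; [lra|exact: dot_gt0].
by rewrite /N /n /v /e /m !dotE !crdE; field.
Qed.

Let expand x : x = m + s x *: e + y x *: v + z x *: n.
Proof.
by rewrite -[LHS](subrK m) addrC -!addrA; congr (_ + _); rewrite addrA;
  apply: basis_decomposition; rewrite gt_eqF.
Qed.

Let dsv : dot (cross v n) v = 0. Proof. exact: dot_cross_l. Qed.
Let dyv : dot (cross n e) v = N. Proof. exact: dot_cross_rot. Qed.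
Let dzv : dot n v = 0. Proof. exact: dot_cross_r. Qed.

Let shift u x r : dot u (x + r *: v - m) = dot u (x - m) + r * dot u v.
Proof. by rewrite addrAC !dotRE. Qed.

Let sv x r : s (x + r *: v) = s x. Proof. by rewrite /s shift dsv mulr0 addr0. Qed.
Let zv x r : z (x + r *: v) = z x. Proof. by rewrite /z shift dzv mulr0 addr0. Qed.
Let yv x r : y (x + r *: v) = y x + r.
Proof. by rewrite /y shift dyv; field; rewrite gt_eqF. Qed.

Let cl u : continuous (fun x => dot u (x - m) / N).
Proof.
move=> x; have h : dot u (x' - m) @[x' --> x] --> dot u (x - m).
  apply: (@continuous_comp _ _ _ (fun x => x - m) (dot u)); last exact: dot_continuous.
  exact: (cvgB cvg_id (cvg_cst _)).
exact: (cvgM h (cvg_cst _)).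
Qed.

Let bp d x := bump s y z d x.

(** The coordinate [s] of the point is [2t - 1]. So the push fixes [a] and [b], moves their midpoint
    to [c], and bends the side into the path from [a] through [c] to [b]. *)
Let bump_ab d t : 0 < d -> 0 <= t <= 1 -> bp d ((1 - t) *: a + t *: b) = 1 - `|t *+ 2 - 1|.
Proof.
move=> d0 /andP[t0 t1]; set x := (1 - t) *: a + t *: b.
have -> : x = m + (t *+ 2 - 1) *: e.
  by rewrite /x /m /e; apply: vec3P; rewrite !crdE; field.
rewrite /bp /bump.
have E u : dot u (m + (t *+ 2 - 1) *: e - m) = (t *+ 2 - 1) * dot u e.
  by rewrite addrAC subrr add0r dotZr.
rewrite /s /y /z !E.
have -> : dot (cross v n) e = N by rewrite dotC.
have -> : dot (cross n e) e = 0 by exact: dot_cross_r.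
have -> : dot n e = 0 by exact: dot_cross_l.
rewrite !mulr0 !mul0r normr0 mul0r !subr0 addr0 minxx mulfK ?gt_eqF //.
apply/max_idPr; rewrite subr_ge0 ler_norml; lra.
Qed.

(** The edges next to the corner touch the triangle at [a] or [b], so no fixed distance keeps them
    off the support. But the support narrows towards these vertices: at abscissa [s] its size is
    proportional to [1 - |s|], and so is the lower bound for the functional on the triangle. Hence
    one small [d] makes the functional positive on the whole support. *)
Let avoids_bump p q : avoids a b c p q ->
  exists2 d0 : R, 0 < d0 & forall d, 0 < d -> d <= d0 -> forall x, seg p q x -> bp d x = 0.
Proof.
case=> u [r] /= [la lb lab lc [lp lq]].
pose lam x := dot u x.
set l := fun x => dot u x - r.
have lD x w : l (x + w) = l x + dot u w by rewrite /l dotDr addrAC.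
have lm : l m = (l a + l b) / 2 by rewrite /l /m !dotRE; field.
have le_ : dot u e = (l b - l a) / 2 by rewrite /l /e !dotRE; field.
have lv : dot u v = l c - l m by rewrite /l /v !dotRE; ring.
have lm0 : 0 < l m by rewrite lm /l; lra.
have lc0 : 0 < l c by [].
pose mu := Num.min (l m) (l c).
have mu0 : 0 < mu by rewrite /mu lt_min lm0.
pose C := `|dot u v| + `|dot u n| + 1.
have C0 : 0 < C by rewrite /C; have := normr_ge0 (dot u v); have := normr_ge0 (dot u n); lra.
exists (mu / C); first exact: divr_gt0.
move=> d d0; rewrite ler_pdivlMr // => dC x [t /andP[t0 t1] xE].
apply/eqP; rewrite eq_le /bp /bump le_max lexx andbT ge_max lexx /= leNgt.
rewrite lt_min; apply/negP => /andP[h1 h2].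
have : 0 < l x; last first.
  have -> : l x = (1 - t) * l p + t * l q by rewrite xE /l !dotRE; ring.
  by rewrite /l; nra.
rewrite (expand x) !lD (dotZr (s x)) (dotZr (y x)) (dotZr (z x)).
have k1 : 0 <= `|z x| / d by rewrite divr_ge0 // ltW.
move: h1 h2 k1; set k := 1 - `|s x|; set w := `|z x| / d => h1 h2 k1.
have zw : `|z x| = d * w by rewrite /w mulrCA divff ?mulr1 // gt_eqF.
have y1 : y x < (1 + d) * (k - w).
  by move: h1; rewrite subr_gt0 ltr_pdivrMr 1?mulrC //; lra.
have y2 : - (d * (k - w)) < y x.
  have : - y x / d < k - w by move: h2; rewrite mulNr; lra.
  by rewrite ltr_pdivrMr //; lra.
have kw : 0 < k - w by nra.
have k0 : 0 < k by lra.
have F1 : k * l m <= l m + s x * dot u e.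
  have : `|s x * dot u e| <= `|s x| * l m.
    by rewrite normrM ler_wpM2l // le_ ler_norml lm /l; lra.
  rewrite ler_norml /k => /andP[? _]; lra.
have F2 : k * mu - d * k * `|dot u v| <= k * l m + y x * dot u v.
  have m1 : mu <= l m by rewrite /mu ge_min lexx.
  have m2 : mu <= l m + dot u v by rewrite lv /mu ge_min addrC subrK lexx orbT.
  have yk1 : y x < (1 + d) * k by nra.
  have yk2 : - (d * k) < y x by nra.
  case: (lerP 0 (dot u v)) => hv.
    rewrite ger0_norm //.
    have : 0 <= k * (l m - mu) by apply: mulr_ge0; [exact: ltW|rewrite subr_ge0].
    have : 0 <= (y x + d * k) * dot u v by apply: mulr_ge0 => //; lra.
    lra.
  rewrite ltr0_norm //.
  have : 0 <= k * (l m + dot u v - mu) by apply: mulr_ge0; [exact: ltW|rewrite subr_ge0].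
  have : 0 <= (y x - (1 + d) * k) * dot u v by apply: mulr_le0; [lra|exact: ltW].
  lra.
have F3 : - (d * k * `|dot u n|) <= z x * dot u n.
  have : `|z x * dot u n| <= d * k * `|dot u n|.
    by rewrite normrM ler_wpM2r // zw; apply: ler_wpM2l; lra.
  by rewrite ler_norml => /andP[].
have F4 : d * k * C <= k * mu by have := ler_wpM2l (ltW k0) dC; lra.
have : d * k * (`|dot u v| + `|dot u n|) < k * mu.
  by move: F4; rewrite /C; have := mulr_gt0 d0 k0; lra.
lra.
Qed.

Lemma triangle_move (es : seq (V * V)) :
  (forall f, f \in es -> avoids a b c f.1 f.2) ->
  ambient_isotopic (seg a b `|` segs es) (seg a c `|` seg c b `|` segs es).
Proof.
move=> avo.
have [d d0 dP] : exists2 d, 0 < d & forall x, segs es x -> bp d x = 0.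
  suff [d0 d00 H] : exists2 d0, 0 < d0 & forall d, 0 < d -> d <= d0 -> forall x, segs es x -> bp d x = 0.
    by exists d0 => // x; exact: H.
  elim: es avo => [_|f es IH avo]; first by exists 1 => // d _ _ x [].
  have [f' f'es|d1 d10 H1] := IH; first by apply: avo; rewrite inE f'es orbT.
  have [|d2 d20 H2] := @avoids_bump f.1 f.2; first by apply: avo; rewrite inE eqxx.
  exists (Num.min d1 d2); first by rewrite lt_min d10.
  move=> d d0; rewrite le_min => /andP[dd1 dd2] x [f' ]; rewrite inE => /orP[/eqP ->|f'es] xf.
    exact: H2 xf.
  by apply: (H1 d) => //; exists f'.
have := push_isotopy d0 sv zv yv (@cl _) (@cl _) (@cl _) (seg a b `|` segs es).
rewrite image_setU; congr (ambient_isotopic _ (_ `|` _)); last first.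
  rewrite -[RHS]image_id; apply: eq_imagel => x xes.
  by rewrite -/(bp d x) dP // scale0r addr0.
have E1 t : 0 <= t <= 1 -> t <= 2^-1 ->
    (1 - t) *: a + t *: b + (1 - `|t *+ 2 - 1|) *: v = (1 - t *+ 2) *: a + (t *+ 2) *: c.
  move=> _ t2; rewrite ler0_norm; last by lra.
  by rewrite /v /m; apply: vec3P; rewrite !crdE; field.
have E2 t : 0 <= t <= 1 -> 2^-1 <= t ->
    (1 - t) *: a + t *: b + (1 - `|t *+ 2 - 1|) *: v = (2 - t *+ 2) *: c + (t *+ 2 - 1) *: b.
  move=> _ t2; rewrite ger0_norm; last by lra.
  by rewrite /v /m; apply: vec3P; rewrite !crdE; field.
apply/seteqP; split => [_ [_ [t t01 ->] <-]|x [] [t t01 ->]].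
- rewrite -/(bp d _) bump_ab //; move: (t01) => /andP[t0 t1].
  case: (lerP t 2^-1) => h.
    by left; rewrite E1 //; exists (t *+ 2) => //; apply/andP; split; lra.
  right; rewrite E2 //; last exact: ltW.
  by exists (t *+ 2 - 1); [apply/andP; split; lra|congr (_ *: _ + _); ring].
- move: (t01) => /andP[t0 t1]; have t01' : 0 <= t / 2 <= 1 by apply/andP; split; lra.
  exists ((1 - t / 2) *: a + (t / 2) *: b); first by exists (t / 2).
  by rewrite -/(bp d _) bump_ab // E1 //; [congr (_ *: _ + _ *: _); field|lra].
- move: (t01) => /andP[t0 t1].
  have t01' : 0 <= (1 + t) / 2 <= 1 by apply/andP; split; lra.
  exists ((1 - (1 + t) / 2) *: a + ((1 + t) / 2) *: b); first by exists ((1 + t) / 2).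
  by rewrite -/(bp d _) bump_ab // E2 //; [congr (_ *: _ + _ *: _); field|lra].
Qed.

End Move.
End TriangleMove.

(** * Closed polygons and the isotopy of all triangles *)

Section Polygons.
Context {R : realType}.
Notation V := 'rV[R]_3.
Implicit Types (a b c p q u w : V).

Fixpoint edges {T : Type} (x : T) (s : seq T) : seq (T * T) :=
  if s is y :: s' then (x, y) :: edges y s' else [::].

Lemma edges_cat (T : Type) (x : T) s1 s2 :
  edges x (s1 ++ s2) = edges x s1 ++ edges (last x s1) s2.
Proof. by elim: s1 x => //= y s1 IH x; rewrite IH. Qed.

Lemma edges_map (T U : Type) (f : T -> U) x s :
  edges (f x) (map f s) = [seq (f e.1, f e.2) | e <- edges x s].
Proof. by elim: s x => //= y s IH x; rewrite IH. Qed.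

Lemma mem_edges (T : eqType) (d x : T) s (e : T * T) :
  reflect (exists2 i, (i < size s)%N & e = (nth d (x :: s) i, nth d s i)) (e \in edges x s).
Proof.
elim: s x => [|y s IH] x /=; first by apply: (iffP idP) => // -[].
rewrite in_cons; apply: (iffP orP) => [[/eqP ->|/(IH y)[i ? ->]]|[[|i] ? eE]].
- by exists 0%N.
- by exists i.+1.
- by rewrite eE eqxx; left.
- by right; apply/(IH y); exists i.
Qed.

Lemma closed_polygonE x (s : seq V) : closed_polygon (x :: s) = segs (edges x (rcons s x)).
Proof.
have E i : (i < (size s).+1)%N ->
    (nth 0 (x :: rcons s x) i, nth 0 (rcons s x) i) =
    ((x :: s)`_i, (x :: s)`_(i.+1 %% (size s).+1)).
  rewrite ltnS leq_eqVlt => /predU1P[->|si].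
    by rewrite modnn -rcons_cons nth_rcons /= ltnS leqnn nth_rcons ltnn eqxx.
  by rewrite modn_small // -rcons_cons nth_rcons /= ltnS ltnW // nth_rcons si.
apply/seteqP; split => y.
- move=> [i [t [/= si t01 ->]]]; exists ((x :: s)`_i, (x :: s)`_(i.+1 %% (size s).+1)).
    by apply/(mem_edges 0); exists i; rewrite ?size_rcons // E.
  by exists t.
- move=> [e /(mem_edges 0)[i]]; rewrite size_rcons => si; rewrite E // => -> [t t01 ->].
  by exists i, t.
Qed.

Lemma segs_cons (e : V * V) es : segs (e :: es) = seg e.1 e.2 `|` segs es.
Proof.
apply/seteqP; split => y.
  by move=> [f]; rewrite inE => /predU1P[->|fes] yf; [left|right; exists f].
by move=> [ye|[f fes yf]]; [exists e|exists f]; rewrite // inE ?eqxx ?fes ?orbT.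
Qed.

Lemma eq_segs (es fs : seq (V * V)) : es =i fs -> segs es = segs fs.
Proof. by move=> ef; apply/seteqP; split => y [f fe yf]; exists f; rewrite // ?ef // -ef. Qed.

Lemma closed_polygon_rot1 x (s : seq V) : closed_polygon (rcons s x) = closed_polygon (x :: s).
Proof.
case: s => [|y s] //=; rewrite !closed_polygonE; apply: eq_segs => e.
by rewrite rcons_cons /= in_cons -[rcons (rcons s x) y]cats1 edges_cat last_rcons mem_cat inE orbC.
Qed.

Lemma closed_polygon_rot n (s : seq V) : closed_polygon (rot n s) = closed_polygon s.
Proof.
elim: n => [|n IH]; first by rewrite rot0.
have [sn|sn] := ltnP n (size s); last by rewrite rot_oversize // ltnW.
by rewrite rotS // -IH; case: (rot n s) => // x t; rewrite rot1_cons closed_polygon_rot1.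
Qed.

Lemma polygon_move a c b (l : seq V) : cross (b - a) (c - a) != 0 ->
  (forall f, f \in edges b (rcons l a) -> avoids a b c f.1 f.2) ->
  ambient_isotopic (closed_polygon (a :: c :: b :: l)) (closed_polygon (a :: b :: l)).
Proof.
move=> abc avo; apply: ambient_isotopic_sym.
by rewrite !closed_polygonE /= !segs_cons /= setUA; exact: triangle_move.
Qed.

Lemma segC p q : seg p q = seg q p.
Proof.
suff sub u w : seg u w `<=` seg w u by apply/seteqP; split; exact: sub.
move=> x [t /andP[t0 t1] ->]; exists (1 - t); first by apply/andP; split; lra.
by rewrite subKr addrC.
Qed.

Lemma triangleE a b c : closed_polygon [:: a; b; c] = seg a b `|` seg b c `|` seg c a.
Proof. by rewrite closed_polygonE /= !segs_cons /= (_ : segs [::] = set0) ?setU0 ?setUA //; apply/seteqP; split => // x []. Qed.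

Lemma triangle_rot a b c : closed_polygon [:: a; b; c] = closed_polygon [:: b; c; a].
Proof. by rewrite -(closed_polygon_rot1 a [:: b; c]). Qed.

Lemma triangle_swap a b c : closed_polygon [:: a; b; c] = closed_polygon [:: b; a; c].
Proof. by rewrite !triangleE (segC b a) (segC c a) (segC b c) -!setUA; congr (_ `|` _); rewrite setUC. Qed.

Definition noncollinear a b c := cross (b - a) (c - a) != 0.

Lemma cross_eq0 u w : reflect (forall x, dot (cross u w) x = 0) (cross u w == 0).
Proof.
apply: (iffP eqP) => [-> x|H]; first by rewrite dotE !crd0 !mul0r !addr0.
by apply/eqP/negPn/negP => /dot_gt0; rewrite H ltxx.
Qed.

Lemma noncollinear_rot a b c : noncollinear a b c = noncollinear b c a.
Proof. by rewrite /noncollinear; congr (_ != 0); apply: vec3P; rewrite !crdE; ring. Qed.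

Lemma noncollinear_swap a b c : noncollinear a b c = noncollinear b a c.
Proof.
rewrite /noncollinear; have -> : cross (b - a) (c - a) = - cross (a - b) (c - b).
  by apply: vec3P; rewrite !crdE; ring.
by rewrite oppr_eq0.
Qed.

(** Off the plane of the triangle, [p] forms with [a], [b], [c] a nondegenerate tetrahedron, and an
    affine functional can be prescribed at its four vertices. So [p] may be inserted between [a] and
    [b], and then [a] may be cut off. *)
Lemma triangle_apex_step a b c p : noncollinear a b c ->
  dot (cross (b - a) (c - a)) (p - a) != 0 ->
  ambient_isotopic (closed_polygon [:: a; b; c]) (closed_polygon [:: p; b; c]).
Proof.
move=> abc D0; set D := dot _ _ in D0.
have [ev ev1] : exists ev : R -> R -> R -> R -> V * R,
    forall ra rb rc rp, let l := fun x => dot (ev ra rb rc rp).1 x - (ev ra rb rc rp).2 in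
    [/\ l a = ra, l b = rb, l c = rc & l p = rp].
  exists (fun ra rb rc rp =>
    let n := D^-1 *: ((rb - ra) *: cross (c - a) (p - a) + (rc - ra) *: cross (p - a) (b - a)
                      + (rp - ra) *: cross (b - a) (c - a)) in (n, dot n a - ra)).
  move=> ra rb rc rp /=; set n := D^-1 *: _.
  have En x : D * dot n x = (rb - ra) * dot (cross (c - a) (p - a)) x +
     (rc - ra) * dot (cross (p - a) (b - a)) x + (rp - ra) * dot (cross (b - a) (c - a)) x.
    by rewrite /n dotC !dotRE mulrA divff // mul1r !(dotC x).
  have l1 x : D * (dot n x - dot n a) = D * dot n (x - a) by rewrite !dotRE.
  have l2 r x : D * dot n (x - a) = D * (r - ra) -> dot n x - (dot n a - ra) = r.
    by move=> e; have := mulfI D0 (etrans (l1 x) e); lra.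
  split; first (by ring); apply: l2; by rewrite En /D !dotE !crdE; ring.
apply: (@ambient_isotopic_trans _ _ (closed_polygon [:: a; p; b; c])).
- apply: ambient_isotopic_sym; apply: polygon_move.
    apply/cross_eq0 => H; move/eqP: D0; apply.
    transitivity (- dot (cross (b - a) (p - a)) (c - a)); last by rewrite H oppr0.
    by rewrite /D !dotE !crdE; ring.
  move=> f /=; rewrite !inE => /orP[|] /eqP -> /=.
  + have [la lb lc lp] := ev1 1 0 0 1; exists (ev 1 0 0 1).1, (ev 1 0 0 1).2 => /=.
    rewrite la lb lc lp; split; [lra|lra|lra|lra|split; lra].
  + have [la lb lc lp] := ev1 0 1 0 1; exists (ev 0 1 0 1).1, (ev 0 1 0 1).2 => /=.
    rewrite la lb lc lp; split; [lra|lra|lra|lra|split; lra].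
rewrite -(closed_polygon_rot 3) /= [closed_polygon [:: p; b; c]](_ : _ = closed_polygon [:: c; p; b]); last first.
  by rewrite triangle_rot triangle_rot.
apply: polygon_move.
  apply/cross_eq0 => H; move/eqP: D0; apply.
  transitivity (dot (cross (p - c) (a - c)) (b - c)); last exact: H.
  by rewrite /D !dotE !crdE; ring.
move=> f /=; rewrite !inE => /orP[|] /eqP -> /=.
+ have [la lb lc lp] := ev1 1 0 1 0; exists (ev 1 0 1 0).1, (ev 1 0 1 0).2 => /=.
  rewrite la lb lc lp; split; [lra|lra|lra|lra|split; lra].
+ have [la lb lc lp] := ev1 1 0 0 1; exists (ev 1 0 0 1).1, (ev 1 0 0 1).2 => /=.
  rewrite la lb lc lp; split; [lra|lra|lra|lra|split; lra].
Qed.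

Lemma triangle_apex a a' b c : noncollinear a b c -> noncollinear a' b c ->
  ambient_isotopic (closed_polygon [:: a; b; c]) (closed_polygon [:: a'; b; c]).
Proof.
move=> abc a'bc; pose n x := cross (b - x) (c - x).
(* Both planes pass through [b]. A displacement leaving both is the sum of the normals if they are
   orthogonal, and [n a] alone otherwise. *)
have [p pa pa'] : exists2 p, dot (n a) (p - a) != 0 & dot (n a') (p - a') != 0.
  have nb x w : dot (n x) (b + w - x) = dot (n x) w.
    by rewrite /n !dotE !crdE; ring.
  have [a0|a0] := eqVneq (dot (n a) (n a')) 0.
    exists (b + (n a + n a')); rewrite nb dotDr ?a0 ?addr0 ?(dotC (n a')) ?a0 ?add0r gt_eqF // dot_gt0 //.
  exists (b + n a); rewrite nb; first by rewrite gt_eqF // dot_gt0.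
  by rewrite dotC.
apply: (ambient_isotopic_trans (triangle_apex_step abc pa)).
exact/ambient_isotopic_sym/(triangle_apex_step a'bc pa').
Qed.

(** Vertices are exchanged one at a time, as in Steinitz' lemma, through triangles that stay
    nondegenerate. *)
Lemma triangle_isotopic a b c a' b' c' : noncollinear a b c -> noncollinear a' b' c' ->
  ambient_isotopic (closed_polygon [:: a; b; c]) (closed_polygon [:: a'; b'; c']).
Proof.
move=> abc abc'.
have [b0 [c0 [abc0 iso0]]] : exists b0 c0, noncollinear a' b0 c0 /\
    ambient_isotopic (closed_polygon [:: a; b; c]) (closed_polygon [:: a'; b0; c0]).
  have [h|/negPn/eqP h1] := boolP (noncollinear a' b c).
    by exists b, c; split => //; exact: triangle_apex.
  have [h|/negPn/eqP h2] := boolP (noncollinear a' c a).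
    exists c, a; split => //; rewrite triangle_rot; apply: triangle_apex => //.
    by rewrite -noncollinear_rot.
  have [h|/negPn/eqP h3] := boolP (noncollinear a' a b).
    exists a, b; split => //; rewrite triangle_rot triangle_rot; apply: triangle_apex => //.
    by rewrite noncollinear_rot.
  (* The vector area of [abc] is the sum of those of the three triangles that [a'] spans with the
     sides, so they cannot all vanish. *)
  suff : cross (b - a) (c - a) == 0 by move=> E; move: abc; rewrite /noncollinear E.
  rewrite (_ : cross _ _ = cross (b - a') (c - a') + cross (c - a') (a - a') + cross (a - a') (b - a')).
    by rewrite h1 h2 h3 !addr0.
  by apply: vec3P; rewrite !crdE; ring.
apply: (ambient_isotopic_trans iso0) => {iso0 abc a b c}.
have [c1 [abc1 iso1]] : exists c1, noncollinear a' b' c1 /\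
    ambient_isotopic (closed_polygon [:: a'; b0; c0]) (closed_polygon [:: a'; b'; c1]).
  have [h|/negPn/eqP h1] := boolP (noncollinear a' b' c0).
    exists c0; split => //; rewrite ![closed_polygon [:: a'; _; _]]triangle_swap.
    by apply: triangle_apex; rewrite noncollinear_swap.
  have [h|/negPn/eqP h2] := boolP (noncollinear a' b' b0).
    exists b0; split => //; rewrite -triangle_rot [X in ambient_isotopic _ X]triangle_swap.
    by apply: triangle_apex; [rewrite noncollinear_rot|rewrite noncollinear_swap].
  (* In the remaining case [w] is parallel to both of the independent vectors [u] and [v], hence
     zero, against the nondegeneracy of the target triangle. *)
  pose w := b' - a'; pose u := b0 - a'; pose v := c0 - a'; pose N := cross u v.
  have E x y : cross w x = 0 -> dot (cross w x) y = 0 by move=> ->; rewrite dotE !crd0 !mul0r !addr0.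
  have D0 : dot u (cross v N) != 0.
    by rewrite -dot_cross_rot dotC -dot_cross_rot gt_eqF // dot_gt0.
  have w0 : w = 0.
    apply: (scalerI D0); rewrite scaler0 basis_expand.
    have -> : dot w (cross v N) = dot (cross w v) N by rewrite !dotE !crdE; ring.
    have -> : dot w (cross N u) = - dot (cross w u) N by rewrite !dotE !crdE; ring.
    have -> : dot w (cross u v) = dot (cross w u) v by rewrite !dotE !crdE; ring.
    by rewrite !E // oppr0 !scale0r !addr0.
  move: abc'; rewrite /noncollinear -/w w0 => /cross_eq0; case => x.
  by rewrite dotE !crdE; ring.
apply: (ambient_isotopic_trans iso1).
rewrite [X in ambient_isotopic X]triangle_rot [X in ambient_isotopic _ X]triangle_rot.
rewrite [X in ambient_isotopic X]triangle_rot [X in ambient_isotopic _ X]triangle_rot.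
by apply: triangle_apex; rewrite noncollinear_rot.
Qed.

Lemma triangle_unknot a b c : noncollinear a b c ->
  ambient_isotopic (closed_polygon [:: a; b; c]) (unknot R).
Proof.
move=> abc; apply: triangle_isotopic => //; apply/negP => /cross_eq0/(_ (point3 0 0 1)).
by rewrite !dotE !crdE; lra.
Qed.
End Polygons.

(** * Local systems on knot complements *)

Section Segment.
Context {R : realType}.

(* Connectedness of the segment [a, b]. *)
Lemma segment_induction (a b : R) (P : R -> Prop) :
  (forall t, a <= t <= b -> \forall s \near t, a <= s <= b -> (P s <-> P t)) ->
  forall s t, a <= s <= b -> a <= t <= b -> P s -> P t.
Proof.
move: P; have up (P : R -> Prop) :
    (forall t, a <= t <= b -> \forall s \near t, a <= s <= b -> (P s <-> P t)) ->
    forall s t, a <= s -> s <= t -> t <= b -> P s -> P t.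
  move=> HP s t sa st tb Ps.
  pose S := [set u | s <= u <= t /\ forall v, s <= v <= u -> P v].
  have Ss : S s by split => [|v /andP[? ?]]; [rewrite lexx|have -> : v = s by apply/le_anti/andP].
  have supS : has_sup S by split; [exists s|exists t => u [/andP[]]].
  set m := sup S.
  have sm : s <= m by exact: sup_upper_bound.
  have mt : m <= t by apply: sup_le_ub => [|u [/andP[]]]; first by exists s.
  have mab : a <= m <= b by rewrite (le_trans sa sm) (le_trans mt tb).
  have [e /= e0 He] := HP m mab.
  have [u Su mu] := sup_adherent e0 supS.
  have um : u <= m by exact: sup_upper_bound.
  case: Su => /andP[su ut] Pu.
  have Hm v : `|m - v| < e -> a <= v <= b -> (P v <-> P m) by move=> ? ?; exact: He.
  have Pm : P m.
    apply/(Hm u); first by rewrite ger0_norm ?subr_ge0 // ltrBlDr -ltrBlDl.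
    - by rewrite (le_trans sa su) (le_trans ut tb).
    - by apply: Pu; rewrite su lexx.
  have Pall v : s <= v -> v <= t -> v < m + e -> P v.
    move=> sv vt ve; case: (lerP v u) => vu; first by apply: Pu; rewrite sv.
    apply/(Hm v) => //; first by rewrite ltr_norml; apply/andP; split; rewrite -/m in mu; lra.
    by rewrite (le_trans sa sv) (le_trans vt tb).
  case: (ltrP t (m + e)) => te; first exact: Pall.
  have : S (m + e / 2).
    split; first by apply/andP; split; lra.
    by move=> v /andP[sv vm]; apply: Pall => //; lra.
  move=> /(sup_upper_bound supS); rewrite -/m; lra.
move=> P HP s t /andP[sa sb] /andP[ta tb] Ps.
case: (lerP s t) => [st|/ltW ts]; first exact: (up P HP s t).
apply: contrapT => nPt; apply: (up (fun r => ~ P r) _ t s) Ps => // r rab.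
by have := HP r rab; apply: filterS => q Pqr /Pqr [? ?]; split => nP /[dup] ?; tauto.
Qed.

End Segment.

Section Convex.
Context {R : realType}.
Notation V := 'rV[R]_3.

Definition is_convex (W : set V) := forall x y, W x -> W y -> seg x y `<=` W.

Lemma is_convexI W1 W2 : is_convex W1 -> is_convex W2 -> is_convex (W1 `&` W2).
Proof. by move=> c1 c2 x y [? ?] [? ?] z xyz; split; [exact: (c1 x y)|exact: (c2 x y)]. Qed.

Definition line (x y : V) (t : R) : V := (1 - t) *: x + t *: y.

Lemma line0 x y : line x y 0 = x.
Proof. by rewrite /line subr0 scale1r scale0r addr0. Qed.
Lemma line1 x y : line x y 1 = y.
Proof. by rewrite /line subrr scale1r scale0r add0r. Qed.

Lemma line_continuous x : continuous (fun yt : V * R => line x yt.1 yt.2).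
Proof.
move=> [y t]; rewrite /line /=.
have ct : yt.2 @[yt --> (y, t)] --> t by exact: cvg_snd.
have cy : yt.1 @[yt --> (y, t)] --> y by exact: cvg_fst.
have h1 : (1 - yt.2)%R @[yt --> (y, t)] --> (1 - t)%R by exact: (cvgB (cvg_cst _) ct).
have h2 : (1 - yt.2) *: x @[yt --> (y, t)] --> (1 - t) *: x by exact: cvgZr_tmp.
have h3 : yt.2 *: yt.1 @[yt --> (y, t)] --> t *: y by exact: cvgZ.
exact: cvgD.
Qed.

Lemma line_continuousr x y : continuous (line x y).
Proof.
move=> t; have := @line_continuous x (y, t).
move=> /(continuous_comp (f := fun t => (y, t)) _); apply.
exact: (cvg_pair (cvg_cst _) cvg_id).
Qed.

Lemma line_seg x y t : 0 <= t <= 1 -> seg x y (line x y t).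
Proof. by exists t. Qed.

Lemma convex_const (A : Type) (W : set V) (h : V -> A) : is_convex W ->
  (forall x, W x -> \forall y \near x, W y -> h y = h x) ->
  forall x y, W x -> W y -> h x = h y.
Proof.
move=> cW hW x y Wx Wy; symmetry.
have := @segment_induction R 0 1 (fun t => h (line x y t) = h x) _ 0 1.
rewrite line0 line1; apply => //; try by rewrite lexx ler01.
move=> t t01.
have Wt := cW _ _ Wx Wy _ (line_seg x y t01).
have C : \forall s \near t, W (line x y s) -> h (line x y s) = h (line x y t).
  exact: (@line_continuousr x y t _ (hW _ Wt)).
near=> s => s01.
have -> // : h (line x y s) = h (line x y t).
have Ws : W (line x y s) by apply: (cW x y Wx Wy); exact: line_seg.
by move: Ws; near: s.
Unshelve. all: by end_near. Qed.
End Convex.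

Section LocalSystem.
Context {R : realType} {G : finGroupType}.
Notation V := 'rV[R]_3.
Implicit Types (U W : set V) (L : V -> V -> G) (F : V -> G).
Local Open Scope group_scope.

(* [L x y] is the transport from y to x, meaningful for y close to x only; two
   points y and z both close to x need not be close enough to each other, whence
   the nesting of the two neighborhoods. *)
Definition local_system U L :=
  forall x, U x -> \forall y \near x, \forall z \near y, L x z = L x y * L y z.

Definition trivializes W L F :=
  forall x, W x -> \forall y \near x, F y = F x * L x y.

Lemma trivializes_mull W L F g : trivializes W L F -> trivializes W L (fun x => g * F x).
Proof. by move=> T x Wx; have := T x Wx; apply: filterS => y ->; rewrite mulgA. Qed.

(** In the quotient of two primitives the transport cancels, so the quotient is locally constant,
    and [W1]&[W2] is convex. *)
Lemma trivializes_eq W1 W2 L F1 F2 c : is_convex W1 -> is_convex W2 ->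
  trivializes W1 L F1 -> trivializes W2 L F2 -> W1 c -> W2 c -> F1 c = F2 c ->
  forall x, W1 x -> W2 x -> F1 x = F2 x.
Proof.
move=> c1 c2 T1 T2 W1c W2c Ec x W1x W2x.
have h := @convex_const R G (W1 `&` W2) (fun x => F1 x * (F2 x)^-1) (is_convexI c1 c2).
suff E : F1 x * (F2 x)^-1 = F1 c * (F2 c)^-1.
  by apply: (mulIg (F2 x)^-1); rewrite E Ec !mulgV.
apply: h => // y [W1y W2y]; near=> z => _.
have -> : F1 z = F1 y * L y z by near: z; exact: T1.
have -> : F2 z = F2 y * L y z by near: z; exact: T2.
by rewrite invMg !mulgA mulgK.
Unshelve. all: by end_near. Qed.

Section Trivialization.
Variables (U W : set V) (L : V -> V -> G) (b : V).
Hypotheses (lsL : local_system U L) (WU : W `<=` U) (oW : open W) (cW : is_convex W) (Wb : W b).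

Let Wl x t : W x -> (0 <= t <= 1)%R -> W (line b x t).
Proof. by move=> Wx t01; exact: (cW Wb Wx (line_seg _ _ t01)). Qed.

Let L1 x : W x -> L x x = 1.
Proof.
move=> /WU/lsL/nbhs_singleton/nbhs_singleton /esym/eqP.
by rewrite -[X in _ == X]mulg1 (inj_eq (mulgI _)) => /eqP.
Qed.

Definition lifts_to (x : V) (F : R -> G) (u : R) := F 0%R = 1 /\
  forall t : R, (0 <= t <= u)%R -> \forall s \near t, (0 <= s <= u)%R ->
    F s = F t * L (line b x t) (line b x s).

(** Whether a lift over [[0, u]] exists is locally constant in [u]: near [t], a lift up to [s] is
    restricted, or continued by comparing with the transport seen from the point at time [t]. *)
Let lift_exists x : W x -> exists F : R -> G, lifts_to x F 1%R.
Proof.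
move=> Wx.
have l01 : (0 <= 1 :> R)%R by exact: ler01.
apply: (@segment_induction R 0 1 (fun u => exists F : R -> G, lifts_to x F u) _ 0%R 1%R);
  rewrite ?lexx ?l01 //; last first.
  exists (fun=> 1); split => // t; rewrite -eq_le => /eqP <-.
  by near=> s; rewrite -eq_le => /eqP <-; rewrite line0 L1 // mulg1.
move=> t t01.
have [e /= e0 He] := @line_continuousr R b x t _ (lsL (WU (Wl Wx t01))).
have Le r : (`|t - r| < e)%R -> \forall q \near r, L (line b x t) (line b x q) =
      L (line b x t) (line b x r) * L (line b x r) (line b x q).
    by move=> tr; exact: (@line_continuousr R b x r _ (He r tr)).
have ext s s' : (`|t - s| < e)%R -> (`|t - s'| < e)%R -> (0 <= s <= 1)%R -> (0 <= s' <= 1)%R ->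
    (exists F : R -> G, lifts_to x F s) -> exists F : R -> G, lifts_to x F s'.
  move=> ts ts' /andP[s0 s1] /andP[s'0 s'1] [F [F0 HF]].
  pose F' r := if (r <= s)%R then F r else
     F s * (L (line b x t) (line b x s))^-1 * L (line b x t) (line b x r).
  exists F'; split; first by rewrite /F' s0.
  move=> r /andP[r0 rs'].
  case: (ltrgtP r s) => [rs|sr|->].
  - near=> q => /andP[q0 qs'].
    have qs : (q < s)%R by near: q; exact: lt_nbhsl.
    rewrite /F' (ltW rs) (ltW qs).
    have : (0 <= q <= s)%R by rewrite q0 ltW.
    by near: q; apply: HF; rewrite r0 ltW.
  - have tr : (`|t - r| < e)%R.
      by move: ts ts'; rewrite !ltr_norml => /andP[? ?] /andP[? ?]; apply/andP; split; lra.
    near=> q => /andP[q0 qs'].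
    have qs : (s < q)%R by near: q; exact: lt_nbhsr.
    have E : L (line b x t) (line b x q) =
        L (line b x t) (line b x r) * L (line b x r) (line b x q) by near: q; exact: Le.
    by rewrite /F' !leNgt sr qs /= E mulgA.
  - near=> q => /andP[q0 qs'].
    rewrite /F' lexx; case: (lerP q s) => qs.
      have : (0 <= q <= s)%R by rewrite q0.
      by near: q; apply: HF; rewrite s0 lexx.
    have E : L (line b x t) (line b x q) =
        L (line b x t) (line b x s) * L (line b x s) (line b x q) by near: q; exact: Le.
    by rewrite E !mulgA mulgKV.
near=> s => s01.
have ts : (`|t - s| < e)%R by near: s; exists e.
by split; apply: ext; rewrite ?subrr ?normr0.
Unshelve. all: by end_near. Qed.

Lemma local_system_trivial : exists F, trivializes W L F.
Proof.
have [F HF] : exists F : V -> R -> G, forall x, W x -> lifts_to x (F x) 1%R.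
  have /choice[F HF] : forall x, exists F : R -> G, W x -> lifts_to x F 1%R.
    by move=> x; have [/lift_exists[F ?]|?] := pselect (W x); [exists F|exists (fun=> 1)].
  by exists F.
have l01 : (0 <= 1 :> R)%R by exact: ler01.
exists (fun x => F x 1%R) => x Wx.
(* The primitive is the final value of the lift along the ray from [b]. The comparison of
   neighbouring rays is carried from [t = 0], where all lifts are 1, to their ends. *)
pose P t := \forall y \near x, F y t = F x t * L (line b x t) (line b y t).
suff : P 1%R by rewrite /P; apply: filterS => y; rewrite !line1.
apply: (@segment_induction R 0 1 P _ 0%R 1%R); rewrite ?lexx ?l01 //; last first.
  rewrite /P; near=> y; rewrite !line0 L1 // mulg1.
  have [-> _] := HF _ Wx.
  suff /HF[-> _] : W y by [].
  by near: y; exact: open_nbhs_nbhs.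
move=> t t01.
have Bp := lsL (WU (Wl Wx t01)).
set p := line b x t in Bp.
have [[B1 B2] /= [HB1 [e /= e0 HB2]] HB] := @line_continuous R b (x, t) _ Bp.
(* During this time interval the rays to points near [x] stay near [p], so each lift is [L p] up to
   a left factor that does not depend on time. *)
have step s s' y : W y -> B1 y -> (`|t - s| < e)%R -> (`|t - s'| < e)%R ->
    (0 <= s <= 1)%R -> (0 <= s' <= 1)%R ->
    F y s * (L p (line b y s))^-1 = F y s' * (L p (line b y s'))^-1.
  move=> Wy B1y.
  have [Fy0 HFy] := HF _ Wy.
  wlog ss' : s s' / (s <= s')%R.
    by move=> H; case: (lerP s s') => [?|/ltW ?] ? ? ? ?; [|symmetry]; exact: H.
  move=> ts ts' s01 s'01.
  symmetry; apply: (@segment_induction R s s' (fun r => F y r * (L p (line b y r))^-1 =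
    F y s * (L p (line b y s))^-1) _ s s'); rewrite ?lexx ?ss' // => r /andP[sr rs'].
  have r01 : (0 <= r <= 1)%R by move: s01 s'01 => /andP[? ?] /andP[? ?]; apply/andP; split; lra.
  have tr : (`|t - r| < e)%R.
    by move: ts ts'; rewrite !ltr_norml => /andP[? ?] /andP[? ?]; apply/andP; split; lra.
  have := @line_continuousr R b y r _ (HB (y, r) (conj B1y (HB2 r tr))).
  have := HFy r r01; apply: filterS2 => q Fq Lq /andP[sq qs'].
  rewrite Fq ?Lq; last by move: s01 s'01 => /andP[? ?] /andP[? ?]; apply/andP; split; lra.
  by rewrite invMg !mulgA mulgK.
have main s s' : (`|t - s| < e)%R -> (`|t - s'| < e)%R ->
    (0 <= s <= 1)%R -> (0 <= s' <= 1)%R -> P s -> P s'.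
  move=> ts ts' s01 s'01 Ps.
  have B1x : B1 x by exact: nbhs_singleton.
  have cl r : line b y r @[y --> x] --> line b x r.
    have h : (r *: y)%R @[y --> x] --> (r *: x)%R by exact: (cvgZl_tmp cvg_id).
    exact: (cvgD (cvg_cst _) h).
  have HL r : (`|t - r| < e)%R ->
      \forall y \near x, L p (line b y r) = L p (line b x r) * L (line b x r) (line b y r).
    by move=> tr; exact: (cl r _ (HB (x, r) (conj B1x (HB2 r tr)))).
  rewrite /P; near=> y.
  have Wy : W y by near: y; exact: open_nbhs_nbhs.
  have B1y : B1 y by near: y.
  have Ey := step s s' y Wy B1y ts ts' s01 s'01.
  have Ex := step s s' x Wx B1x ts ts' s01 s'01.
  have Es : F y s = F x s * L (line b x s) (line b y s) by near: y.
  have Ls : L p (line b y s) = L p (line b x s) * L (line b x s) (line b y s).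
    by near: y; exact: HL.
  have Ls' : L p (line b y s') = L p (line b x s') * L (line b x s') (line b y s').
    by near: y; exact: HL.
  apply: (mulIg (L p (line b y s'))^-1); rewrite -Ey Ls' Es Ls !invMg !mulgA !mulgK.
  exact: Ex.
near=> s => s01.
have ts : (`|t - s| < e)%R by near: s; exists e.
by split; apply: main; rewrite ?subrr ?normr0.
Unshelve. all: by end_near. Qed.
End Trivialization.
End LocalSystem.

(** * Cyclic monodromy and the complement of the unknot *)

Section CyclicSystems.
Context {R : realType}.
Notation V := 'rV[R]_3.
Local Open Scope group_scope.

(* Every homomorphism from the fundamental groupoid of U to G has, up to
   conjugation, its values in a cyclic subgroup. *)
Definition cyclic_systems (G : finGroupType) (U : set V) :=
  forall L : V -> V -> G, local_system U L ->
  exists (f : V -> G) (g : G),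
    forall x, U x -> \forall y \near x, f x * L x y * (f y)^-1 \in <[g]>.

Lemma cyclic_systems_homeo G (U : set V) h :
  homeomorphism h -> cyclic_systems G U -> cyclic_systems G (h @^-1` U).
Proof.
move=> [h' [ch ch' hK h'K]] cU L lsL.
have [|f [g fg]] := cU (fun x y => L (h' x) (h' y)).
  move=> x Ux; have Uh'x : (h @^-1` U) (h' x) by rewrite /preimage /= h'K.
  have C : \forall y \near x, \forall z \near h' y, L (h' x) z = L (h' x) (h' y) * L (h' y) z.
    exact: (ch' x _ (lsL _ Uh'x)).
  near=> y.
  have Cy : \forall z \near h' y, L (h' x) z = L (h' x) (h' y) * L (h' y) z by near: y.
  exact: (ch' y _ Cy).
exists (f \o h), g => x Ux.
have C : \forall y \near x, f (h x) * L (h' (h x)) (h' (h y)) * (f (h y))^-1 \in <[g]>.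
  exact: (ch x _ (fg _ Ux)).
near=> y; rewrite /= -{2}(hK x) -{1}(hK y).
by near: y.
Unshelve. all: by end_near. Qed.

Definition halfspace (n : V) (r : R) : set V := [set x | (r < dot n x)%R].

Lemma halfspace_convex n r : is_convex (halfspace n r).
Proof.
move=> x y; rewrite /halfspace /= => hx hy _ [t /andP[t0 t1] ->] /=.
rewrite !dotRE; have [->|t0'] := eqVneq t 0%R; first lra.
have {t0 t0'}t0 : (0 < t)%R by rewrite lt_neqAle eq_sym t0'.
have := ltr_pM2l t0 r (dot n y); rewrite hy => ?.
have : ((1 - t) * r <= (1 - t) * dot n x)%R by apply: ler_wpM2l; lra.
by lra.
Qed.

Lemma halfspace_open n r : open (halfspace n r).
Proof.
have -> : halfspace n r = dot n @^-1` [set s | (r < s)%R] by [].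
by apply: open_comp; [move=> x _; exact: dot_continuous|exact: open_gt].
Qed.

Section Unknot.
Variables (G : finGroupType) (L : V -> V -> G).
Hypothesis lsL : local_system (~` unknot R) L.

Let up : set V := halfspace (point3 0 0 1) 0.
Let dn : set V := halfspace (point3 0 0 (-1)) 0.
Let h1 : set V := halfspace (point3 (-1) 0 0) 0.
Let h2 : set V := halfspace (point3 0 (-1) 0) 0.
Let h3 : set V := halfspace (point3 1 1 0) 1.
Let tr : set V := halfspace (point3 1 0 0) 0 `&` halfspace (point3 0 1 0) 0
  `&` halfspace (point3 (-1) (-1) 0) (-1).

Let setE x : [/\ up x = (0 < crd 2 x)%R, dn x = (crd 2 x < 0)%R, h1 x = (crd 0 x < 0)%R,
   h2 x = (crd 1 x < 0)%R & h3 x = (1 < crd 0 x + crd 1 x)%R] /\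
   tr x = [/\ (0 < crd 0 x)%R, (0 < crd 1 x)%R & (crd 0 x + crd 1 x < 1)%R].
Proof.
rewrite /up /dn /h1 /h2 /h3 /tr /halfspace /= /setI /= !dotE !crd_point3.
do !split; try (congr (is_true _); apply/idP/idP; lra).
apply/propext; split => [[[? ?] ?]|[? ? ?]]; do !split; lra.
Qed.

(** The inequalities describe the filled triangle; the product vanishes on the lines of its three
    sides. *)
Let unknotE x : unknot R x <-> [/\ crd 2 x = 0%R, (0 <= crd 0 x)%R, (0 <= crd 1 x)%R,
  (crd 0 x + crd 1 x <= 1)%R & crd 0 x * crd 1 x * (1 - crd 0 x - crd 1 x) = 0]%R.
Proof.
rewrite /unknot triangleE; split.
  by move=> [[]|] [t /andP[t0 t1] ->]; rewrite !crdE; split; nra.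
move=> [z0 x0 y0 xy /eqP]; rewrite !mulf_eq0 => /orP[/orP[]|] /eqP e.
- right; exists (1 - crd 1 x)%R; first by apply/andP; split; lra.
  by apply: vec3P; rewrite !crdE; lra.
- left; left; exists (crd 0 x); first by apply/andP; split; lra.
  by apply: vec3P; rewrite !crdE; lra.
- left; right; exists (crd 1 x); first by apply/andP; split; lra.
  by apply: vec3P; rewrite !crdE; lra.
Qed.

Let triv (W : set V) c : open W -> is_convex W -> W c ->
  (forall x, W x -> ~ unknot R x) -> exists F, trivializes W L F.
Proof. by move=> oW cW Wc WU; exact: (local_system_trivial lsL WU oW cW Wc). Qed.

Let cup : is_convex up := @halfspace_convex _ _.
Let cdn : is_convex dn := @halfspace_convex _ _.
Let ch1 : is_convex h1 := @halfspace_convex _ _.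
Let ch2 : is_convex h2 := @halfspace_convex _ _.
Let ch3 : is_convex h3 := @halfspace_convex _ _.
Let ctr : is_convex tr :=
  is_convexI (is_convexI (@halfspace_convex _ _) (@halfspace_convex _ _)) (@halfspace_convex _ _).

Let memP (x y z : R) :
  [/\ up (point3 x y z) = (0 < z)%R, dn (point3 x y z) = (z < 0)%R,
      h1 (point3 x y z) = (x < 0)%R, h2 (point3 x y z) = (y < 0)%R &
      h3 (point3 x y z) = (1 < x + y)%R] /\
   tr (point3 x y z) = [/\ (0 < x)%R, (0 < y)%R & (x + y < 1)%R].
Proof. by have := setE (point3 x y z); rewrite !crd_point3. Qed.

(** All overlaps of the six sets are convex, so primitives agreeing at one point of an overlap agree
    on it. Those on the prism and the outer half-spaces are normalized against [up]; the one on [dn]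
    is normalized against an outer half-space, hence matches all three, and only its comparison with
    the prism produces a new element. *)
Lemma unknot_gluing : exists (f : V -> G) (g : G),
    forall x, (~` unknot R) x -> \forall y \near x, f x * L x y * (f y)^-1 \in <[g]>.
Proof.
have N (W : set V) : (forall x, W x -> ~ unknot R x) -> W `<=` ~` unknot R by [].
have nup x : up x -> ~ unknot R x by have [[-> _ _ _ _] _] := setE x; rewrite unknotE => ? [? ? ? ? ?]; lra.
have ndn x : dn x -> ~ unknot R x by have [[_ -> _ _ _] _] := setE x; rewrite unknotE => ? [? ? ? ? ?]; lra.
have nh1 x : h1 x -> ~ unknot R x by have [[_ _ -> _ _] _] := setE x; rewrite unknotE => ? [? ? ? ? ?]; lra.
have nh2 x : h2 x -> ~ unknot R x by have [[_ _ _ -> _] _] := setE x; rewrite unknotE => ? [? ? ? ? ?]; lra.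
have nh3 x : h3 x -> ~ unknot R x by have [[_ _ _ _ ->] _] := setE x; rewrite unknotE => ? [? ? ? ? ?]; lra.
have ntr x : tr x -> ~ unknot R x.
  have [_ ->] := setE x; rewrite unknotE => -[? ? ?] [_ _ _ _ /eqP]; apply/negP.
  by rewrite !mulf_neq0 // gt_eqF //; lra.
have ho := halfspace_open.
have otr : open tr by apply: openI; [apply: openI|]; exact: ho.
have [Fu Tu] : exists F, trivializes up L F.
  by apply: (@triv up (point3 0 0 1) (ho _ _) cup _ nup); have [[-> _ _ _ _] _] := memP 0 0 1; lra.
have nrm (W : set V) c g : open W -> is_convex W -> W c -> (forall x, W x -> ~ unknot R x) ->
    exists2 F, trivializes W L F & F c = g.
  move=> oW cW Wc NW; have [F TF] := triv oW cW Wc NW.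
  exists (fun x => g * (F c)^-1 * F x); first exact: trivializes_mull.
  by rewrite mulgKV.
have lift (W : set V) c : open W -> is_convex W -> W c -> up c -> (forall x, W x -> ~ unknot R x) ->
    exists2 F, trivializes W L F & forall x, W x -> up x -> F x = Fu x.
  move=> oW cW Wc uc NW; have [F TF Fc] := nrm W c (Fu c) oW cW Wc NW.
  exists F => //; exact: (trivializes_eq cW cup TF Tu Wc uc Fc).
have [F1 T1 E1] : exists2 F, trivializes h1 L F & forall x, h1 x -> up x -> F x = Fu x.
  apply: (lift h1 (point3 (-1) 0 1) (ho _ _) ch1 _ _ nh1); have [[hu _ hh _ _] _] := memP (-1) 0 1.
    by rewrite hh; lra.
  by rewrite hu; lra.
have [F2 T2 E2] : exists2 F, trivializes h2 L F & forall x, h2 x -> up x -> F x = Fu x.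
  apply: (lift h2 (point3 0 (-1) 1) (ho _ _) ch2 _ _ nh2); have [[hu _ _ hh _] _] := memP 0 (-1) 1.
    by rewrite hh; lra.
  by rewrite hu; lra.
have [F3 T3 E3] : exists2 F, trivializes h3 L F & forall x, h3 x -> up x -> F x = Fu x.
  apply: (lift h3 (point3 1 1 1) (ho _ _) ch3 _ _ nh3); have [[hu _ _ _ hh] _] := memP 1 1 1.
    by rewrite hh; lra.
  by rewrite hu; lra.
have [FT TT ET] : exists2 F, trivializes tr L F & forall x, tr x -> up x -> F x = Fu x.
  apply: (lift tr (point3 4^-1 4^-1 1) otr ctr _ _ ntr).
  - by have [_ ->] := memP 4^-1 4^-1 1; split; lra.
  - by have [[-> _ _ _ _] _] := memP 4^-1 4^-1 1; lra.
have E12 x : h1 x -> h2 x -> F1 x = F2 x.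
  have [[u _ hh1 hh2 _] _] := memP (-1) (-1) 1.
  have uc : up (point3 (-1) (-1) 1) by rewrite u; lra.
  have c1 : h1 (point3 (-1) (-1) 1) by rewrite hh1; lra.
  have c2 : h2 (point3 (-1) (-1) 1) by rewrite hh2; lra.
  have Ec : F1 (point3 (-1) (-1) 1) = F2 (point3 (-1) (-1) 1) by rewrite E1 // E2.
  exact: (trivializes_eq ch1 ch2 T1 T2 c1 c2 Ec).
have E13 x : h1 x -> h3 x -> F1 x = F3 x.
  have [[u _ hh1 _ hh3] _] := memP (-1) 3 1.
  have uc : up (point3 (-1) 3 1) by rewrite u; lra.
  have c1 : h1 (point3 (-1) 3 1) by rewrite hh1; lra.
  have c2 : h3 (point3 (-1) 3 1) by rewrite hh3; lra.
  have Ec : F1 (point3 (-1) 3 1) = F3 (point3 (-1) 3 1) by rewrite E1 // E3.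
  exact: (trivializes_eq ch1 ch3 T1 T3 c1 c2 Ec).
have E23 x : h2 x -> h3 x -> F2 x = F3 x.
  have [[u _ _ hh2 hh3] _] := memP 3 (-1) 1.
  have uc : up (point3 3 (-1) 1) by rewrite u; lra.
  have c1 : h2 (point3 3 (-1) 1) by rewrite hh2; lra.
  have c2 : h3 (point3 3 (-1) 1) by rewrite hh3; lra.
  have Ec : F2 (point3 3 (-1) 1) = F3 (point3 3 (-1) 1) by rewrite E2 // E3.
  exact: (trivializes_eq ch2 ch3 T2 T3 c1 c2 Ec).
have [Fd Td Ed] : exists2 F, trivializes dn L F & F (point3 (-1) (-1) (-1)) = F1 (point3 (-1) (-1) (-1)).
  by apply: (nrm dn _ _ (ho _ _) cdn _ ndn); have [[_ -> _ _ _] _] := memP (-1) (-1) (-1); lra.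
(* The points [(-1, -1, -1)] and [(-1, 3, -1)], which lie below [h1]&[h2] and [h1]&[h3], carry the
   normalization of [Fd] from [h1] to the other outer half-spaces. *)
have d12 : dn (point3 (-1) (-1) (-1)) by have [[_ -> _ _ _] _] := memP (-1) (-1) (-1); lra.
have d13 : dn (point3 (-1) 3 (-1)) by have [[_ -> _ _ _] _] := memP (-1) 3 (-1); lra.
have c12 : h1 (point3 (-1) (-1) (-1)) by have [[_ _ -> _ _] _] := memP (-1) (-1) (-1); lra.
have c21 : h2 (point3 (-1) (-1) (-1)) by have [[_ _ _ -> _] _] := memP (-1) (-1) (-1); lra.
have c13 : h1 (point3 (-1) 3 (-1)) by have [[_ _ -> _ _] _] := memP (-1) 3 (-1); lra.
have c31 : h3 (point3 (-1) 3 (-1)) by have [[_ _ _ _ ->] _] := memP (-1) 3 (-1); lra.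
have D1 x : dn x -> h1 x -> Fd x = F1 x by exact: (trivializes_eq cdn ch1 Td T1 d12 c12 Ed).
have D2 x : dn x -> h2 x -> Fd x = F2 x.
  exact: (trivializes_eq cdn ch2 Td T2 d12 c21 (etrans Ed (E12 _ c12 c21))).
have D3 x : dn x -> h3 x -> Fd x = F3 x.
  exact: (trivializes_eq cdn ch3 Td T3 d13 c31 (etrans (D1 _ d13 c13) (E13 _ c13 c31))).
pose c := point3 4^-1 4^-1 (-1) : V.
pose g := Fd c * (FT c)^-1.
have dc : dn c by have [[_ -> _ _ _] _] := memP 4^-1 4^-1 (-1); lra.
have tc : tr c by have [_ ->] := memP 4^-1 4^-1 (-1); split; lra.
have DT x : dn x -> tr x -> Fd x = g * FT x.
  by apply: (trivializes_eq cdn ctr Td (trivializes_mull g TT) dc tc); rewrite /g mulgKV.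
(* In the plane of the triangle [f] follows a primitive that is defined on both sides of the plane,
   so near such a point a single primitive has to be compared with [Fu] and [Fd]. *)
pose f x := if (0 < crd 2 x)%R then Fu x else if (crd 2 x < 0)%R then Fd x else
  if (crd 0 x < 0)%R then F1 x else if (crd 1 x < 0)%R then F2 x else
  if (1 < crd 0 x + crd 1 x)%R then F3 x else FT x.
exists f, g => x Ux.
suff [W [F [oW TW Wx fx fW]]] : exists W F, [/\ open W, trivializes W L F, W x, f x = F x &
    forall y, W y -> f y = F y \/ f y = g * F y].
  near=> y.
  have Wy : W y by near: y; exact: open_nbhs_nbhs.
  have Fy : F y = F x * L x y by near: y; exact: TW.
  rewrite fx -Fy; case: (fW y Wy) => ->; first by rewrite mulgV group1.
  by rewrite invMg mulgA mulgV mul1g groupV cycle_id.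
have [eqs eqt] := setE x; case: eqs => ux dx x1 x2 x3.
have fE y : [/\ up y -> f y = Fu y, dn y -> f y = Fd y & ~ up y -> ~ dn y ->
    [/\ h1 y -> f y = F1 y, h2 y -> f y = F2 y, h3 y -> f y = F3 y & tr y -> f y = FT y]].
  have [[-> -> y1 y2 y3] yt] := setE y; rewrite /f; split.
  - by move=> ->.
  - by move=> y0; rewrite y0 ltNge ltW.
  - move=> /negP/negPf -> /negP/negPf ->; split.
    + by rewrite y1 => ->.
    + by move=> hy; have := hy; rewrite {1}y2 => ->; case: ifP => // hy1; rewrite E12 // y1.
    + move=> hy; have := hy; rewrite {1}y3 => ->; case: ifP => hy1; first by rewrite E13 // y1.
      by case: ifP => // hy2; rewrite E23 // y2.
    + by rewrite yt => -[? ? ?]; rewrite !ltNge !ltW.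
have fW (W : set V) F g' y : (g' = 1 \/ g' = g) -> (forall z, W z -> up z -> F z = Fu z) ->
    (forall z, dn z -> W z -> Fd z = g' * F z) -> (W y -> ~ up y -> ~ dn y -> f y = F y) ->
    W y -> f y = F y \/ f y = g * F y.
  move=> g'E Wu Wd Wn Wy; have [fu fd _] := fE y.
  have [uy|uy] := pselect (up y); first by left; rewrite fu // Wu.
  have [dy|dy] := pselect (dn y); last by left; exact: Wn.
  by rewrite fd // Wd //; case: g'E => ->; [left; rewrite mul1g|right].
have [fu fd fn] := fE x.
have [uy|uy] := pselect (up x).
  exists up, Fu; split=> //; [exact: ho|exact: fu|].
  by move=> y uy'; left; have [-> //] := fE y.
have [dy|dy] := pselect (dn x).
  exists dn, Fd; split=> //; [exact: ho|exact: fd|].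
  by move=> y dy'; left; have [_ -> //] := fE y.
have [f1 f2 f3 ft] := fn uy dy.
have [hx|nx1] := pselect (h1 x).
  exists h1, F1; split=> //; [exact: ho|exact: f1|] => y.
  apply: (fW _ _ 1); [by left|exact: E1|by move=> z dz ?; rewrite mul1g D1|].
  by move=> Wy nu nd; have [_ _ /(_ nu nd)[? ? ? ?]] := fE y; auto.
have [hx|nx2] := pselect (h2 x).
  exists h2, F2; split=> //; [exact: ho|exact: f2|] => y.
  apply: (fW _ _ 1); [by left|exact: E2|by move=> z dz ?; rewrite mul1g D2|].
  by move=> Wy nu nd; have [_ _ /(_ nu nd)[? ? ? ?]] := fE y; auto.
have [hx|nx3] := pselect (h3 x).
  exists h3, F3; split=> //; [exact: ho|exact: f3|] => y.
  apply: (fW _ _ 1); [by left|exact: E3|by move=> z dz ?; rewrite mul1g D3|].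
  by move=> Wy nu nd; have [_ _ /(_ nu nd)[? ? ? ?]] := fE y; auto.
have tx : tr x.
  apply: contrapT => ntx; apply: Ux; apply/unknotE.
  move: uy dy nx1 nx2 nx3 ntx; rewrite ux dx x1 x2 x3 eqt.
  move=> /negP + /negP + /negP + /negP + /negP; rewrite -!leNgt => ? ? x0 y0 xy nt; split; [lra|lra|lra|lra|].
  have [->|x00] := eqVneq (crd 0 x) 0%R; first by rewrite !mul0r.
  have [->|y00] := eqVneq (crd 1 x) 0%R; first by rewrite mulr0 mul0r.
  have [e|xy1] := eqVneq (1 - crd 0 x - crd 1 x)%R 0%R; first by rewrite e mulr0.
  exfalso; apply: nt; split; rewrite lt_neqAle ?(eq_sym 0%R) ?x00 ?y00 //.
  by rewrite xy andbT; apply: contraNneq xy1 => <-; apply/eqP; ring.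
exists tr, FT; split=> //; [exact: ft|] => y.
apply: (fW _ _ g); [by right|exact: ET|exact: DT|].
by move=> Wy nu nd; have [_ _ /(_ nu nd)[? ? ? ?]] := fE y; auto.
Unshelve. all: by end_near. Qed.
End Unknot.

Lemma unknot_cyclic_systems G : cyclic_systems G (~` unknot R).
Proof. by move=> L; exact: unknot_gluing. Qed.

End CyclicSystems.

(** * A noncyclic representation of the trefoil group *)

(* The dihedral group of order 6: [(k, s)] is the map t |-> (-1)^s t + k of
   Z/3, with 0, 1, 2 encoded as [None], [Some false], [Some true]. *)
Definition dih3 := (option bool * bool)%type.

Definition z3_opp (k : option bool) := omap negb k.
Definition z3_add (k l : option bool) : option bool :=
  match k, l with
  | None, m | m, None => m
  | Some false, Some false => Some true
  | Some true, Some true => Some false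
  | _, _ => None
  end.

Definition dih3_mul (x y : dih3) : dih3 :=
  (z3_add x.1 (if x.2 then z3_opp y.1 else y.1), x.2 (+) y.2).
Definition dih3_one : dih3 := (None, false).
Definition dih3_inv (x : dih3) : dih3 := ((if x.2 then x.1 else z3_opp x.1), x.2).

Lemma dih3_mulA : associative dih3_mul.
Proof. by move=> [[[]|] []] [[[]|] []] [[[]|] []]. Qed.
Lemma dih3_mul1 : left_id dih3_one dih3_mul.
Proof. by move=> [[[]|] []]. Qed.
Lemma dih3_mulV : left_inverse dih3_one dih3_inv dih3_mul.
Proof. by move=> [[[]|] []]. Qed.

HB.instance Definition _ := Finite.on dih3.
HB.instance Definition _ := Finite_isGroup.Build dih3 dih3_mulA dih3_mul1 dih3_mulV.

Definition reflection (k : nat) : dih3 := (nth None [:: None; Some false; Some true] k, true).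

Lemma transport_chain (G : finGroupType) (a b c d e : G) :
  (a * (b * c) * e^-1 = (a * b * d^-1) * (d * c * e^-1))%g.
Proof. by rewrite !mulgA mulgKV. Qed.

Lemma zigzag_chain (G : finGroupType) (a b c p q m r : G) :
  ((p * q * a^-1)^-1 * (p * b * c^-1) * (c * m * r^-1) = a * (q^-1 * b * m) * r^-1)%g.
Proof. by rewrite !invMg invgK !mulgA !mulgKV. Qed.

Lemma cycle_conj_comm (G : finGroupType) (a x y g : G) :
  (a * x * a^-1 \in <[g]> -> a * y * a^-1 \in <[g]> -> x * y = y * x)%g.
Proof.
move=> /cycleP[i xi] /cycleP[j yj].
have E u v : (a * (u * v) * a^-1 = (a * u * a^-1) * (a * v * a^-1))%g by rewrite !mulgA mulgKV.
by apply: (mulgI a); apply: (mulIg (a^-1)%g); rewrite !E xi yj -!expgD addnC.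
Qed.

(** An odd cell is a single integer and an even one an open interval or ray: these are the cells of
    the points close to a point of the cell [a]. *)
Definition cell_nbrs (a : nat) : seq nat := if odd a then [:: a.-1; a; a.+1] else [:: a].
(* Points in the plane of a curtain belong to the side of larger coordinate. *)
Definition up (a : nat) : nat := if odd a then a.+1 else a.

(* A 3-coloring of the grid diagram: entry k of [grid_columns] gives the interval
   of y and the color of the arc on the line x = k at height z = 1, and entry k of
   [grid_rows] the intervals of x and the colors of the arcs on the line y = k at
   height z = 0, cut where they pass under a column.  A color is a reflection, by
   which the transport is multiplied when it crosses the vertical curtain that
   hangs down from the arc. *)
Definition grid_columns : seq (nat * nat * nat) :=
  [:: (0, 2, 0); (1, 3, 1); (2, 4, 2); (0, 3, 0); (1, 4, 2)]%N.
Definition grid_rows : seq (seq (nat * nat * nat)) :=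
  [:: [:: (0, 3, 0)]; [:: (1, 3, 1); (3, 4, 2)]; [:: (0, 1, 0); (1, 2, 2)];
      [:: (1, 2, 1); (2, 3, 0)]; [:: (2, 4, 2)]]%N.

(** The integer [k] is the cell [k.*2.+1]. *)
Definition spans (a : nat) (e : nat * nat * nat) : bool := ((e.1.1).*2.+1 < a < (e.1.2).*2.+1)%N.

(** Here [a] and [c] are the cells of the crossing point along the curtain and in height. The
    heights 1 and 0 are the cells 3 and 1, whence the bounds here and in [cross_row]. *)
Definition cross_column (k a c : nat) : dih3 :=
  let e := nth (0, 0, 0)%N grid_columns k in
  if (c < 3)%N && spans a e then reflection e.2 else dih3_one.
Definition cross_row (k a c : nat) : dih3 :=
  if (c < 1)%N then
    foldr (fun e r => if spans a e then reflection e.2 else r) dih3_one (nth [::] grid_rows k)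
  else dih3_one.

Definition gridcell := (nat * nat * nat)%type.

(** The path from [a] to a neighbour [b] first changes [x], at the [y] of [a], and then [y], at the
    [x] of [b], both at the height of [b]; vertical motion crosses no curtain. A factor is
    nontrivial only if [a] lies in a grid plane and [b] on its smaller side, so [./2] is the index
    of that plane. *)
Definition transport (a b : gridcell) : dih3 :=
  let: (a1, a2, a3) := a in let: (b1, b2, b3) := b in
  dih3_mul (if up b1 == up a1 then dih3_one else cross_column a1./2 (up a2) (up b3))
           (if up b2 == up a2 then dih3_one else cross_row a2./2 (up b1) (up b3)).

(* The transport along a sequence of moves from a cell a to a cell b through a
   common face u. *)
Fixpoint monodromy (a : gridcell) (s : seq (gridcell * gridcell)) : dih3 :=
  if s is (u, b) :: s' then ((transport u a)^-1 * transport u b * monodromy b s')%g else 1%g.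

Definition grid_vertices : seq (nat * nat * nat) :=
  [:: (0, 0, 0); (0, 0, 1); (0, 2, 1); (0, 2, 0); (2, 2, 0); (2, 2, 1); (2, 4, 1); (2, 4, 0);
      (4, 4, 0); (4, 4, 1); (4, 1, 1); (4, 1, 0); (1, 1, 0); (1, 1, 1); (1, 3, 1); (1, 3, 0);
      (3, 3, 0); (3, 3, 1); (3, 0, 1); (3, 0, 0)]%N.

Definition between (i j a : nat) : bool := ((minn i j).*2.+1 <= a <= (maxn i j).*2.+1)%N.
Definition on_edge (a : gridcell) (e : gridcell * gridcell) : bool :=
  [&& between e.1.1.1 e.2.1.1 a.1.1, between e.1.1.2 e.2.1.2 a.1.2 & between e.1.2 e.2.2 a.2].
Definition grid_edges := edges (0, 0, 0)%N (rcons (behead grid_vertices) (0, 0, 0)%N).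
Definition on_grid (a : gridcell) : bool := has (on_edge a) grid_edges.

Definition nbrs3 (a : gridcell) : seq gridcell :=
  [seq (x, z) | x <- [seq (x, y) | x <- cell_nbrs a.1.1, y <- cell_nbrs a.1.2], z <- cell_nbrs a.2].
Fixpoint zigzag (a : gridcell) (s : seq (gridcell * gridcell)) : bool :=
  if s is (u, b) :: s' then [&& a \in nbrs3 u, b \in nbrs3 u & zigzag b s'] else true.

Definition all_cells : seq gridcell :=
  [seq (x, z) | x <- [seq (x, y) | x <- iota 0 11, y <- iota 0 11], z <- iota 0 5].

(** Below a crossing the curtains of a column and a row meet in a vertical line. The cocycle
    condition there is the Wirtinger relation of the crossing, satisfied by the 3-coloring; below a
    corner it expresses that the two arcs have the same color. *)
Definition transport_check : bool :=
  all (fun a => on_grid a ||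
    all (fun b => let t := transport a b in
      all (fun c => transport a c == dih3_mul t (transport b c))
          (nbrs3 b)) (nbrs3 a)) all_cells.

(** This is the combinatorial form of the knot being closed: from a cell off the knot, small
    displacements do not reach it. *)
Lemma grid_closed : all (fun a => on_grid a || all (fun b => ~~ on_grid b) (nbrs3 a)) all_cells.
Proof. by vm_compute. Qed.

Lemma transport_checkT : transport_check.
Proof. by vm_compute. Qed.

(** * Cells of the real line *)

Section Cells.
Context {R : realType}.

(* The position of t among k, k+1, ..., k+n-1: odd values for equality. *)
Fixpoint cell (n : nat) (k t : R) : nat :=
  if n is n'.+1 then
    if t < k then 0 else if t == k then 1 else (cell n' (k + 1) t).+2
  else 0.

Lemma cell_ltS n k t : (cell n k t < n.*2.+1)%N.
Proof. by elim: n k => //= n IH k; case: ifP => // _; case: ifP => // _; exact: IH. Qed.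

Lemma cell_ge n k t i : (i < n)%N -> (i.*2.+1 <= cell n k t)%N = (k + i%:R <= t).
Proof.
elim: n k i => //= n IH k [_|i]; first by rewrite addr0 leNgt; case: ifP => // _; case: ifP.
rewrite ltnS => /IH E; have i0 := ltr0Sn R i; case: ltgtP => h.
- by rewrite leNgt (_ : t < _); [|lra].
- by rewrite doubleS !ltnS E -[i.+1]add1n natrD addrA.
- by rewrite leNgt (_ : t < _); [|lra].
Qed.

Lemma cell_le n k t i : (i < n)%N -> (cell n k t <= i.*2.+1)%N = (t <= k + i%:R).
Proof.
elim: n k i => //= n IH k [_|i].
  by rewrite addr0 leNgt; case: ltgtP.
rewrite ltnS => /IH E; have i0 := ltr0Sn R i; case: ltgtP => h.
- by rewrite (_ : t <= _); [|lra].
- by rewrite doubleS !ltnS E -[i.+1]add1n natrD addrA.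
- by rewrite (_ : t <= _); [|lra].
Qed.

Lemma cell_homo n k s t : s <= t -> (cell n k s <= cell n k t)%N.
Proof.
move=> st; elim: n k => //= n IH k.
by case: (ltgtP s k) => h; case: (ltgtP t k) => h'; rewrite ?ltnS ?IH //; lra.
Qed.

Lemma cell_near n k t : \forall s \near t, cell n k s \in cell_nbrs (cell n k t).
Proof.
elim: n k => [|n IH] k /=; first by near=> s; rewrite inE.
case: (ltgtP t k) => h.
- near=> s; have -> : s < k by near: s; exact: lt_nbhsl.
  by rewrite inE.
- near=> s; have ks : k < s by near: s; exact: lt_nbhsr.
  have : cell n (k + 1) s \in cell_nbrs (cell n (k + 1) t) by near: s; exact: IH.
  rewrite ltNge (ltW ks) gt_eqF //= /cell_nbrs /= negbK.
  by case: ifP => o; rewrite !inE ?eqSS //; case: (cell n (k + 1) t) o.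
- near=> s; rewrite /cell_nbrs /= !inE; case: ltgtP => // hs.
  rewrite !eqSS /=; suff -> : cell n (k + 1) s = 0%N by [].
  have : s < k + 1 by near: s; apply: lt_nbhsl; rewrite h; lra.
  by case: (n) => //= m ->.
Unshelve. all: by end_near. Qed.

Lemma cell_between n k s t r : cell n k t \in cell_nbrs (cell n k s) ->
  s <= r <= t \/ t <= r <= s -> cell n k r \in cell_nbrs (cell n k s).
Proof.
rewrite /cell_nbrs => + st; have : (cell n k s <= cell n k r <= cell n k t)%N \/
   (cell n k t <= cell n k r <= cell n k s)%N.
  by case: st => /andP[? ?]; [left|right]; rewrite !cell_homo.
case: ifP => o; rewrite !inE.
  case: (cell n k s) o => // m _ /=; move: (cell n k t) (cell n k r) => a b; lia.
by move=> h /eqP e; move: h; rewrite e -eqn_leq eq_sym; case=> [|/eqP ->]; rewrite ?e ?eqxx.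
Qed.

Lemma cell_half n (k : R) (a : nat) : (a < n.*2.+1)%N -> cell n k (k + (a%:R - 1) / 2) = a.
Proof.
elim: n k a => [|n IH] k a; first by rewrite ltnS leqn0 => /eqP ->.
have cE t : cell n.+1 k t = if t < k then 0%N else if t == k then 1%N else (cell n (k + 1) t).+2 by [].
rewrite cE; case: a => [|[|a]] an.
- by rewrite (_ : _ < k); [|lra].
- by rewrite subrr mul0r addr0 ltxx eqxx.
have a0 : (0 : R) <= a%:R by exact: ler0n.
rewrite -[in RHS](IH (k + 1) a an) -[a.+2]addn2 natrD.
rewrite (_ : k + (a%:R + 2%:R - 1) / 2 = k + 1 + (a%:R - 1) / 2); last by field.
by rewrite ltNge (_ : k <= _) /= ?gt_eqF //; lra.
Qed.
End Cells.

(** * The local system on the complement of the grid trefoil *)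

Section GridTrefoil.
Context {R : realType}.
Notation V := 'rV[R]_3.

Definition cells (x : V) : gridcell :=
  (cell 5 0 (crd 0 x), cell 5 0 (crd 1 x), cell 2 0 (crd 2 x)).

Definition grid_point (v : nat * nat * nat) : V := point3 v.1.1%:R v.1.2%:R v.2%:R.

Definition grid_trefoil : set V := closed_polygon (map grid_point grid_vertices).

Lemma mem_nbrs3 a b : (b \in nbrs3 a) =
  [&& b.1.1 \in cell_nbrs a.1.1, b.1.2 \in cell_nbrs a.1.2 & b.2 \in cell_nbrs a.2].
Proof.
apply/allpairsP/and3P => [[[x z] /= [/allpairsP[[x1 x2] /= [h1 h2 ->]] h3 ->]] //|[h1 h2 h3]].
by exists (b.1, b.2); split => //=; [apply/allpairsP; exists b.1; split => //; case: (b.1)|case: b {h1 h2 h3}].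
Qed.

Lemma cells_in x : cells x \in all_cells.
Proof.
have c5 t := @cell_ltS R 5 0 t; have c2 t := @cell_ltS R 2 0 t.
apply/allpairsP; exists ((cells x).1, (cells x).2); split; [|by rewrite mem_iota; exact: c2|by []].
by apply/allpairsP; exists (cells x).1; split; [rewrite mem_iota; exact: c5|rewrite mem_iota; exact: c5|].
Qed.

Lemma cells_near x : \forall y \near x, cells y \in nbrs3 (cells x).
Proof.
have C n k (m : nat) : \forall y \near x, cell n k (crd m y) \in cell_nbrs (cell n k (crd m x)).
  exact: (@crd_continuous R m x _ (cell_near n k (crd m x))).
near=> y; rewrite mem_nbrs3; apply/and3P; split; near: y; exact: C.
Unshelve. all: by end_near. Qed.

Lemma box_seg (p q x : V) (k : nat) :
  (forall j, (j < 3)%N -> Num.min (crd j p) (crd j q) <= crd j x <= Num.max (crd j p) (crd j q)) ->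
  (forall j, (j < 3)%N -> j != k -> crd j p = crd j q) -> (k < 3)%N -> seg p q x.
Proof.
move=> box flat k3.
have flatx j : (j < 3)%N -> j != k -> crd j x = crd j p.
  move=> j3 jk; have := box j j3; rewrite -flat // minxx maxxx => ?.
  by apply/le_anti; rewrite andbC.
have [e|pq] := eqVneq (crd k p) (crd k q).
  exists 0; first by rewrite lexx ler01.
  rewrite subr0 scale1r scale0r addr0.
  have xk : crd k x = crd k p.
    by have := box k k3; rewrite -e minxx maxxx => ?; apply/le_anti; rewrite andbC.
  by case: k {box flat e k3} flatx xk => [|[|[|k]]] fx xk; apply: vec3P; rewrite ?xk ?fx.
have qp : crd k q - crd k p != 0 by rewrite subr_eq0 eq_sym.
exists ((crd k x - crd k p) / (crd k q - crd k p)).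
  have := box k k3; case: (ltrP (crd k p) (crd k q)) => h /andP[h1 h2].
    have h' : 0 < crd k q - crd k p by rewrite subr_gt0.
    by apply/andP; split; [apply: divr_ge0|rewrite ler_pdivrMr]; lra.
  have h' : 0 < crd k p - crd k q by rewrite subr_gt0 lt_neqAle h andbT eq_sym.
  rewrite -mulrNN -invrN !opprB.
  by apply/andP; split; [apply: divr_ge0|rewrite ler_pdivrMr]; lra.
have E j : (j < 3)%N -> crd j x = crd j ((1 - (crd k x - crd k p) / (crd k q - crd k p)) *: p +
   ((crd k x - crd k p) / (crd k q - crd k p)) *: q).
  move=> j3; rewrite !crdE; have [->|jk] := eqVneq j k; first by field.
  by rewrite -(flat j j3 jk) (flatx j j3 jk); ring.
by apply: vec3P; apply: E.
Qed.

Lemma grid_trefoilE :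
  grid_trefoil = segs [seq (grid_point e.1, grid_point e.2) | e <- grid_edges].
Proof.
rewrite /grid_trefoil -[grid_vertices]/((0, 0, 0)%N :: behead grid_vertices) map_cons.
by rewrite closed_polygonE -map_rcons edges_map.
Qed.

Lemma grid_edge_bounds e : e \in grid_edges ->
  [/\ (e.1.1.1 < 5)%N && (e.2.1.1 < 5)%N, (e.1.1.2 < 5)%N && (e.2.1.2 < 5)%N &
      (e.1.2 < 2)%N && (e.2.2 < 2)%N].
Proof. by move=> eE; apply/and3P; move: e eE; apply/allP; vm_compute. Qed.

Lemma betweenE n (t : R) i j : (i < n)%N -> (j < n)%N ->
  between i j (cell n 0 t) = (Num.min (i%:R : R) j%:R <= t <= Num.max i%:R j%:R).
Proof.
move=> ii jj; rewrite /between cell_ge ?cell_le ?gtn_max ?gtn_min ?ii ?jj // !add0r.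
by rewrite -natr_min -natr_max.
Qed.

Lemma on_edgeE x e : e \in grid_edges -> on_edge (cells x) e ->
  forall j, (j < 3)%N -> Num.min (crd j (grid_point e.1)) (crd j (grid_point e.2)) <=
   crd j x <= Num.max (crd j (grid_point e.1)) (crd j (grid_point e.2)).
Proof.
move=> /grid_edge_bounds[/andP[? ?] /andP[? ?] /andP[? ?]].
rewrite /on_edge !betweenE // => /and3P[? ? ?].
by move=> [|[|[|//]]] _; rewrite /grid_point !crd_point3.
Qed.

Lemma on_gridP x : on_grid (cells x) -> grid_trefoil x.
Proof.
move=> /hasP[e eE /(on_edgeE eE) E]; rewrite grid_trefoilE.
exists (grid_point e.1, grid_point e.2); first by apply/mapP; exists e.
have : [|| (e.1.1.1 == e.2.1.1) && (e.1.1.2 == e.2.1.2),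
    (e.1.1.1 == e.2.1.1) && (e.1.2 == e.2.2) | (e.1.1.2 == e.2.1.2) && (e.1.2 == e.2.2)].
  by move: e eE {E}; apply/allP; vm_compute.
case/or3P => /andP[/eqP e1 /eqP e2].
- by apply: (@box_seg _ _ _ 2) => // -[|[|[|//]]] // _ _; rewrite !crd_point3 /= ?e1 ?e2.
- by apply: (@box_seg _ _ _ 1) => // -[|[|[|//]]] // _ _; rewrite !crd_point3 /= ?e1 ?e2.
- by apply: (@box_seg _ _ _ 0) => // -[|[|[|//]]] // _ _; rewrite !crd_point3 /= ?e1 ?e2.
Qed.

Lemma grid_trefoil_on x : grid_trefoil x -> on_grid (cells x).
Proof.
rewrite grid_trefoilE => -[_ /mapP[e eE ->] [t /andP[t0 t1] /= ->]].
apply/hasP; exists e => //.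
have [/andP[? ?] /andP[? ?] /andP[? ?]] := grid_edge_bounds eE.
have B (a b : R) : Num.min a b <= (1 - t) * a + t * b <= Num.max a b.
  by case: (ltrP a b) => ?; apply/andP; split; nra.
by rewrite /on_edge !betweenE // /grid_point !crdE !B.
Qed.

Let L (x y : V) : dih3 := transport (cells x) (cells y).

Let L_trans x y z : ~ grid_trefoil x -> cells y \in nbrs3 (cells x) -> cells z \in nbrs3 (cells y) ->
  L x z = (L x y * L y z)%g.
Proof.
move=> Kx xy yz; have := allP transport_checkT _ (cells_in x).
by case/orP=> [/on_gridP/Kx //|/allP H]; exact: (eqP (allP (H _ xy) _ yz)).
Qed.

Lemma grid_local_system : local_system (~` grid_trefoil) L.
Proof.
move=> x Kx; near=> y.
have xy : cells y \in nbrs3 (cells x) by near: y; exact: cells_near.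
have := cells_near y; near_simpl => C; near=> z.
by apply: L_trans => //; near: z.
Unshelve. all: by end_near. Qed.

Lemma grid_not_cyclic : ~ cyclic_systems dih3 (~` grid_trefoil).
Proof.
move=> /(_ _ grid_local_system)[f [g fg]].
(* Cyclicity is given for infinitely close points only. Along the segment from [x] to [z] the cells
   stay among the neighbours of that of [x], where [L] is multiplicative, so the property spreads to
   all of the segment. *)
have star x z : ~~ on_grid (cells x) -> cells z \in nbrs3 (cells x) ->
    (f x * L x z * (f z)^-1 \in <[g]>)%g.
  move=> Kx xz.
  pose P t := (f x * L x (line x z t) * (f (line x z t))^-1 \in <[g]>)%g.
  suff : P 1 by rewrite /P line1.
  have Ux : ~ grid_trefoil x by move=> /grid_trefoil_on; apply/negP.
  have xy t : 0 <= t <= 1 -> cells (line x z t) \in nbrs3 (cells x).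
    move=> /andP[t0 t1]; move: xz; rewrite !mem_nbrs3 => /and3P[z0 z1 z2].
    have B j : crd j x <= crd j (line x z t) <= crd j z \/ crd j z <= crd j (line x z t) <= crd j x.
      rewrite /line !crdE; case: (lerP (crd j x) (crd j z)) => ?; [left|right];
        by apply/andP; split; nra.
    by apply/and3P; split; [exact: (cell_between z0)|exact: (cell_between z1)|exact: (cell_between z2)].
  have Uy t : 0 <= t <= 1 -> ~ grid_trefoil (line x z t).
    move=> /xy h /grid_trefoil_on; apply/negP; move: Kx => /negPf Kx.
    by have /allP/(_ _ (cells_in x)) := grid_closed; rewrite Kx => /allP/(_ _ h).
  apply: (@segment_induction R 0 1 P _ 0 1); rewrite ?lexx ?ler01 //; last first.
    rewrite /P line0; have -> : L x x = 1%g.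
      have xx : cells x \in nbrs3 (cells x) by have := xy 0; rewrite line0 lexx ler01 => /(_ isT).
      by apply: (mulgI (L x x)); rewrite mulg1 -(L_trans Ux xx xx).
    by rewrite mulg1 mulgV group1.
  move=> t t01.
  have C1 := @line_continuousr R x z t _ (fg _ (Uy t t01)).
  have C2 := @line_continuousr R x z t _ (cells_near (line x z t)).
  near=> s => s01.
  have h1 : (f (line x z t) * L (line x z t) (line x z s) * (f (line x z s))^-1 \in <[g]>)%g by near: s.
  have h2 : cells (line x z s) \in nbrs3 (cells (line x z t)) by near: s.
  rewrite /P (L_trans Ux (xy t t01) h2).
  by rewrite (transport_chain _ _ _ (f (line x z t))) groupMr.
pose rep (a : nat) : R := (a%:R - 1) / 2.
pose P (a : gridcell) : V := point3 (rep a.1.1) (rep a.1.2) (rep a.2).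
have cellP a : a \in all_cells -> cells (P a) = a.
  have C n b : b \in iota 0 n.*2.+1 -> cell n 0 (rep b) = b.
    by rewrite mem_iota => bn; rewrite -(add0r (rep b)); exact: cell_half.
  case/allpairsP=> p [] /allpairsP[q [q1 q2 pq]] p2 ->; rewrite pq.
  by rewrite /cells /P !crd_point3 (C 5%N _ q1) (C 5%N _ q2) (C 2%N _ p2).
have step (a b : gridcell) : a \in all_cells -> b \in all_cells -> ~~ on_grid a -> b \in nbrs3 a ->
    (f (P a) * transport a b * (f (P b))^-1 \in <[g]>)%g.
  by move=> aA bA na ab; have := star (P a) (P b); rewrite /L !cellP //; exact.
have walk a s : a \in all_cells ->
    all (fun e => [&& e.1 \in all_cells, e.2 \in all_cells & ~~ on_grid e.1]) s ->
    zigzag a s -> (f (P a) * monodromy a s * (f (P (last a (map snd s))))^-1 \in <[g]>)%g.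
  elim: s a => [|[u b] s IH] a /= aA; first by rewrite mulg1 mulgV group1.
  move=> /andP[/and3P[uA bA nu] sA] /and3P[ua ub zs].
  have k1 := step _ _ uA aA nu ua; have k2 := step _ _ uA bA nu ub.
  have k3 := IH _ bA sA zs.
  rewrite -(zigzag_chain (f (P a)) (transport u b) (f (P b)) (f (P u)) (transport u a)).
  exact: (groupM (groupM (groupVr k1) k2) k3).
(* The cell [A] lies above the diagram, between columns 0 and 1. The loop [s0] descends beyond
   column 0 and returns under it through its curtain, and [s1] does the same with column 1. Their
   monodromies are two distinct reflections, which do not commute. *)
pose A : gridcell := (2, 4, 4)%N.
pose s0 : seq (gridcell * gridcell) := [:: ((1, 4, 4), (0, 4, 4)); ((0, 4, 3), (0, 4, 2));
  ((1, 4, 2), (2, 4, 2)); ((2, 4, 3), A)]%N.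
pose s1 : seq (gridcell * gridcell) := [:: ((3, 4, 4), (4, 4, 4)); ((4, 4, 3), (4, 4, 2));
  ((3, 4, 2), (2, 4, 2)); ((2, 4, 3), A)]%N.
have m0 : (f (P A) * reflection 0 * (f (P A))^-1 \in <[g]>)%g by apply: (walk A s0).
have m1 : (f (P A) * reflection 1 * (f (P A))^-1 \in <[g]>)%g by apply: (walk A s1).
have := cycle_conj_comm m0 m1.
by apply/eqP.
Unshelve. all: by end_near. Qed.
End GridTrefoil.

(** * Certified polygon moves over the integers *)

Record zpt := ZPt { zx : Z; zy : Z; zz : Z }.

Definition zadd (p q : zpt) := ZPt (zx p + zx q)%BinZ (zy p + zy q)%BinZ (zz p + zz q)%BinZ.
Definition zopp (p : zpt) := ZPt (- zx p)%BinZ (- zy p)%BinZ (- zz p)%BinZ.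
Definition zsub (p q : zpt) := ZPt (zx p - zx q)%BinZ (zy p - zy q)%BinZ (zz p - zz q)%BinZ.
Definition zscale (k : Z) (p : zpt) := ZPt (k * zx p)%BinZ (k * zy p)%BinZ (k * zz p)%BinZ.
Definition zdot (p q : zpt) := (zx p * zx q + zy p * zy q + zz p * zz q)%BinZ.
Definition zcross (p q : zpt) := ZPt (zy p * zz q - zz p * zy q)%BinZ
  (zz p * zx q - zx p * zz q)%BinZ (zx p * zy q - zy p * zx q)%BinZ.
Definition zeqb (p q : zpt) := [&& (zx p =? zx q)%BinZ, (zy p =? zy q)%BinZ & (zz p =? zz q)%BinZ].

Lemma zeqP : Equality.axiom zeqb.
Proof.
move=> [x y z] [x' y' z']; apply: (iffP and3P) => [[/Z.eqb_spec /= -> /Z.eqb_spec /= -> /Z.eqb_spec /= ->]//|].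
by case=> -> -> ->; rewrite /= !Z.eqb_refl.
Qed.
HB.instance Definition _ := hasDecEq.Build zpt zeqP.

Section Embedding.
Context {R : realType}.
Notation V := 'rV[R]_3.

Definition zr (x : Z) : R := (int_of_Z x)%:~R.

Lemma zrD x y : zr (x + y)%BinZ = zr x + zr y. Proof. by rewrite /zr -intrD -rmorphD. Qed.
Lemma zrN x : zr (- x)%BinZ = - zr x. Proof. by rewrite /zr -intrN -rmorphN. Qed.
Lemma zrB x y : zr (x - y)%BinZ = zr x - zr y. Proof. by rewrite -zrN -zrD. Qed.
Lemma zrM x y : zr (x * y)%BinZ = zr x * zr y. Proof. by rewrite /zr -intrM -rmorphM. Qed.
Definition zrE := (zrD, zrN, zrB, zrM).

Lemma zr_lt x y : (x <? y)%BinZ = (zr x < zr y).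
Proof. by rewrite /zr ltr_int; lia. Qed.
Lemma zr_le x y : (x <=? y)%BinZ = (zr x <= zr y).
Proof. by rewrite /zr ler_int; lia. Qed.
Lemma zr_eq x y : (x =? y)%BinZ = (zr x == zr y).
Proof. by rewrite /zr eqr_int; lia. Qed.
Lemma zr0 : zr 0 = 0. Proof. by []. Qed.

Definition vec (p : zpt) : V := point3 (zr (zx p)) (zr (zy p)) (zr (zz p)).

Lemma vec_inj : injective vec.
Proof.
move=> p q pq; apply/eqP; rewrite /eq_op /= /zeqb !zr_eq.
by apply/and3P; split; apply/eqP; [move/(congr1 (crd 0)): pq|move/(congr1 (crd 1)): pq|
  move/(congr1 (crd 2)): pq]; rewrite !crd_point3.
Qed.

Lemma vecD p q : vec (zadd p q) = vec p + vec q.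
Proof. by apply: vec3P; rewrite !crdE !zrE. Qed.
Lemma vecN p : vec (zopp p) = - vec p.
Proof. by apply: vec3P; rewrite !crdE !zrE. Qed.
Lemma vecB p q : vec (zsub p q) = vec p - vec q.
Proof. by apply: vec3P; rewrite !crdE !zrE. Qed.
Lemma vecZ k p : vec (zscale k p) = zr k *: vec p.
Proof. by apply: vec3P; rewrite !crdE !zrE. Qed.
Lemma vec_dot p q : zr (zdot p q) = dot (vec p) (vec q).
Proof. by rewrite dotE !crdE !zrE. Qed.
Lemma vec_cross p q : vec (zcross p q) = cross (vec p) (vec q).
Proof. by apply: vec3P; rewrite !crdE !zrE. Qed.
End Embedding.

Definition apart (la lb lc lp lq : Z) : bool :=
  if (lp <? la)%BinZ
  then [&& lp <? lb, lp <? lc, lq <? la, lq <? lb & lq <? lc]%BinZ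
  else [&& la <? lp, lb <? lp, lc <? lp, la <? lq, lb <? lq & lc <? lq]%BinZ.

(** The edge [bq] shares [b] with the triangle, so strict separation is impossible. Instead the
    direction [d] has to leave the angle at [b]: it lies off the plane, or one of its coordinates in
    the basis [al], [ga], which are the last two expressions up to the factor [|n|^2], is
    negative. *)
Definition cone_free (a c b q : zpt) : bool :=
  let al := zsub a b in let ga := zsub c b in let n := zcross al ga in let d := zsub q b in
  [|| ~~ (zdot d n =? 0)%BinZ, (zdot (zcross d ga) n <? 0)%BinZ | (zdot (zcross al d) n <? 0)%BinZ].

(* [sep a b c es] must imply that no segment in [es] meets the triangle abc. *)
Definition separator := zpt -> zpt -> zpt -> seq (zpt * zpt) -> bool.

Definition removable (sep : separator) (a c b : zpt) (l : seq zpt) : bool :=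
  if l is q :: l' then
    [&& zcross (zsub b a) (zsub c a) != ZPt 0 0 0, cone_free a c b q, cone_free b c a (last q l') &
        sep a b c (edges q l')]
  else false.

(* The functionals whose level planes are parallel to the mirrors of the Coxeter
   group of the cube. *)
Definition mirror_functionals : seq (zpt -> Z) :=
  [:: zx; zy; zz; (fun p => zx p + zy p)%BinZ; (fun p => zx p - zy p)%BinZ;
      (fun p => zx p + zz p)%BinZ; (fun p => zx p - zz p)%BinZ;
      (fun p => zy p + zz p)%BinZ; (fun p => zy p - zz p)%BinZ].

Fixpoint unseparated (l : zpt -> Z) (la lb lc : Z) (es : seq (zpt * zpt)) : seq (zpt * zpt) :=
  if es is (p, q) :: es' then
    if apart la lb lc (l p) (l q) then unseparated l la lb lc es'
    else (p, q) :: unseparated l la lb lc es'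
  else [::].

Fixpoint separated_by (ls : seq (zpt -> Z)) a b c (es : seq (zpt * zpt)) : bool :=
  if es is [::] then true else
  if ls is l :: ls' then separated_by ls' a b c (unseparated l (l a) (l b) (l c) es)
  else false.

Definition mirror_separator : separator := separated_by mirror_functionals.

(* The candidates of the separating axis theorem for a triangle and a segment. *)
Definition axes (a b c p q : zpt) : seq zpt :=
  let u := zsub b a in let v := zsub c a in let w := zsub c b in let d := zsub q p in
  let n := zcross u v in
  [:: n; zcross u d; zcross v d; zcross w d; zcross n u; zcross n v; zcross n w].

Definition axis_separator : separator := fun a b c es =>
  all (fun e => has (fun n => apart (zdot n a) (zdot n b) (zdot n c) (zdot n e.1) (zdot n e.2))
                    (axes a b c e.1 e.2)) es.

(** A greedy strategy: each round cuts the corner at the front if possible and rotates the polygon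
    in any case. The fuel [n] counts the rounds. *)
Fixpoint reduces_to_triangle (n : nat) (s : seq zpt) : bool :=
  if n isn't n'.+1 then false else
  match s with
  | a :: c :: b :: l =>
      if l is [::] then zcross (zsub c a) (zsub b a) != ZPt 0 0 0
      else if removable mirror_separator a c b l then reduces_to_triangle n' (b :: rcons l a)
      else reduces_to_triangle n' (c :: b :: rcons l a)
  | _ => false
  end.

Inductive move := Cut | Push of zpt.

Definition do_move (s : seq zpt) (m : nat * move) : option (seq zpt) :=
  match m.2, rot m.1 s with
  | Cut, a :: c :: b :: l => if removable axis_separator a c b l then Some (a :: b :: l) else None
  | Push c, a :: b :: l => if removable axis_separator a c b l then Some (a :: c :: b :: l) else None
  | _, _ => None
  end.

Fixpoint do_moves (s : seq zpt) (ms : seq (nat * move)) : option (seq zpt) :=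
  if ms is m :: ms' then obind (do_moves^~ ms') (do_move s m) else Some s.

(** * Soundness of the integer certificates *)

Section Soundness.
Context {R : realType}.
Notation V := 'rV[R]_3.
Local Notation vec := (@vec R).
Local Notation zr := (@zr R).
Let zr_lt := @zr_lt R.
Let zr_eq := @zr_eq R.

Definition segment_apart (a b c p q : V) := exists (n : V) (r : R),
  [/\ r < dot n a, r < dot n b, r < dot n c, dot n p <= r & dot n q <= r].

Lemma apart_segment (l : zpt -> Z) (n : V) (a b c p q : zpt) :
  (forall x, zr (l x) = dot n (vec x)) -> apart (l a) (l b) (l c) (l p) (l q) ->
  segment_apart (vec a) (vec b) (vec c) (vec p) (vec q).
Proof.
move=> ln; rewrite /apart; case: ifP => [|_].
  rewrite !zr_lt !ln => pa /and5P[pb pc qa qb qc].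
  exists n, (Num.max (dot n (vec p)) (dot n (vec q))).
  by rewrite !gt_max !le_max !lexx pa pb pc qa qb qc orbT.
rewrite !zr_lt !ln => /andP[pa /and5P[pb pc qa qb qc]].
exists (- n), (Num.max (- dot n (vec p)) (- dot n (vec q))).
rewrite ![dot (- n) _]dotC !dotNr ![dot _ n]dotC.
by rewrite !gt_max !le_max !lexx !ltrN2 pa pb pc qa qb qc orbT.
Qed.

Definition sound (sep : separator) := forall a b c es, sep a b c es ->
  forall e, e \in es -> segment_apart (vec a) (vec b) (vec c) (vec e.1) (vec e.2).

Lemma mirror_separator_sound : sound mirror_separator.
Proof.
rewrite /mirror_separator; have : forall l, List.In l mirror_functionals ->
    exists n, forall x, zr (l x) = dot n (vec x).
  have E x y z : exists n : V, forall p, x * zr (zx p) + y * zr (zy p) + z * zr (zz p) = dot n (vec p).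
    by exists (point3 x y z) => p; rewrite dotE !crdE.
  move=> l [<-|[<-|[<-|[<-|[<-|[<-|[<-|[<-|[<-|[]]]]]]]]]].
  - by have [n En] := E 1 0 0; exists n => p; rewrite -En; ring.
  - by have [n En] := E 0 1 0; exists n => p; rewrite -En; ring.
  - by have [n En] := E 0 0 1; exists n => p; rewrite -En; ring.
  - by have [n En] := E 1 1 0; exists n => p; rewrite -En zrD; ring.
  - by have [n En] := E 1 (-1) 0; exists n => p; rewrite -En zrB; ring.
  - by have [n En] := E 1 0 1; exists n => p; rewrite -En zrD; ring.
  - by have [n En] := E 1 0 (-1); exists n => p; rewrite -En zrB; ring.
  - by have [n En] := E 0 1 1; exists n => p; rewrite -En zrD; ring.
  - by have [n En] := E 0 1 (-1); exists n => p; rewrite -En zrB; ring.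
elim: mirror_functionals => [|l ls IH] lin a b c es; first by case: es.
have [n ln] := lin l (or_introl erefl).
have {}IH := IH (fun k kls => lin k (or_intror kls)) a b c.
move=> H; have /IH{H}IH : separated_by ls a b c (unseparated l (l a) (l b) (l c) es).
  by case: es H => //; case: (ls).
move=> e; move: es IH.
elim=> // -[p q] es IHes; rewrite [unseparated _ _ _ _ _]/=.
case: ifP => [apq H|_ H]; rewrite inE => /predU1P[->|ees].
- exact: (apart_segment ln apq).
- exact: IHes.
- by apply: H; rewrite inE eqxx.
- by apply: IHes => // f fu; apply: H; rewrite inE fu orbT.
Qed.

Lemma axis_separator_sound : sound axis_separator.
Proof.
move=> a b c es /allP H e /H /hasP[n _]; apply: (@apart_segment (zdot n) (vec n)) => x.
exact: vec_dot.
Qed.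

(** The vectors [s] and [t] are dual to [u] and [v] up to the factor [dot n n]. The functional
    [s + t] is positive on [u] and [v]; it is made nonpositive on [d] by adding a multiple of the
    normal, or by increasing the weight of the one of [s], [t] that is negative on [d]. *)
Lemma cone_separation (u v d : V) : cross u v != 0 ->
  [\/ dot d (cross u v) != 0, dot (cross d v) (cross u v) < 0 |
      dot (cross u d) (cross u v) < 0] ->
  exists n : V, [/\ 0 < dot n u, 0 < dot n v & dot n d <= 0].
Proof.
set n := cross u v => n0 H; have N0 := dot_gt0 n0.
pose s := cross v n; pose t := cross n u.
have su : dot s u = dot n n by rewrite /s /n !dotE !crdE; ring.
have sv : dot s v = 0 by rewrite /s /n !dotE !crdE; ring.
have tu : dot t u = 0 by rewrite /t /n !dotE !crdE; ring.
have tv : dot t v = dot n n by rewrite /t /n !dotE !crdE; ring.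
have nu : dot n u = 0 by exact: dot_cross_l.
have nv : dot n v = 0 by exact: dot_cross_r.
have sd : dot s d = dot (cross d v) n by rewrite /s /n !dotE !crdE; ring.
have td : dot t d = dot (cross u d) n by rewrite /t /n !dotE !crdE; ring.
have comb (x y z : R) w : dot (x *: s + y *: t + z *: n) w = x * dot s w + y * dot t w + z * dot n w.
  by rewrite !(dotC _ w) !dotRE.
case: H => H.
- exists (1 *: s + 1 *: t + (- (`|dot s d + dot t d| / dot d n)) *: n).
  rewrite !comb su sv tu tv nu nv.
  have -> : - (`|dot s d + dot t d| / dot d n) * dot n d = - `|dot s d + dot t d|.
    by rewrite (dotC n d) mulNr divfK.
  by have := ler_norm (dot s d + dot t d); split; lra.
- exists ((`|dot t d| + 1) / (- dot s d) *: s + 1 *: t + 0 *: n).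
  have M0 : 0 < (`|dot t d| + 1) / (- dot s d).
    by apply: divr_gt0; [have := normr_ge0 (dot t d); lra|rewrite sd; lra].
  rewrite !comb su sv tu tv nu nv.
  have -> : (`|dot t d| + 1) / (- dot s d) * dot s d = - (`|dot t d| + 1).
    by rewrite invrN mulrN mulNr divfK // sd lt_eqF.
  by have := ler_norm (dot t d); have := mulr_gt0 M0 N0; split; lra.
- exists (1 *: s + (`|dot s d| + 1) / (- dot t d) *: t + 0 *: n).
  have M0 : 0 < (`|dot s d| + 1) / (- dot t d).
    by apply: divr_gt0; [have := normr_ge0 (dot s d); lra|rewrite td; lra].
  rewrite !comb su sv tu tv nu nv.
  have -> : (`|dot s d| + 1) / (- dot t d) * dot t d = - (`|dot s d| + 1).
    by rewrite invrN mulrN mulNr divfK // td lt_eqF.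
  by have := ler_norm (dot s d); have := mulr_gt0 M0 N0; split; lra.
Qed.

Lemma cone_freeP (a c b q : zpt) : zcross (zsub a b) (zsub c b) != ZPt 0 0 0 -> cone_free a c b q ->
  exists n : V, [/\ 0 < dot n (vec a - vec b), 0 < dot n (vec c - vec b) & dot n (vec q - vec b) <= 0].
Proof.
move=> n0 H; apply: cone_separation.
  rewrite -!vecB -vec_cross; apply: contraNneq n0 => e.
  by apply/eqP/(@vec_inj R); rewrite e; apply: vec3P; rewrite !crdE.
move: H; rewrite /cone_free !zr_lt !zr_eq !vec_dot !vec_cross !vecB => /or3P[]; last 2 first.
- by constructor 2.
- by constructor 3.
by constructor 1.
Qed.

Lemma removable_avoids sep a c b l : sound sep -> removable sep a c b l ->
  cross (vec b - vec a) (vec c - vec a) != 0 /\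
  forall f, f \in edges b (rcons l a) -> avoids (vec a) (vec b) (vec c) (vec f.1) (vec f.2).
Proof.
move=> ssep; case: l => // q l /and4P[n0 cq cl sl]; split.
  rewrite -!vecB -vec_cross; apply: contraNneq n0 => e.
  by apply/eqP/(@vec_inj R); rewrite e; apply: vec3P; rewrite !crdE.
have n1 : zcross (zsub a b) (zsub c b) != ZPt 0 0 0.
  apply: contraNneq n0 => /(congr1 vec); rewrite vec_cross !vecB => e.
  apply/eqP/(@vec_inj R); rewrite vec_cross !vecB.
  have -> : cross (vec b - vec a) (vec c - vec a) = - cross (vec a - vec b) (vec c - vec b).
    by apply: vec3P; rewrite !crdE; ring.
  by rewrite e; apply: vec3P; rewrite !crdE /= oppr0.
have n2 : zcross (zsub b a) (zsub c a) != ZPt 0 0 0 by [].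
move=> f; rewrite rcons_cons /= inE -cats1 edges_cat mem_cat inE.
case/or3P=> [/eqP -> /=|fl|/eqP -> /=].
- have [n [na nc nq]] := cone_freeP n1 cq; exists n, (dot n (vec b)) => /=.
  by move: na nc nq; rewrite !dotRE => ? ? ?; split; [lra|lra|lra|lra|split; lra].
- have [n [r [ra rb rc rp rq]]] := ssep _ _ _ _ sl f fl; exists n, r => /=.
  by split; [lra|lra|lra|lra|split; lra].
- have [n [na nc nq]] := cone_freeP n2 cl; exists n, (dot n (vec a)) => /=.
  by move: na nc nq; rewrite !dotRE => ? ? ?; split; [lra|lra|lra|lra|split; lra].
Qed.
End Soundness.

(** * Chambers and galleries *)

(* The pyramid with center of cube D, center of face D + u1 and the two other
   vertices D + u1 + u2 + u3 (color A) and D + u1 + u2 - u3 (color B). *)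
Record chamber := Chamber { chD : zpt; ch1 : zpt; ch2 : zpt; ch3 : zpt }.

(** The vectors of the new chamber: A and B reflect in the diagonals of the face of the cube, C
    exchanges two faces of the cube, and D passes to the next cube. *)
Definition chamber_step (p : chamber) (s : color) : chamber :=
  match s with
  | colA => Chamber (chD p) (ch1 p) (zopp (ch3 p)) (zopp (ch2 p))
  | colB => Chamber (chD p) (ch1 p) (ch3 p) (ch2 p)
  | colC => Chamber (chD p) (ch2 p) (ch1 p) (ch3 p)
  | colD => Chamber (zadd (chD p) (zadd (ch1 p) (ch1 p))) (zopp (ch1 p)) (ch2 p) (ch3 p)
  end.

Definition chamber_run : chamber -> seq color -> chamber := foldl chamber_step.

Definition base_chamber :=
  Chamber (ZPt 0 0 0) (ZPt 1 0 0) (ZPt 0 1 0) (ZPt 0 0 1).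

(* Four times the barycenter, that is, 4 D + 3 u1 + 2 u2. *)
Definition chamber_center (p : chamber) : zpt :=
  let q := zadd (chD p) (ch1 p) in let r := zadd (zadd (chD p) (ch2 p)) q in
  zadd (zadd r r) (ch1 p).

Fixpoint chamber_walk (p : chamber) (w : seq color) : seq zpt :=
  if w is s :: w' then chamber_center p :: chamber_walk (chamber_step p s) w' else [::].

Definition chamber_lin (p : chamber) (v : zpt) : zpt :=
  zadd (zadd (zscale (zx v) (ch1 p)) (zscale (zy v) (ch2 p))) (zscale (zz v) (ch3 p)).
(** A chamber stands for the affine map that carries [base_chamber] to it; this is the composition
    of these maps. *)
Definition chamber_mul (p q : chamber) : chamber :=
  Chamber (zadd (chD p) (chamber_lin p (chD q))) (chamber_lin p (ch1 q))
          (chamber_lin p (ch2 q)) (chamber_lin p (ch3 q)).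

Definition chamber_eqb (p q : chamber) : bool :=
  [&& zeqb (ch1 p) (ch1 q), zeqb (ch2 p) (ch2 q), zeqb (ch3 p) (ch3 q) & zeqb (chD p) (chD q)].

Definition cubes_to_base (p : chamber) : bool :=
  chamber_eqb (chamber_mul p (chamber_mul p p)) base_chamber.

Definition unknotted_word (g : seq color) : bool :=
  let s := chamber_walk base_chamber (g ++ g ++ g) in
  (* For words of at most 12 letters the polygon has at most 36 vertices; that 200 rounds are enough
     is confirmed by the evaluation of the search. *)
  if uniq s then reduces_to_triangle 200 s else true.

(* Depth-first search: the chamber p is reached by the reversed word w, the walk
   along w has visited the centers vis and is continued by at most n letters of
   al.  The [if]s prevent an eager evaluation of both branches. *)
Fixpoint search (n : nat) (al : seq color) (p : chamber) (w : seq color) (vis : seq zpt) : bool :=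
  (if cubes_to_base p then unknotted_word (rev w) else true) &&
  if n is n'.+1 then
    all (fun s => let q := chamber_step p s in let c := chamber_center q in
           if has (zeqb c) vis then true else search n' al q (s :: w) (c :: vis)) al
  else true.

Definition search_from (s : color) (al : seq color) : bool :=
  let p := chamber_step base_chamber s in
  search 11 al p [:: s] [:: chamber_center p; chamber_center base_chamber].

(** * Transfer of certificates to orthogonal frames *)

Section AffineFrame.
Context {R : realType}.
Notation V := 'rV[R]_3.
Local Notation vec := (@vec R).

Record frame := Frame { fr_o : V; fr_1 : V; fr_2 : V; fr_3 : V; fr_k : R }.

Definition orthogonal_frame (f : frame) : Prop :=
  let: Frame _ e1 e2 e3 k := f in
  [/\ 0 < k, dot e1 e1 = k, dot e2 e2 = k & dot e3 e3 = k] /\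
  [/\ dot e1 e2 = 0, dot e1 e3 = 0 & dot e2 e3 = 0].

Definition lin (f : frame) (x : V) : V :=
  crd 0 x *: fr_1 f + crd 1 x *: fr_2 f + crd 2 x *: fr_3 f.
Definition affine (f : frame) (x : V) : V := fr_o f + lin f x.

Lemma linB f x y : lin f x - lin f y = lin f (x - y).
Proof. by apply: vec3P; rewrite !crdE; ring. Qed.
Lemma affineB f x y : affine f x - affine f y = lin f (x - y).
Proof. by rewrite -linB /affine opprD addrACA subrr add0r. Qed.

Variable f : frame.
Hypothesis hf : orthogonal_frame f.

(** Functionals are transported by the inverse transpose of [lin f], which for an orthogonal frame
    with common squared length [fr_k f] is [lin f] divided by that number. *)
Definition colin (n : V) : V := (fr_k f)^-1 *: lin f n.

Lemma colinP n x : dot (colin n) (lin f x) = dot n x.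
Proof.
move: hf; rewrite /orthogonal_frame /colin /lin; case: f => o e1 e2 e3 k /= [[k0 k1 k2 k3] [k12 k13 k23]].
rewrite dotC dotZr.
set u := _ + _; set w := _ + _.
have -> : dot u w = k * dot n x.
  by rewrite /u /w !dotRE ![dot (_ + _) _]dotC !dotRE k1 k2 k3 k12 k13 k23
    (dotC e2 e1) (dotC e3 e1) (dotC e3 e2) k12 k13 k23 dotE; ring.
by rewrite mulKf // gt_eqF.
Qed.

Lemma lin_inj x y : lin f x = lin f y -> x = y.
Proof.
move=> E; have H n : dot n x = dot n y by rewrite -(colinP n x) -(colinP n y) E.
by apply: vec3P; [have := H (point3 1 0 0)|have := H (point3 0 1 0)|have := H (point3 0 0 1)];
  rewrite !dotE !crdE; lra.
Qed.

Lemma affine_inj : injective (affine f).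
Proof. by move=> x y /addrI; exact: lin_inj. Qed.

Lemma noncollinear_lin u v : cross u v != 0 -> cross (lin f u) (lin f v) != 0.
Proof.
apply: contraNneq => E.
(* By the Binet-Cauchy identity, if the images are parallel then all minors of [u] and [v]
   vanish. *)
have H n m : dot n u * dot m v = dot m u * dot n v.
  rewrite -!(colinP _ u) -!(colinP _ v); set u' := lin f u in E *; set v' := lin f v in E *.
  apply/eqP; rewrite -subr_eq0; set n' := colin n; set m' := colin m.
  have -> : dot n' u' * dot m' v' - dot m' u' * dot n' v' = dot (cross n' m') (cross u' v').
    by rewrite !dotE !crdE; ring.
  by rewrite E dotE !crd0 !mulr0 !addr0.
have e0 := H (point3 1 0 0) (point3 0 1 0); have e1 := H (point3 0 1 0) (point3 0 0 1).
have e2 := H (point3 0 0 1) (point3 1 0 0).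
by apply/eqP; apply: vec3P; move: e0 e1 e2; rewrite !dotE !crdE; lra.
Qed.

Lemma avoids_affine a b c p q : avoids a b c p q ->
  avoids (affine f a) (affine f b) (affine f c) (affine f p) (affine f q).
Proof.
move=> [n [r /= H]]; exists (colin n), (r + dot (colin n) (fr_o f)) => /=.
have E x : dot (colin n) (affine f x) - (r + dot (colin n) (fr_o f)) = dot n x - r.
  by rewrite /affine dotDr colinP; ring.
by rewrite !E.
Qed.

Definition place (p : zpt) : V := affine f (vec p).

Lemma removable_isotopic sep a c b l : sound (R := R) sep -> removable sep a c b l ->
  ambient_isotopic (closed_polygon (map place (a :: c :: b :: l)))
                   (closed_polygon (map place (a :: b :: l))).
Proof.
move=> ssep /(removable_avoids ssep)[nc avo]; apply: polygon_move.
  by rewrite !affineB; exact: noncollinear_lin.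
move=> e; rewrite -map_rcons edges_map => /mapP[e' /avo ae' ->].
exact: avoids_affine.
Qed.

Lemma closed_polygon_place_rot n s :
  closed_polygon (map place (rot n s)) = closed_polygon (map place s).
Proof. by rewrite map_rot closed_polygon_rot. Qed.

Lemma reduces_to_triangle_unknot n s : reduces_to_triangle n s ->
  ambient_isotopic (closed_polygon (map place s)) (unknot R).
Proof.
elim: n s => // n IH [|a [|c [|b [|q l]]]] // H.
  apply: triangle_unknot; rewrite /noncollinear !affineB; apply: noncollinear_lin.
  rewrite -!vecB -vec_cross; move: H => /=; apply: contraNneq => e.
  by apply/eqP/(@vec_inj R); rewrite e; apply: vec3P; rewrite !crdE.
move: H; rewrite /reduces_to_triangle -/reduces_to_triangle.
case: ifP => [rm|_] /IH.
  apply: ambient_isotopic_trans; rewrite (_ : _ :: rcons _ _ = rot 1 (a :: b :: q :: l)); last by rewrite rot1_cons.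
  by rewrite closed_polygon_place_rot; apply: (removable_isotopic _ rm); exact: mirror_separator_sound.
rewrite (_ : c :: _ = rot 1 (a :: c :: b :: q :: l)); last by rewrite rot1_cons.
by rewrite closed_polygon_place_rot.
Qed.

Lemma do_moves_isotopic s ms s' : do_moves s ms = Some s' ->
  ambient_isotopic (closed_polygon (map place s)) (closed_polygon (map place s')).
Proof.
have as_ := axis_separator_sound.
elim: ms s => [|[n m] ms IH] s /=; first by move=> [->]; exact: ambient_isotopic_refl.
rewrite /do_move /= -(closed_polygon_place_rot n s).
case: m => [|c]; case: (rot n s) => [|a [|b l]] //.
  case: l => // b' l; case: ifP => // rm /IH; apply: ambient_isotopic_trans.
  exact: (removable_isotopic (@as_ R) rm).
case: ifP => // rm /IH; apply: ambient_isotopic_trans.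
exact/ambient_isotopic_sym/(removable_isotopic (@as_ R) rm).
Qed.
End AffineFrame.

(** * Pyramids and their neighbours *)

Section Pyramids.
Context {R : realType}.
Notation V := 'rV[R]_3.
Implicit Types (p q : pyramid R) (s c : color).

Definition flip s p c : V :=
  match s, c with
  | colA, colA => 2 *: p colC - p colA
  | colB, colB => 2 *: p colC - p colB
  | colC, colC => p colD + 2^-1 *: (p colA + p colB) - p colC
  | colD, colD => 2 *: p colC - p colD
  | _, _ => p c
  end.

Lemma flip_other s p c : c <> s -> flip s p c = p c.
Proof. by case: s; case: c. Qed.

(** The legs of the pyramid as an orthoscheme, from the center of the cube to that of the face, on
    to the midpoint of the edge and on to its end [A]: pairwise orthogonal vectors of length 1/2. *)
Definition pyramid_u1 p := p colC - p colD.
Definition pyramid_u2 p := 2^-1 *: (p colA + p colB) - p colC.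
Definition pyramid_u3 p := 2^-1 *: (p colA - p colB).

(* A quarter of the half edges, so that the barycenters of the pyramids of the
   tessellation become integer points. *)
Definition pyramid_frame p : frame :=
  Frame (p colD) (4^-1 *: pyramid_u1 p) (4^-1 *: pyramid_u2 p) (4^-1 *: pyramid_u3 p) 64^-1.

Lemma third_index (i j : 'I_3) : i != j ->
  exists m, [/\ m != i, m != j & forall k, k != i -> k != j -> k = m].
Proof.
move=> ij; have [m /andP[mi mj]|H] := pickP (fun m : 'I_3 => (m != i) && (m != j)).
  exists m; split=> // k ki kj.
  move: i j m k ij mi mj ki kj; do 4!case=> -[|[|[|//]]] ?; move=> //; rewrite -?val_eqE //= => _ _ _ _ _; exact/val_inj.
have := H (inord 0); have := H (inord 1); have := H (inord 2).
by move: i j ij {H}; do 2!case=> -[|[|[|//]]] ?; rewrite -?val_eqE //= !inordK.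
Qed.

Lemma pyramid_coordinates p : is_pyramid p ->
  exists (i j m : 'I_3) (s1 s2 s3 : R),
  [/\ [/\ i != j, m != i & m != j], [/\ s1 ^+ 2 = 4^-1, s2 ^+ 2 = 4^-1 & s3 ^+ 2 = 4^-1] &
  forall k, [/\ pyramid_u1 p 0 k = if k == i then s1 else 0,
    pyramid_u2 p 0 k = if k == m then s2 else 0 &
    pyramid_u3 p 0 k = if k == j then s3 else 0]].
Proof.
move=> [z [a [b [i [j [[az bz ij ab] _ [pA pB pC pD]]]]]]].
have [m [mi mj kijm]] := third_index ij.
have ha k : (a 0 k)%:~R = (z 0 k)%:~R :> R \/ (a 0 k)%:~R = (z 0 k)%:~R + 1 :> R.
  by case: (az k) => ->; [left|right]; rewrite ?intrD.
have hb k : (b 0 k)%:~R = (z 0 k)%:~R :> R \/ (b 0 k)%:~R = (z 0 k)%:~R + 1 :> R.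
  by case: (bz k) => ->; [left|right]; rewrite ?intrD.
have eab k : k != j -> (b 0 k)%:~R = (a 0 k)%:~R :> R by rewrite -ab => /eqP ->.
have nab : (a 0 j)%:~R != (b 0 j)%:~R :> R by rewrite eqr_int ab eqxx.
exists i, j, m, ((a 0 i)%:~R - ((z 0 i)%:~R + 2^-1)), ((a 0 m)%:~R - ((z 0 m)%:~R + 2^-1)),
  (2^-1 * ((a 0 j)%:~R - (b 0 j)%:~R)).
split; first by [].
  split; [by case: (ha i) => ->; field|by case: (ha m) => ->; field|].
  by case: (ha j) (hb j) nab => -> [] ->; rewrite ?eqxx // => _; field.
move=> k; rewrite /pyramid_u1 /pyramid_u2 /pyramid_u3 pA pB pC pD !mxE.
have [ki|ki] := eqVneq k i.
  by rewrite ki (negPf ij) eq_sym (negPf mi) (eab i) //; split => //; field.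
have [km|km] := eqVneq k m.
  by rewrite km (negPf mj) (eab m) //; split => //; field.
have [->|kj] := eqVneq k j; last by case/eqP: km; exact: kijm.
split => //; first by ring.
by case: (ha j) (hb j) nab => -> [] ->; rewrite ?eqxx // => _; field.
Qed.

Lemma pyramid_orthogonal p : is_pyramid p -> orthogonal_frame (pyramid_frame p).
Proof.
move=> /pyramid_coordinates[i [j [m [s1 [s2 [s3 [[ij mi mj] [q1 q2 q3] H]]]]]]].
have D (u v : V) x y (k l : 'I_3) : (forall n, u 0 n = if n == k then x else 0) ->
    (forall n, v 0 n = if n == l then y else 0) -> dot u v = if k == l then x * y else 0.
  move=> uk vl; rewrite /dot (bigD1 k) //= uk eqxx vl big1 ?addr0; first by case: ifP => // _; rewrite mulr0.
  by move=> n /negPf nk; rewrite uk nk mul0r.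
have H1 k : pyramid_u1 p 0 k = if k == i then s1 else 0 by case: (H k).
have H2 k : pyramid_u2 p 0 k = if k == m then s2 else 0 by case: (H k).
have H3 k : pyramid_u3 p 0 k = if k == j then s3 else 0 by case: (H k).
have Z (u v : V) r : dot u v = r -> dot (4^-1 *: u) (4^-1 *: v) = r / 16.
  by move=> <-; rewrite dotC dotZr dotC dotZr; field.
rewrite /pyramid_frame; split; split; first lra.
- by rewrite (Z _ _ _ (D _ _ _ _ _ _ H1 H1)) eqxx -expr2 q1; field.
- by rewrite (Z _ _ _ (D _ _ _ _ _ _ H2 H2)) eqxx -expr2 q2; field.
- by rewrite (Z _ _ _ (D _ _ _ _ _ _ H3 H3)) eqxx -expr2 q3; field.
- by rewrite (Z _ _ _ (D _ _ _ _ _ _ H1 H2)) eq_sym (negPf mi) mul0r.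
- by rewrite (Z _ _ _ (D _ _ _ _ _ _ H1 H3)) (negPf ij) mul0r.
- by rewrite (Z _ _ _ (D _ _ _ _ _ _ H2 H3)) (negPf mj) mul0r.
Qed.

Lemma flip_pyramid s p : is_pyramid p -> is_pyramid (flip s p).
Proof.
move=> [z [a [b [i [j [[az bz ij ab] ev [pA pB pC pD]]]]]]].
have [m [mi mj kijm]] := third_index ij.
have sum3 (x : 'rV[int]_3) : \sum_k x 0 k = x 0 i + x 0 j + x 0 m.
  rewrite (bigD1 i) //= (bigD1 j) 1?eq_sym //= (bigD1 m) /=; last by rewrite mi mj.
  rewrite big1 ?addr0 ?addrA // => k /andP[/andP[ki kj]] /eqP; case; exact: kijm.
have abi : b 0 i = a 0 i by apply/esym/eqP; rewrite ab.
have abm : b 0 m = a 0 m by apply/esym/eqP; rewrite ab.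
have abj : b 0 j <> a 0 j by move/esym/eqP; rewrite ab eqxx.
have aj := az j; have bj := bz j.
have ji : (j == i) = false by rewrite eq_sym (negPf ij).
have jm : (j == m) = false by rewrite eq_sym (negPf mj).
have im : (i == m) = false by rewrite eq_sym (negPf mi).
have mi' := negPf mi. have mj' := negPf mj. have ij' := negPf ij.
have all3 (P : 'I_3 -> Prop) : P i -> P j -> P m -> forall k, P k.
  move=> Pi Pj Pm k; have [->//|ki] := eqVneq k i; have [->//|kj] := eqVneq k j.
  by rewrite (kijm k ki kj).
case: s.
(* The map [a |-> 2 z + 1 - a] exchanges [z] and [z + 1]. So the new corner is opposite to [a] in
   the face, and the edge turns from axis [j] to axis [m]. *)
- exists z, (\row_k (if k == i then a 0 k else z 0 k + z 0 k + 1 - a 0 k)), b, i, m.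
  have aE k : (\row_k (if k == i then a 0 k else z 0 k + z 0 k + 1 - a 0 k)) 0 k =
    (if k == i then a 0 k else z 0 k + z 0 k + 1 - a 0 k) by rewrite mxE.
  split; [split|by rewrite sum3 !aE eqxx ji mi'; move: ev; rewrite sum3; lia|split => //].
  + by move=> k; rewrite aE; have := az k; case: ifP => _; lia.
  + exact: bz.
  + by rewrite eq_sym.
  + by apply: all3; rewrite aE ?eqxx ?ji ?mi' ?im ?jm; have := az m; lia.
  + by apply/rowP; apply: all3; rewrite /flip pA pC !mxE ?eqxx ?ji ?mi' ?intrB ?intrD; field.
  + by rewrite /flip pC; apply/rowP => k; rewrite !mxE; case: ifP.
- exists z, a, (\row_k (if k == i then b 0 k else z 0 k + z 0 k + 1 - b 0 k)), i, m.
  have bE k : (\row_k (if k == i then b 0 k else z 0 k + z 0 k + 1 - b 0 k)) 0 k =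
    (if k == i then b 0 k else z 0 k + z 0 k + 1 - b 0 k) by rewrite mxE.
  split; [split|by []|split => //].
  + exact: az.
  + by move=> k; rewrite bE; have := bz k; case: ifP => _; lia.
  + by rewrite eq_sym.
  + by apply: all3; rewrite bE ?eqxx ?ji ?mi' ?im ?jm; have := az m; lia.
  + by apply/rowP; apply: all3; rewrite /flip pB pC !mxE ?eqxx ?ji ?mi' ?abi ?intrB ?intrD; field.
- exists z, a, b, m, j; split; [split => //|by []|split => //].
  have e : a 0 j + b 0 j = z 0 j + z 0 j + 1 by lia.
  have sj : (a 0 j)%:~R + (b 0 j)%:~R = (z 0 j)%:~R + (z 0 j)%:~R + 1 :> R by rewrite -intrD e !intrD.
  apply/rowP; apply: all3; rewrite /flip pA pB pC pD !mxE ?eqxx ?ji ?mi' ?im ?jm ?abi ?abm; first by field.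
    by rewrite sj; field.
  by field.
(* The cube on the other side of the face: [2 a - z - 1] is [z + 1] if [a = z + 1] and [z - 1] if
   [a = z]. *)
- exists (\row_k (if k == i then a 0 k + a 0 k - z 0 k - 1 else z 0 k)), a, b, i, j.
  have zE k : (\row_k (if k == i then a 0 k + a 0 k - z 0 k - 1 else z 0 k)) 0 k =
    (if k == i then a 0 k + a 0 k - z 0 k - 1 else z 0 k) by rewrite mxE.
  split; [split => //|by []|split => //].
  + by move=> k; rewrite zE; have := az k; case: eqP => // ->; lia.
  + by move=> k; rewrite zE; have := bz k; case: eqP => // ->; rewrite abi; have := az i; lia.
  + by rewrite /flip pC; apply/rowP => k; rewrite !mxE; case: ifP.
  + by apply/rowP => k; rewrite /flip pC pD !mxE; case: ifP => _; rewrite ?intrB ?intrD; field.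
Qed.
End Pyramids.

Section Adjacency.
Context {R : realType}.
Notation V := 'rV[R]_3.
Implicit Types (p q : pyramid R) (s c : color).

Definition orthogonal (k : R) (e1 e2 e3 : V) : Prop :=
  [/\ dot e1 e1 = k, dot e2 e2 = k & dot e3 e3 = k] /\
  [/\ dot e1 e2 = 0, dot e1 e3 = 0 & dot e2 e3 = 0].

Lemma pyramid_orthogonal_edges p : is_pyramid p ->
  orthogonal 4^-1 (pyramid_u1 p) (pyramid_u2 p) (pyramid_u3 p).
Proof.
move=> /pyramid_orthogonal [[_ k1 k2 k3] [k12 k13 k23]].
have Z (u v : V) r : dot (4^-1 *: u) (4^-1 *: v) = r -> dot u v = 16 * r.
  by move=> <-; rewrite dotZr (dotC (_ *: u)) dotZr (dotC v); field.
split; split; first by rewrite (Z _ _ _ k1); field.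
- by rewrite (Z _ _ _ k2); field.
- by rewrite (Z _ _ _ k3); field.
- by rewrite (Z _ _ _ k12) mulr0.
- by rewrite (Z _ _ _ k13) mulr0.
- by rewrite (Z _ _ _ k23) mulr0.
Qed.

Lemma orthogonal_det k e1 e2 e3 : orthogonal k e1 e2 e3 -> dot e1 (cross e2 e3) ^+ 2 = k ^+ 3.
Proof.
move=> [[k1 k2 k3] [k12 k13 k23]].
have -> : dot e1 (cross e2 e3) ^+ 2 =
    dot e1 e1 * (dot e2 e2 * dot e3 e3 - dot e2 e3 ^+ 2)
    - dot e1 e2 * (dot e1 e2 * dot e3 e3 - dot e2 e3 * dot e1 e3)
    + dot e1 e3 * (dot e1 e2 * dot e2 e3 - dot e2 e2 * dot e1 e3).
  by rewrite !dotE !crdE; ring.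
by rewrite k1 k2 k3 k12 k13 k23; ring.
Qed.

Lemma orthogonal_expand k e1 e2 e3 w : k != 0 -> orthogonal k e1 e2 e3 ->
  k *: w = dot w e1 *: e1 + dot w e2 *: e2 + dot w e3 *: e3.
Proof.
move=> k0 o; have D2 := orthogonal_det o; case: o => -[k1 k2 k3] [k12 k13 k23].
have D0 : dot e1 (cross e2 e3) != 0.
  by apply: contraNneq k0 => D0; move: D2; rewrite D0 expr0n /= => /esym/eqP; rewrite expf_eq0.
apply/eqP; rewrite -subr_eq0; set r := _ - _.
have dual : dot e1 (cross e2 e3) *: r =
    dot r e1 *: cross e2 e3 + dot r e2 *: cross e3 e1 + dot r e3 *: cross e1 e2.
  by move: r => r; apply: vec3P; rewrite !dotE !crdE; ring.
have re e : dot r e = k * dot w e - (dot w e1 * dot e1 e + dot w e2 * dot e2 e + dot w e3 * dot e3 e).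
  by rewrite /r dotC !dotRE !(dotC e).
apply/eqP/(scalerI D0); rewrite dual !re (dotC e2 e1) (dotC e3 e1) (dotC e3 e2) k1 k2 k3 k12 k13 k23.
by rewrite scaler0 !mulr0 !addr0 !add0r ![_ * k]mulrC !subrr !scale0r !addr0.
Qed.

(** The coordinates of [w] in the plane of [e1] and [e2] have sum 1 and sum of squares 1, so their
    product is zero. *)
Lemma orthogonal_pair e1 e2 e3 w : orthogonal 4^-1 e1 e2 e3 ->
  dot w w = 4^-1 -> dot w e3 = 0 -> dot w e1 + dot w e2 = 4^-1 -> w = e1 \/ w = e2.
Proof.
move=> o ww w3 w12; have k0 : (4^-1 : R) != 0 by rewrite gt_eqF //; lra.
have E := orthogonal_expand w k0 o; rewrite w3 scale0r addr0 in E.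
have : dot w (4^-1 *: w) = dot w e1 ^+ 2 + dot w e2 ^+ 2 by rewrite E !dotRE; ring.
rewrite dotZr ww => S.
have /eqP : dot w e1 * dot w e2 = 0 by nra.
rewrite mulf_eq0 => /orP[/eqP x0|/eqP x0]; [right|left]; apply: (scalerI k0);
  rewrite E x0 scale0r ?addr0 ?add0r; congr (_ *: _); lra.
Qed.

(** Once three vertices are fixed, the orthogonality of the legs leaves two positions for the
    fourth: that in [p], which is excluded, and its mirror image. So a word determines the gallery
    from its first pyramid. *)
Lemma adjacent_flip s p q : Defs.adjacent s p q -> q = flip s p.
Proof.
case=> pp pq ne eqo; apply/funext => c.
have op := pyramid_orthogonal_edges pp; have oq := pyramid_orthogonal_edges pq.
suff qs : q s = flip s p s.
  have [->//|cs] := pselect (c = s).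
  by rewrite flip_other // eqo.
move: op oq; rewrite /pyramid_u1 /pyramid_u2 /pyramid_u3.
case: s ne eqo => ne eqo /=; set u1 := p colC - p colD; set u2 := _ - p colC; set u3 := _ *: (p colA - _);
  set v1 := q colC - q colD; set v2 := _ - q colC; set v3 := _ *: (q colA - _) => op oq.
- have eB : q colB = p colB by rewrite eqo.
  have eC : q colC = p colC by rewrite eqo.
  have eD : q colD = p colD by rewrite eqo.
  have o' : orthogonal 4^-1 u2 (- u3) u1.
    move: op => [[? ? ?] [k12 k13 k23]]; split; split; rewrite ?dotNr ?(dotC (- u3)) ?dotNr ?opprK //.
      by rewrite k23 oppr0.
    by rewrite dotC.
    by rewrite k13 oppr0.
  case: oq => [[q1 q2 q3] [q12 q13 q23]].
  have v1E : v1 = u1 by rewrite /v1 /u1 ?eB ?eC ?eD.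
  have v23 : v2 - v3 = u2 - u3.
    by rewrite /v2 /v3 /u2 /u3 ?eB ?eC ?eD; apply: vec3P; rewrite !crdE; field.
  have [||| |] := @orthogonal_pair _ _ _ v2 o'.
  + exact: q2.
  + by rewrite -v1E dotC.
  + by rewrite -dotDr -v23 dotDr dotNr q2 q23 oppr0 addr0.
  + move=> v2E; case: ne; move: v2E; rewrite /v2 /u2 ?eB ?eC ?eD => /(congr1 (fun x => 2 *: x - p colB + 2 *: p colC)).
    have E (x : V) : 2 *: (2^-1 *: (x + p colB) - p colC) - p colB + 2 *: p colC = x.
      by apply: vec3P; rewrite !crdE; field.
    by rewrite !E.
  + move=> v2E; move: v2E; rewrite /v2 /u3 ?eB ?eC ?eD => /(congr1 (fun x => 2 *: x - p colB + 2 *: p colC)).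
    have E (x : V) : 2 *: (2^-1 *: (x + p colB) - p colC) - p colB + 2 *: p colC = x.
      by apply: vec3P; rewrite !crdE; field.
    by rewrite !E => ->; apply: vec3P; rewrite !crdE; field.
- have eA : q colA = p colA by rewrite eqo.
  have eC : q colC = p colC by rewrite eqo.
  have eD : q colD = p colD by rewrite eqo.
  case: oq => [[q1 q2 q3] [q12 q13 q23]].
  have o' : orthogonal 4^-1 u2 u3 u1.
    by move: op => [[? ? ?] [k12 k13 k23]]; split; split => //; rewrite dotC.
  have v1E : v1 = u1 by rewrite /v1 /u1 ?eA ?eC ?eD.
  have v23 : v2 + v3 = u2 + u3.
    by rewrite /v2 /v3 /u2 /u3 ?eA ?eC ?eD; apply: vec3P; rewrite !crdE; field.
  have E (x : V) : 2 *: (2^-1 *: (p colA + x) - p colC) - p colA + 2 *: p colC = x.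
    by apply: vec3P; rewrite !crdE; field.
  have [||| |] := @orthogonal_pair _ _ _ v2 o'.
  + exact: q2.
  + by rewrite -v1E dotC.
  + by rewrite -dotDr -v23 dotDr q2 q23 addr0.
  + move=> v2E; case: ne; move: v2E; rewrite /v2 /u2 ?eA ?eC ?eD => /(congr1 (fun x => 2 *: x - p colA + 2 *: p colC)).
    by rewrite !E.
  + move=> v2E; move: v2E; rewrite /v2 /u3 ?eA ?eC ?eD => /(congr1 (fun x => 2 *: x - p colA + 2 *: p colC)).
    by rewrite !E => ->; apply: vec3P; rewrite !crdE; field.
- have eA : q colA = p colA by rewrite eqo.
  have eB : q colB = p colB by rewrite eqo.
  have eD : q colD = p colD by rewrite eqo.
  case: oq => [[q1 q2 q3] [q12 q13 q23]].
  have v3E : v3 = u3 by rewrite /v3 /u3 ?eA ?eB ?eD.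
  have v12 : v1 + v2 = u1 + u2 by rewrite /v1 /v2 /u1 /u2 ?eA ?eB ?eD; apply: vec3P; rewrite !crdE; ring.
  have [||| |] := @orthogonal_pair _ _ _ v1 op.
  + exact: q1.
  + by rewrite -v3E.
  + by rewrite -dotDr -v12 dotDr q1 q12 addr0.
  + by rewrite /v1 /u1 ?eA ?eB ?eD => /addIr /esym.
  + rewrite /v1 /u2 ?eA ?eB ?eD => /(canRL (subrK _)) ->.
    by apply: vec3P; rewrite !crdE; ring.
- have eA : q colA = p colA by rewrite eqo.
  have eB : q colB = p colB by rewrite eqo.
  have eC : q colC = p colC by rewrite eqo.
  case: oq => [[q1 q2 q3] [q12 q13 q23]].
  have k0 : (4^-1 : R) != 0 by rewrite gt_eqF //; lra.
  have v2E : v2 = u2 by rewrite /v2 /u2 ?eA ?eB ?eC.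
  have v3E : v3 = u3 by rewrite /v3 /u3 ?eA ?eB ?eC.
  have E := orthogonal_expand v1 k0 op.
  rewrite -v2E -v3E q12 q13 !scale0r !addr0 in E.
  have : dot v1 (4^-1 *: v1) = dot v1 u1 ^+ 2 by rewrite E dotZr expr2.
  rewrite dotZr q1 => S.
  have : (dot v1 u1 - 4^-1) * (dot v1 u1 + 4^-1) == 0 by apply/eqP; lra.
  rewrite mulf_eq0 => /orP[/eqP x|/eqP x].
    have : v1 = u1 by apply: (scalerI k0); rewrite E; congr (_ *: _); lra.
    by rewrite /v1 /u1 ?eA ?eB ?eC => /addrI/oppr_inj/esym.
  have : v1 = - u1 by apply: (scalerI k0); rewrite E scalerN -scaleNr; congr (_ *: _); lra.
  rewrite /v1 /u1 ?eA ?eB ?eC => /(congr1 (fun x => p colC - x)).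
  by rewrite subKr => ->; apply: vec3P; rewrite !crdE; ring.
Qed.

Lemma flip_adjacent s p : is_pyramid p -> Defs.adjacent s p (flip s p).
Proof.
move=> pp; split => //; first exact: flip_pyramid.
- have [[k1 k2 k3] [k12 k13 k23]] := pyramid_orthogonal_edges pp.
  (* If a flip fixed its vertex, a nonzero leg would coincide with a vector orthogonal to it. *)
  have N (u w : V) : dot u u = 4^-1 -> dot u w = 0 -> u <> w.
    by move=> uu uw e; move: uw; rewrite -e uu; lra.
  case: s => /= e.
  + have : dot (pyramid_u2 p) (- pyramid_u3 p) = 0 by rewrite dotNr k23 oppr0.
    move/(N _ _ k2); apply; rewrite /pyramid_u2 /pyramid_u3.
    have -> : p colC = 2^-1 *: (p colA + p colA).
      by rewrite {1}e; apply: vec3P; rewrite !crdE; field.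
    by apply: vec3P; rewrite !crdE; field.
  + apply: (N _ _ k2 k23); rewrite /pyramid_u2 /pyramid_u3.
    have -> : p colC = 2^-1 *: (p colB + p colB).
      by rewrite {1}e; apply: vec3P; rewrite !crdE; field.
    by apply: vec3P; rewrite !crdE; field.
  + apply: (N _ _ k1 k12); rewrite /pyramid_u1 /pyramid_u2.
    by rewrite {1}e; apply: vec3P; rewrite !crdE; field.
  + have k0 : dot (pyramid_u1 p) 0 = 0 by rewrite dotE !crd0; ring.
    apply: (N _ _ k1 k0); rewrite /pyramid_u1.
    have -> : p colC = 2^-1 *: (p colD + p colD).
      by rewrite {1}e; apply: vec3P; rewrite !crdE; field.
    by apply: vec3P; rewrite !crdE; field.
- by move=> c cs; rewrite flip_other.
Qed.
End Adjacency.

(** * Galleries as walks of chambers *)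

Section Galleries.
Context {R : realType}.
Notation V := 'rV[R]_3.
Implicit Types (p q : pyramid R) (s c : color) (w g : seq color).

Definition pyramid_run : pyramid R -> seq color -> pyramid R := foldl (fun p s => flip s p).

Fixpoint pyramid_walk p w : seq (pyramid R) :=
  if w is s :: w' then p :: pyramid_walk (flip s p) w' else [::].

Lemma size_pyramid_walk p w : size (pyramid_walk p w) = size w.
Proof. by elim: w p => //= s w IH p; rewrite IH. Qed.

Lemma pyramid_walk_cat p w1 w2 :
  pyramid_walk p (w1 ++ w2) = pyramid_walk p w1 ++ pyramid_walk (pyramid_run p w1) w2.
Proof. by elim: w1 p => //= s w1 IH p; rewrite IH. Qed.

Lemma pyramid_run_cat p w1 w2 : pyramid_run p (w1 ++ w2) = pyramid_run (pyramid_run p w1) w2.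
Proof. exact: foldl_cat. Qed.

Lemma pyramid_run_pyramid p w : is_pyramid p -> is_pyramid (pyramid_run p w).
Proof. by elim: w p => //= s w IH p /(flip_pyramid s); exact: IH. Qed.

Lemma is_galleryP w p ps : is_gallery w p ps <->
  [/\ is_pyramid p, belast p ps = pyramid_walk p w & last p ps = pyramid_run p w].
Proof.
elim: w p ps => [|s w IH] p [|q ps] //=; split=> //.
- by move=> [].
- by move=> [_ /(congr1 size)]; rewrite /= size_belast.
- by move=> [].
- by move=> [/[dup] pq [pp _ _ _] /IH[_ -> ->]]; rewrite (adjacent_flip pq).
- move=> [pp [e] l].
  have eq_ : q = flip s p.
    by case: w e l {IH} => [|s' w] /=; case: ps => [|r ps] //= [].
  move: e l; rewrite eq_ => e l; split; first exact: flip_adjacent.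
  by apply/IH; split => //; exact: flip_pyramid.
Qed.

Lemma gallery_exists p w : is_pyramid p ->
  exists ps, [/\ is_gallery w p ps, belast p ps = pyramid_walk p w & last p ps = pyramid_run p w].
Proof.
elim: w p => [|s w IH] p pp; first by exists [::].
have [ps [gps bps lps]] := IH _ (flip_pyramid s pp).
by exists (flip s p :: ps); split; rewrite /= ?bps //; split => //; exact: flip_adjacent.
Qed.

Definition pyramid_centers p w : seq V := map barycenter (pyramid_walk p w).

Lemma pyramid_centers_rot p w n : pyramid_run p w = p ->
  let q := pyramid_run p (take n w) in
  pyramid_run q (rot n w) = q /\ pyramid_centers q (rot n w) = rot n (pyramid_centers p w).
Proof.
move=> cl q; have [nw|wn] := leqP n (size w); last first.
  have -> : q = p by rewrite /q take_oversize // ltnW.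
  by rewrite !rot_oversize ?size_map ?size_pyramid_walk // ltnW.
have clq : pyramid_run q (drop n w) = p by rewrite /q -pyramid_run_cat cat_take_drop.
have -> : rot n w = drop n w ++ take n w by [].
rewrite pyramid_run_cat clq; split => //.
have sx : size (map barycenter (pyramid_walk p (take n w))) = n.
  by rewrite size_map size_pyramid_walk size_takel.
rewrite -[in RHS](cat_take_drop n w) /pyramid_centers !pyramid_walk_cat !map_cat clq.
have E (A B : seq V) : size A = n -> rot n (A ++ B) = B ++ A by move=> <-; exact: rot_size_cat.
by rewrite (E _ _ sx).
Qed.

Definition orientation p : R := dot (pyramid_u1 p) (cross (pyramid_u2 p) (pyramid_u3 p)).

Lemma orientation_flip s p : orientation (flip s p) = - orientation p.
Proof.
by case: s; rewrite /orientation /pyramid_u1 /pyramid_u2 /pyramid_u3 /= !dotE !crdE; field.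
Qed.

Lemma closed_even p w : is_pyramid p -> pyramid_run p w = p -> ~~ odd (size w).
Proof.
move=> pp cl; have E q : orientation (pyramid_run q w) = (-1) ^+ size w * orientation q.
  by elim: w {cl} q => [|s w IH] q /=; rewrite ?mul1r // IH orientation_flip exprS; ring.
have := E p; rewrite cl -signr_odd; case: odd => //; rewrite expr1 => e.
have : orientation p = 0 by lra.
move=> o0; have := orthogonal_det (pyramid_orthogonal_edges pp); rewrite -/(orientation p) o0.
by move=> /eqP; rewrite expr0n /= eq_sym expf_eq0 /= invr_eq0 pnatr_eq0.
Qed.

Definition chamber_vertex (t : chamber) c : zpt :=
  let e := zadd (chD t) (ch1 t) in
  match c with
  | colA => zadd (zadd e (ch2 t)) (ch3 t)
  | colB => zsub (zadd e (ch2 t)) (ch3 t)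
  | colC => e
  | colD => chD t
  end.

(** The factor 4 compensates the quarter in [pyramid_frame]; it disappears in the barycenters, which
    become [place f] of integer points. *)
Definition chamber_pyramid (f : frame) (t : chamber) : pyramid R :=
  fun c => fr_o f + 4 *: lin f (vec (chamber_vertex t c)).

Lemma chamber_pyramid_base p : chamber_pyramid (pyramid_frame p) base_chamber = p.
Proof.
have z1 : zr 1 = 1 :> R by [].
by apply/funext => -[]; rewrite /chamber_pyramid /lin /pyramid_frame /pyramid_u1 /pyramid_u2 /pyramid_u3 /=;
  apply: vec3P; rewrite !crdE /= ?z1 ?(@zr0 R); field.
Qed.

Lemma flip_chamber f t s : flip s (chamber_pyramid f t) = chamber_pyramid f (chamber_step t s).
Proof.
by apply/funext => c; case: s; case: c => //; rewrite /flip /chamber_pyramid /lin /=;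
  apply: vec3P; rewrite ?vecB ?vecD ?vecN !crdE; field.
Qed.

Lemma run_chamber f t w : pyramid_run (chamber_pyramid f t) w = chamber_pyramid f (chamber_run t w).
Proof. by elim: w t => //= s w IH t; rewrite flip_chamber IH. Qed.

Lemma barycenter_chamber f t : barycenter (chamber_pyramid f t) = place f (chamber_center t).
Proof.
rewrite /barycenter /chamber_pyramid /place /affine /lin /chamber_center.
by apply: vec3P; rewrite ?vecB ?vecD ?vecN !crdE; field.
Qed.

Lemma centers_chamber f t w :
  pyramid_centers (chamber_pyramid f t) w = map (place f) (chamber_walk t w).
Proof.
rewrite /pyramid_centers; elim: w t => //= s w IH t.
by rewrite barycenter_chamber flip_chamber IH.
Qed.

Lemma chamber_pyramid_inj f t t' : orthogonal_frame f ->
  chamber_pyramid f t = chamber_pyramid f t' -> t = t'.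
Proof.
move=> hf E; have H c : vec (chamber_vertex t c) = vec (chamber_vertex t' c) :> V.
  have := congr1 (fun p => p c) E; rewrite /chamber_pyramid => /addrI/(scalerI _) e.
  by apply: (lin_inj hf); apply: e; rewrite pnatr_eq0.
have eD : chD t = chD t' by apply/(@vec_inj R)/(H colD).
have e1 : ch1 t = ch1 t'.
  by have := H colC; rewrite /= !vecD eD => /addrI/vec_inj.
have := H colA; have := H colB; rewrite /= !vecB !vecD eD e1 => hB hA.
have e2 : ch2 t = ch2 t'.
  apply: (@vec_inj R); apply: (@scalerI _ _ (2 : R)); first by rewrite pnatr_eq0.
  by apply: vec3P; have := congr2 (fun x y => x + y) hA hB;
    [move/(congr1 (crd 0))|move/(congr1 (crd 1))|move/(congr1 (crd 2))]; rewrite !crdE; lra.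
have e3 : ch3 t = ch3 t' by move: hA; rewrite e2 => /addrI/vec_inj.
by case: t t' eD e1 e2 e3 {E H hA hB} => [? ? ? ?] [? ? ? ?] /= -> -> -> ->.
Qed.
End Galleries.

(** * Exhaustion of the short words *)

Section LowerBound.
Context {R : realType}.
Notation V := 'rV[R]_3.
Local Notation base := base_chamber.

Lemma chamber_walk_cat t w1 w2 :
  chamber_walk t (w1 ++ w2) = chamber_walk t w1 ++ chamber_walk (chamber_run t w1) w2.
Proof. by elim: w1 t => //= s w1 IH t; rewrite IH. Qed.

Lemma chamber_eqP t t' : reflect (t = t') (chamber_eqb t t').
Proof.
apply: (iffP and4P) => [[]|->]; last by split; apply/zeqP.
by case: t t' => [? ? ? ?] [? ? ? ?] /= /zeqP -> /zeqP -> /zeqP -> /zeqP ->.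
Qed.

(** Letters act relative to the current chamber, that is, on the right, and hence commute with left
    multiplication. This is what turns closedness of a threefold word into a cube in the group. *)
Lemma chamber_mul_run t u w : chamber_run (chamber_mul t u) w = chamber_mul t (chamber_run u w).
Proof.
elim: w u => //= s w IH u; rewrite -IH; congr chamber_run.
have zptP (p q : zpt) : vec p = vec q :> V -> p = q by apply: vec_inj.
case: s; rewrite /chamber_mul /chamber_lin /=; congr Chamber => //; apply: zptP;
  rewrite ?(vecD, vecN, vecZ); apply: vec3P; rewrite !crdE ?zrE; ring.
Qed.

Lemma chamber_mul_base t : chamber_mul t base = t.
Proof.
have z1 : zr 1 = 1 :> R by [].
have zptP (p q : zpt) : vec p = vec q :> V -> p = q by apply: vec_inj.
case: t => a b c d; rewrite /chamber_mul /chamber_lin /=.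
by congr Chamber; apply: zptP; rewrite ?(vecD, vecZ) ?z1 ?(@zr0 R) ?scale1r ?scale0r ?addr0 ?add0r.
Qed.

Lemma chamber_run_cube g :
  let t := chamber_run base g in chamber_run base (g ++ g ++ g) = chamber_mul t (chamber_mul t t).
Proof.
move=> t; have tg : chamber_run t g = chamber_mul t t.
  by rewrite -{1}(chamber_mul_base t) chamber_mul_run.
have run_cat u w1 w2 : chamber_run u (w1 ++ w2) = chamber_run (chamber_run u w1) w2 by exact: foldl_cat.
by rewrite !run_cat -/t tg chamber_mul_run tg.
Qed.

Lemma all_In (A : Type) (P : pred A) s x : all P s -> List.In x s -> P x.
Proof. by elim: s => //= y s IH /andP[Py Ps] [<-//|]; exact: IH. Qed.

(** The prefix [x] has been read and [y] is still ahead. Pruning is sound as soon as all members of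
    [vis] are centers met along [x]. *)
Lemma searchP n al x y vis :
  search n al (chamber_run base x) (rev x) vis ->
  (forall c, has (zeqb c) vis -> c \in rcons (chamber_walk base x) (chamber_center (chamber_run base x))) ->
  (size y <= n)%N -> (forall s, List.In s y -> List.In s al) -> (0 < size (x ++ y))%N ->
  cubes_to_base (chamber_run base (x ++ y)) ->
  uniq (chamber_walk base ((x ++ y) ++ (x ++ y) ++ (x ++ y))) ->
  unknotted_word (x ++ y).
Proof.
elim: n x y vis => [|n IH] x [|s y] vis // /andP[h1 h2] hv yn yal g0.
- by rewrite cats0 => ct _; move: h1; rewrite ct revK.
- by rewrite cats0 => ct _; move: h1; rewrite ct revK.
have rs : chamber_step (chamber_run base x) s = chamber_run base (rcons x s).
  by rewrite /chamber_run foldl_rcons.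
rewrite -cat_rcons => ct un; have /= := all_In h2 (yal s (or_introl erefl)).
have walk_rcons : chamber_walk base (rcons x s) =
    rcons (chamber_walk base x) (chamber_center (chamber_run base x)).
  by rewrite -cats1 chamber_walk_cat cats1.
rewrite rs; case: ifP => [/hv inw|_ hs].
  (* [chamber_walk] records a chamber only when a letter follows. The two remaining copies of the
     word guarantee such a letter, so the repeated center does occur twice in the walk. *)
  case E : (y ++ (rcons x s ++ y) ++ (rcons x s ++ y)) => [|r rest].
    by move/(congr1 size): E; rewrite !size_cat size_rcons /=; lia.
  move: un; rewrite -catA E chamber_walk_cat /= cat_uniq => /and3P[_ /norP[+ _] _].
  by rewrite walk_rcons inw.
apply: (IH _ _ (chamber_center (chamber_run base (rcons x s)) :: vis)) => //.
- by rewrite rev_rcons.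
- move=> c /= /orP[/zeqP ->|/hv h]; first by rewrite mem_rcons inE eqxx.
  by rewrite mem_rcons inE walk_rcons h orbT.
- by move=> r ry; apply: yal; right.
- by rewrite size_cat size_rcons.
Qed.

(* A threefold gallery can be started at an occurrence of the smallest letter of
   its word. *)
Lemma searchT : [/\ search_from colA [:: colA; colB; colC; colD],
  search_from colB [:: colB; colC; colD], search_from colC [:: colC; colD] &
  search_from colD [:: colD]].
Proof. by split; vm_compute. Qed.

Lemma search_fromP s al y : search_from s al -> (size y <= 11)%N ->
  (forall r, List.In r y -> List.In r al) ->
  cubes_to_base (chamber_run base (s :: y)) ->
  uniq (chamber_walk base ((s :: y) ++ (s :: y) ++ (s :: y))) ->
  unknotted_word (s :: y).
Proof.
move=> hs yn yal ct un.
apply: (@searchP 11 al [:: s] y [:: chamber_center (chamber_step base s); chamber_center base]) => //.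
by move=> c /= /or3P[/zeqP ->|/zeqP ->|//]; rewrite !inE eqxx ?orbT.
Qed.

Lemma unknotted_wordP g : unknotted_word g -> uniq (chamber_walk base (g ++ g ++ g)) ->
  reduces_to_triangle 200 (chamber_walk base (g ++ g ++ g)).
Proof. by rewrite /unknotted_word => h u; move: h; rewrite u. Qed.

(** The type [color] carries no [eqType] structure here; words are inspected with such tests and
    with [List.In]. *)
Definition is_colA c := if c is colA then true else false.
Definition is_colB c := if c is colB then true else false.
Definition is_colC c := if c is colC then true else false.
Definition is_colD c := if c is colD then true else false.

Lemma rot_find (P : pred color) g : has P g -> exists s y, rot (find P g) g = s :: y /\ P s.
Proof.
move=> hP; have fg : (find P g < size g)%N by rewrite -has_find.
exists (nth colA g (find P g)), (drop (find P g).+1 g ++ take (find P g) g).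
by split; [rewrite /rot (drop_nth colA)|exact: nth_find].
Qed.

Lemma In_rot n (g : seq color) s : List.In s (rot n g) -> List.In s g.
Proof.
move=> h; have [?|?] := List.in_app_or _ _ _ h; rewrite -(cat_take_drop n g);
  apply: List.in_or_app; by [right|left].
Qed.

Lemma In_hasN (P : pred color) g s : ~~ has P g -> List.In s g -> ~~ P s.
Proof. by elim: g => //= t g IH /norP[h1 h2] [<-//|]; exact: (IH h2). Qed.

Lemma rotate_to_minimal g : (0 < size g)%N -> exists n s y al,
  [/\ (n < size g)%N, rot n g = s :: y, forall t, List.In t y -> List.In t al &
   List.In (s, al) [:: (colA, [:: colA; colB; colC; colD]); (colB, [:: colB; colC; colD]);
                       (colC, [:: colC; colD]); (colD, [:: colD])]].
Proof.
move=> g0.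
have main (P : pred color) s al : has P g -> (forall t, P t -> t = s) ->
    (forall t, List.In t g -> List.In t al) -> exists n y,
    [/\ (n < size g)%N, rot n g = s :: y & forall t, List.In t y -> List.In t al].
  move=> hP Ps gal; have [t [y [E /Ps ts]]] := rot_find hP.
  exists (find P g), y; rewrite E ts -has_find; split => // r ry.
  by apply: gal; apply: (@In_rot (find P g)); rewrite E; right.
have [hA|nA] := boolP (has is_colA g).
  have [||n [y [ng E yal]]] := main _ colA [:: colA; colB; colC; colD] hA.
  - by case.
  - by move=> t _; case: t => /=; auto 6.
  by exists n, colA, y, [:: colA; colB; colC; colD]; split => //; left.
have [hB|nB] := boolP (has is_colB g).
  have [||n [y [ng E yal]]] := main _ colB [:: colB; colC; colD] hB.
  - by case.
  - by move=> t tg; move: (In_hasN nA tg); case: t {tg} => //= _; auto 6.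
  by exists n, colB, y, [:: colB; colC; colD]; split => //; right; left.
have [hC|nC] := boolP (has is_colC g).
  have [||n [y [ng E yal]]] := main _ colC [:: colC; colD] hC.
  - by case.
  - by move=> t tg; move: (In_hasN nA tg) (In_hasN nB tg); case: t {tg} => //= _; auto 6.
  by exists n, colC, y, [:: colC; colD]; split => //; do 2!right; left.
have hD : has is_colD g by case: (g) g0 nA nB nC => // -[].
have [||n [y [ng E yal]]] := main _ colD [:: colD] hD.
- by case.
- by move=> t tg; move: (In_hasN nA tg) (In_hasN nB tg) (In_hasN nC tg); case: t {tg} => //= _; auto 6.
by exists n, colD, y, [:: colD]; split => //; do 3!right; left.
Qed.

Theorem short_threefold_unknot (p : pyramid R) g : is_pyramid p -> (0 < size g < 14)%N ->
  pyramid_run p (g ++ g ++ g) = p -> uniq (pyramid_centers p (g ++ g ++ g)) ->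
  ambient_isotopic (closed_polygon (pyramid_centers p (g ++ g ++ g))) (unknot R).
Proof.
move=> pp /andP[g0 g14] cl un.
have g12 : (size g <= 12)%N.
  have := closed_even pp cl; rewrite !size_cat !oddD; case: (odd (size g)) / boolP => // og _.
  by move: g14; rewrite ltnS leq_eqVlt => /predU1P[e|//]; move: og; rewrite e.
have rot3 n : (n <= size g)%N -> rot n (g ++ g ++ g) = rot n g ++ rot n g ++ rot n g.
  move=> ng; rewrite -{1 2 3}(cat_take_drop n g) -!catA -{1}(size_takel ng) rot_size_cat.
  by rewrite /rot -!catA.
have data n (ng : (n < size g)%N) : let h := rot n g in let q := pyramid_run p (take n (g ++ g ++ g)) in
    [/\ orthogonal_frame (pyramid_frame q), chamber_run base (h ++ h ++ h) = base,
        uniq (chamber_walk base (h ++ h ++ h)) &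
        closed_polygon (pyramid_centers p (g ++ g ++ g)) =
        closed_polygon (map (place (pyramid_frame q)) (chamber_walk base (h ++ h ++ h)))].
  move=> h q; have [clq cq] := pyramid_centers_rot n cl; rewrite -/q rot3 1?ltnW // -/h in clq cq.
  have oq : orthogonal_frame (pyramid_frame q) by apply: pyramid_orthogonal; exact: pyramid_run_pyramid.
  have E : pyramid_centers q (h ++ h ++ h) = map (place (pyramid_frame q)) (chamber_walk base (h ++ h ++ h)).
    by rewrite -centers_chamber chamber_pyramid_base.
  split => //.
  - apply: (chamber_pyramid_inj oq).
    by rewrite -run_chamber chamber_pyramid_base.
  - by apply: (map_uniq (f := place (pyramid_frame q))); rewrite -E cq rot_uniq.
  - by rewrite -E cq closed_polygon_rot.
have [n [s [y [al [ng E yal sal]]]]] := rotate_to_minimal g0.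
have [oq clh unh ->] := data n ng.
rewrite E in clh unh *; apply: reduces_to_triangle_unknot => //; have := unh; apply: unknotted_wordP.
have yn : (size y <= 11)%N by have := size_rot n g; rewrite E => /= e; rewrite -ltnS e.
have ct : cubes_to_base (chamber_run base (s :: y)).
  by rewrite /cubes_to_base -chamber_run_cube clh; apply/chamber_eqP.
have [TA TB TC TD] := searchT.
case: sal => [|[|[|[|[]]]]] [es ea]; move: yn yal ct unh; rewrite -es -ea.
- exact: search_fromP TA.
- exact: search_fromP TB.
- exact: search_fromP TC.
- exact: search_fromP TD.
Qed.
End LowerBound.

(** * The trefoil gallery *)

Definition half_below (a b c d : Z) : bool :=
  [&& a <? c, a <? d, b <=? c & b <=? d]%BinZ.

(* The edges contain their first but not their second endpoint. *)
Definition disjoint_edges (e f : zpt * zpt) : bool :=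
  has (fun n => half_below (zdot n e.1) (zdot n e.2) (zdot n f.1) (zdot n f.2)
             || half_below (zdot n f.1) (zdot n f.2) (zdot n e.1) (zdot n e.2))
    (* The last entry does not repeat the first: [half_below] is strict at the first endpoint of the
       lower edge, and negation makes it strict at that of the upper edge. *)
    [:: ZPt 1 0 0; ZPt 0 1 0; ZPt 0 0 1; ZPt 1 (-1) 0; ZPt 1 0 (-1); ZPt 0 1 (-1); ZPt (-1) 0 0].

Definition edges_disjoint (s : seq zpt) : bool :=
  if s is p :: s' then
    let es := edges p (rcons s' p) in all (fun e => e.1 != e.2) es && pairwise disjoint_edges es
  else false.

Definition trefoil_vertices : seq zpt :=
  [:: ZPt 1 0 0; ZPt 0 (-1) 1; ZPt 0 1 0; ZPt 1 0 (-1); ZPt 0 0 1; ZPt (-1) 1 0].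

Definition trefoil_word : seq color :=
  [:: colA; colB; colC; colA; colD; colC; colD; colC; colD; colC; colA; colB; colD; colC].

Definition trefoil_walk : seq zpt := chamber_walk base_chamber (trefoil_word ++ trefoil_word ++ trefoil_word).

(* The frame of [base_pyramid] maps X to (1/2, 1/2, -1/2) + X / 8, hence this
   point to -p. *)
Definition mirror_point (p : zpt) : zpt := zsub (zscale (-8) p) (ZPt 4 4 (-4)).

(* Found, like [grid_moves], by a randomized search. *)
Definition trefoil_walk_moves : seq (nat * move) :=
  [:: (23, Cut); (2, Cut); (16, Cut); (14, Cut); (16, Cut); (36, Cut); (30, Cut); (29, Cut);
      (11, Cut); (25, Cut); (23, Cut); (3, Cut); (18, Cut); (5, Cut); (23, Cut); (20, Cut);
      (5, Cut); (16, Cut); (13, Cut); (11, Cut); (2, Cut); (4, Cut); (6, Cut); (12, Cut);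
      (17, Cut); (14, Cut); (11, Cut); (9, Cut); (3, Cut); (3, Cut); (2, Cut); (3, Cut);
      (4, Cut); (6, Cut); (2, Cut); (1, Cut); (3, Push (ZPt (-4) (-4) (-4))); (6, Cut);
      (5, Push (ZPt (-4) (-12) 4)); (6, Cut); (4, Push (ZPt 4 (-12) 4)); (6, Cut);
      (2, Push (ZPt (-12) (-4) 4)); (6, Cut); (4, Push (ZPt (-4) 0 7)); (6, Cut);
      (1, Push (ZPt (-12) (-4) 12)); (6, Cut); (5, Push (ZPt (-4) 4 (-4))); (6, Cut)].

Definition grid_moves : seq (nat * move) :=
  [:: (11, Cut); (3, Cut); (3, Cut); (6, Cut); (9, Cut); (6, Cut); (1, Cut); (9, Cut);
      (2, Cut); (4, Cut); (2, Cut); (8, Cut); (2, Cut); (0, Push (ZPt 8 4 4)); (7, Cut);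
      (3, Cut); (3, Push (ZPt 1 8 0)); (6, Cut); (0, Push (ZPt 11 0 4)); (6, Cut);
      (0, Push (ZPt 4 10 3)); (6, Cut); (1, Push (ZPt 4 9 2)); (6, Cut);
      (3, Push (ZPt 1 8 (-1))); (6, Cut); (3, Push (ZPt 13 2 1)); (6, Cut);
      (4, Push (ZPt 10 0 4)); (6, Cut); (5, Push (ZPt 3 4 3)); (6, Cut);
      (4, Push (ZPt 0 8 (-1))); (6, Cut); (1, Push (ZPt (-4) 4 0)); (6, Cut);
      (3, Push (ZPt 10 0 (-2))); (6, Cut); (3, Push (ZPt 4 7 2)); (6, Cut);
      (1, Push (ZPt 7 5 2)); (6, Cut); (2, Push (ZPt 6 0 4)); (6, Cut);
      (4, Push (ZPt 5 (-2) 1)); (6, Cut); (4, Push (ZPt 0 0 4)); (6, Cut);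
      (4, Push (ZPt 0 (-4) 4)); (6, Cut); (4, Push (ZPt 1 0 6)); (6, Cut);
      (1, Push (ZPt 1 0 5)); (6, Cut); (1, Push (ZPt 0 0 4)); (6, Cut);
      (1, Push (ZPt 0 (-1) 5)); (6, Cut); (1, Push (ZPt 0 0 4)); (6, Cut);
      (5, Push (ZPt 2 4 3)); (6, Cut); (1, Push (ZPt 1 4 2)); (6, Cut);
      (2, Push (ZPt 14 5 (-2))); (6, Cut); (4, Push (ZPt 7 3 3)); (6, Cut);
      (4, Push (ZPt 6 1 (-4))); (6, Cut); (0, Push (ZPt 0 4 1)); (6, Cut);
      (2, Push (ZPt 7 (-1) (-4))); (6, Cut); (1, Push (ZPt 8 (-1) (-5))); (6, Cut);
      (4, Push (ZPt 4 0 0)); (6, Cut); (4, Push (ZPt 1 (-1) (-5))); (6, Cut);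
      (0, Push (ZPt 0 4 0)); (6, Cut); (2, Push (ZPt 4 0 (-4))); (6, Cut)].

Definition grid_zpt (v : nat * nat * nat) : zpt :=
  ZPt (Z.of_nat v.1.1) (Z.of_nat v.1.2) (Z.of_nat v.2).

Lemma trefoil_walk_disjoint : edges_disjoint trefoil_walk.
Proof. by vm_compute. Qed.

Lemma trefoil_walk_reduces :
  do_moves trefoil_walk trefoil_walk_moves = Some (map mirror_point trefoil_vertices).
Proof. by vm_compute. Qed.

(** The factor 4 makes room for integer intermediate vertices; [grid_frame] undoes it. *)
Lemma grid_walk_reduces :
  do_moves (map (zscale 4 \o grid_zpt) grid_vertices) grid_moves =
    Some (rot 2 (map (zscale 4) trefoil_vertices)).
Proof. by vm_compute. Qed.

Lemma trefoil_walk_closed :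
  chamber_run base_chamber (trefoil_word ++ trefoil_word ++ trefoil_word) = base_chamber.
Proof. by vm_compute. Qed.

(** * Simplicity of polygons *)

Section SimplePolygons.
Context {R : realType}.
Notation V := 'rV[R]_3.
Local Notation vec := (@vec R).
Local Notation zr := (@zr R).

Lemma half_below_lt (a b c d : Z) (s t : R) : half_below a b c d -> 0 <= s < 1 -> 0 <= t < 1 ->
  (1 - s) * zr a + s * zr b < (1 - t) * zr c + t * zr d.
Proof.
rewrite /half_below !(@zr_lt R) !(@zr_le R) => /and4P[ac ad bc bd] /andP[s0 s1] /andP[t0 t1].
have below x : zr a < x -> zr b <= x -> (1 - s) * zr a + s * zr b < x by nra.
have [cd|dc] := lerP (zr c) (zr d); first by have := below _ ac bc; nra.
by have := below _ ad bd; nra.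
Qed.

Lemma disjoint_edgesP (e f : zpt * zpt) (s t : R) : disjoint_edges e f -> 0 <= s < 1 -> 0 <= t < 1 ->
  (1 - s) *: vec e.1 + s *: vec e.2 <> (1 - t) *: vec f.1 + t *: vec f.2.
Proof.
move=> /hasP[n _ H] s01 t01 /(congr1 (dot (vec n))); rewrite !dotRE -!vec_dot => E.
by case/orP: H => /half_below_lt H; [have := H _ _ s01 t01|have := H _ _ t01 s01]; rewrite E ltxx.
Qed.

Lemma closed_polygon_edge (T : zmodType) (v : seq T) i : (i < size v)%N ->
  (v`_i, v`_(i.+1 %% size v)) = nth (0, 0) (edges v`_0 (rcons (behead v) v`_0)) i.
Proof.
case: v => // x v; rewrite /= ltnS => iv.
have E (y : T) (s : seq T) k : (k < size s)%N -> nth (0, 0) (edges y s) k = ((y :: s)`_k, s`_k).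
  by elim: s y k => //= z s IH y [|k] // ks; exact: (IH z k ks).
rewrite E ?size_rcons //; congr pair.
  by case: i iv => //= i iv; rewrite nth_rcons iv.
rewrite nth_rcons; move: iv; rewrite leq_eqVlt => /predU1P[->|iv].
  by rewrite modnn ltnn eqxx.
by rewrite modn_small ?iv.
Qed.

Lemma simple_polygon_vec (v : seq zpt) : edges_disjoint v -> simple_polygon (map vec v).
Proof.
case: v => // p v /andP[nd pw]; split; first by rewrite size_map.
set es := edges p _ in nd pw; have ses : size es = size (p :: v).
  rewrite /es; have E (T : Type) (x : T) s : size (edges x s) = size s by elim: s x => //= y s IH x; rewrite IH.
  by rewrite E size_rcons.
have pt i (s : R) : (i < size (p :: v))%N -> polygon_point (map vec (p :: v)) i s =
    (1 - s) *: vec (nth (p, p) es i).1 + s *: vec (nth (p, p) es i).2.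
  move=> iv; rewrite /polygon_point.
  have := @closed_polygon_edge _ (map vec (p :: v)) i; rewrite size_map => /(_ iv).
  rewrite [behead _]/= [_`_0]/= -map_rcons edges_map -/es (nth_map (p, p)) ?ses //.
  by move=> [-> ->].
have ne i j s t : (i < j < size (p :: v))%N -> 0 <= s < 1 -> 0 <= t < 1 ->
    polygon_point (map vec (p :: v)) i s <> polygon_point (map vec (p :: v)) j t.
  move=> /andP[ij jv]; have iv := ltn_trans ij jv; rewrite !pt //.
  by apply: disjoint_edgesP; apply: (pairwiseP (p, p) pw); rewrite ?inE ?ses.
rewrite size_map => i j s t iv jv s01 t01; have [ij|ji|ij] := ltngtP i j.
- by move/ne; rewrite ij jv => /(_ isT s01 t01).
- by move/esym/ne; rewrite ji iv => /(_ isT t01 s01).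
rewrite -ij !pt //; set e := nth _ es i => E; split => //.
have nde : e.1 != e.2 by apply: (allP nd); rewrite mem_nth ?ses.
have : (s - t) *: (vec e.2 - vec e.1) = 0.
  apply/eqP; rewrite -(subr_eq0 _ 0) subr0; apply/eqP; move/eqP: E; rewrite -subr_eq0 => /eqP <-.
  by apply: vec3P; rewrite !crdE; ring.
move/eqP; rewrite scaler_eq0 !subr_eq0 => /orP[/eqP //|/eqP/(@vec_inj R) e21].
by move: nde; rewrite e21 eqxx.
Qed.

Lemma polygon_point_affine f (v : seq V) i t : (i < size v)%N ->
  polygon_point (map (affine f) v) i t = affine f (polygon_point v i t).
Proof.
move=> iv; rewrite /polygon_point size_map !(nth_map 0) ?ltn_pmod //; last exact: leq_trans iv.
by rewrite /affine /lin; apply: vec3P; rewrite !crdE; ring.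
Qed.

Lemma simple_polygon_affine f (v : seq V) : orthogonal_frame f ->
  simple_polygon v -> simple_polygon (map (affine f) v).
Proof.
move=> hf [v0 sv]; split; rewrite size_map // => i j s t iv jv s01 t01.
by rewrite !polygon_point_affine // => /(affine_inj hf); exact: sv.
Qed.

Lemma simple_polygon_uniq (v : seq V) : simple_polygon v -> uniq v.
Proof.
move=> [_ sv]; apply/(uniqP 0) => i j; rewrite !inE => iv jv ij.
have z01 : 0 <= (0 : R) < 1 by rewrite lexx ltr01.
have [] // := sv i j 0 0 iv jv z01 z01.
by rewrite /polygon_point !subr0 !scale1r !scale0r !addr0.
Qed.

Lemma closed_polygon_opp (v : seq V) : closed_polygon (map -%R v) = -%R @` closed_polygon v.
Proof.
have E i t : (i < size v)%N -> polygon_point (map -%R v) i t = - polygon_point v i t.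
  move=> iv; rewrite /polygon_point size_map !(nth_map 0) ?ltn_pmod //; last exact: leq_trans iv.
  by rewrite !scalerN opprD.
apply/seteqP; split => x.
  move=> [i [t []]]; rewrite size_map => iv t01; rewrite E // => ->.
  by exists (polygon_point v i t) => //; exists i, t.
by move=> [_ [i [t [iv t01 ->]]] <-]; exists i, t; rewrite size_map E.
Qed.
End SimplePolygons.

Section TrefoilKnot.
Context {R : realType}.
Notation V := 'rV[R]_3.

Lemma trefoil_vec : trefoil R = closed_polygon (map vec trefoil_vertices).
Proof. by []. Qed.

Definition grid_frame : frame :=
  Frame 0 (point3 4^-1 0 0) (point3 0 4^-1 0) (point3 0 0 4^-1) (16^-1 : R).

Lemma grid_frame_orthogonal : orthogonal_frame grid_frame.
Proof. by split; split; first lra; rewrite !dotE !crdE; field. Qed.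

Lemma place_grid p : place grid_frame (zscale 4 p) = vec p.
Proof.
have z4 : zr 4 = 4 :> R by [].
by rewrite /place /affine /lin /= vecZ z4; apply: vec3P; rewrite !crdE; field.
Qed.

Lemma vec_grid v : vec (grid_zpt v) = grid_point v :> V.
Proof.
have zn n : zr (Z.of_nat n) = n%:R :> R by rewrite /zr (_ : int_of_Z _ = n%:Z) //; lia.
by rewrite /vec !zn.
Qed.

Lemma grid_trefoil_isotopic : ambient_isotopic (grid_trefoil (R := R)) (trefoil R).
Proof.
have := do_moves_isotopic grid_frame_orthogonal grid_walk_reduces.
rewrite closed_polygon_place_rot -!map_comp trefoil_vec.
have pg v : place grid_frame (zscale 4 (grid_zpt v)) = grid_point v by rewrite place_grid vec_grid.
by rewrite (eq_map (g := grid_point) pg) (eq_map (g := vec) place_grid).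
Qed.

(** The last stage of the isotopy is a homeomorphism of space that matches the complements. *)
Lemma ambient_isotopic_cyclic G (K L : set V) : ambient_isotopic K L ->
  cyclic_systems G (~` L) -> cyclic_systems G (~` K).
Proof.
move=> [H [_ hH _ <-]]; have i01 : 0 <= (1 : R) <= 1 by rewrite ler01 lexx.
have [h' [_ _ hK _]] := hH 1 i01.
move=> /(cyclic_systems_homeo (hH 1 i01)); congr (cyclic_systems G _).
apply/seteqP; split => x /=; first by move=> nK Kx; apply: nK; exists x.
by move=> nK [y Ky /(congr1 h')]; rewrite !hK => yx; apply: nK; rewrite -yx.
Qed.

Lemma trefoil_not_cyclic : ~ cyclic_systems dih3 (~` trefoil R).
Proof. by move=> /(ambient_isotopic_cyclic grid_trefoil_isotopic); exact: grid_not_cyclic. Qed.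

Lemma mirror_trefoil_not_cyclic : ~ cyclic_systems dih3 (~` mirror_trefoil R).
Proof.
have hN : homeomorphism (-%R : V -> V).
  by exists -%R; split; [exact: opp_continuous|exact: opp_continuous|exact: opprK|exact: opprK].
move=> /(cyclic_systems_homeo hN) H; apply: trefoil_not_cyclic; move: H; congr (cyclic_systems _ _).
apply/seteqP; split => x /= nT Tx; apply: nT; first by exists x.
by case: Tx => y Ty /oppr_inj <-.
Qed.

Lemma knots_as_trefoil_nontrivially (v : seq V) : knots_as_trefoil v -> knots_nontrivially v.
Proof.
have knotted (K : set V) : ~ cyclic_systems dih3 (~` K) -> ~ ambient_isotopic K (unknot R).
  by move=> nK /ambient_isotopic_cyclic H; apply/nK/H; exact: unknot_cyclic_systems.
case=> [] [sv vK]; split => // /(ambient_isotopic_trans (ambient_isotopic_sym vK)).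
- exact/knotted/trefoil_not_cyclic.
- exact/knotted/mirror_trefoil_not_cyclic.
Qed.
End TrefoilKnot.

Section TrefoilGallery.
Context {R : realType}.
Notation V := 'rV[R]_3.

(** Placed in the cube below the plane [z = 0], so that with [A] at even coordinate sum the three
    legs point in the positive directions of the axes. *)
Definition base_pyramid : pyramid R := fun c =>
  match c with
  | colA => point3 1 1 0
  | colB => point3 1 1 (-1)
  | colC => point3 1 2^-1 (- 2^-1)
  | colD => point3 2^-1 2^-1 (- 2^-1)
  end.

Lemma base_pyramid_pyramid : is_pyramid base_pyramid.
Proof.
pose z : 'rV[int]_3 := \row_k nth 0 [:: 0; 0; -1] k.
pose a : 'rV[int]_3 := \row_k nth 0 [:: 1; 1; 0] k.
pose b : 'rV[int]_3 := \row_k nth 0 [:: 1; 1; -1] k.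
exists z, a, b, (inord 0), (inord 2).
have all3 (P : 'I_3 -> Prop) : P (inord 0) -> P (inord 1) -> P (inord 2) -> forall k, P k.
  by move=> P0 P1 P2 k; rewrite -(inord_val k); case: k => -[|[|[|]]] /=.
split; [split|by rewrite !big_ord_recl big_ord0 !mxE|].
- by apply: all3; rewrite !mxE !inordK //=; auto.
- by apply: all3; rewrite !mxE !inordK //=; auto.
- by rewrite -val_eqE /= !inordK.
- by apply: all3; rewrite !mxE -[inord _ == inord _]val_eqE /= !inordK.
by split; apply/rowP; apply: all3; rewrite /= !mxE -?[inord _ == inord _]val_eqE /= !inordK //= ?rmorphN1 ?mulr0z; lra.
Qed.

Lemma base_face_reflection (x y z : R) :
  (face_reflection base_pyramid colA (point3 x y z) = point3 x (- z) (- y)) *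
  (face_reflection base_pyramid colB (point3 x y z) = point3 x (z + 1) (y - 1)) *
  (face_reflection base_pyramid colC (point3 x y z) = point3 y x z) *
  (face_reflection base_pyramid colD (point3 x y z) = point3 (2 - x) y z).
Proof.
by do !split; rewrite /face_reflection /plane_reflection /=; apply: vec3P;
  rewrite !dotE !crdE; field.
Qed.

(** A cyclic permutation of the coordinates followed by the translation by [(1, 0, -1)], which is
    orthogonal to the axis [(1, 1, 1)]: a rotation by 120 degrees. *)
Lemma trefoil_word_isometry (x y z : R) :
  word_isometry base_pyramid trefoil_word (point3 x y z) = point3 (z + 1) x (y - 1).
Proof.
have cons s w v : word_isometry base_pyramid (s :: w) v =
    face_reflection base_pyramid s (word_isometry base_pyramid w v) by [].
have nil_ v : word_isometry base_pyramid [::] v = v by [].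
by rewrite /trefoil_word !cons nil_ !base_face_reflection; congr point3; ring.
Qed.

Lemma trefoil_word_order : has_order (word_isometry base_pyramid trefoil_word) 3.
Proof.
move: (word_isometry base_pyramid trefoil_word) trefoil_word_isometry => f E.
split => // [v|[|[|[|//]]] // _ /(_ (point3 0 0 0))].
- by rewrite -(point3_crd v) /= !E; congr point3; ring.
- by rewrite /= E => /(congr1 (crd 0)); rewrite !crdE add0r => /eqP; rewrite oner_eq0.
- rewrite /= !E => /(congr1 (crd 1)); rewrite !crdE add0r => /eqP.
  by rewrite oner_eq0.
Qed.

Lemma threefold_gallery_centers g (p : pyramid R) ps : threefold_gallery g p ps ->
  [/\ is_pyramid p, pyramid_run p (g ++ g ++ g) = p &
      gallery_vertices p ps = pyramid_centers p (g ++ g ++ g)].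
Proof.
move=> [[/is_galleryP[pp bp lp] cl] _]; split => //; last by rewrite /gallery_vertices bp.
by rewrite -lp; apply/funext.
Qed.

Lemma trefoil_gallery : exists (p : pyramid R) ps,
  threefold_gallery trefoil_word p ps /\ knots_as_trefoil (gallery_vertices p ps).
Proof.
have [ps [gps bps lps]] := gallery_exists (trefoil_word ++ trefoil_word ++ trefoil_word) base_pyramid_pyramid.
have cb := chamber_pyramid_base base_pyramid.
have of_ := pyramid_orthogonal base_pyramid_pyramid.
exists base_pyramid, ps; split.
  split; last exact: trefoil_word_order.
  by split=> // c; rewrite lps -{1}cb run_chamber trefoil_walk_closed cb.
have -> : gallery_vertices base_pyramid ps = map (place (pyramid_frame base_pyramid)) trefoil_walk.
  by rewrite /gallery_vertices bps -[X in pyramid_walk X _]cb -centers_chamber.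
right; split.
  rewrite map_comp; apply: simple_polygon_affine => //; apply: simple_polygon_vec.
  exact: trefoil_walk_disjoint.
have := do_moves_isotopic of_ trefoil_walk_reduces; congr (ambient_isotopic _ _).
rewrite /mirror_trefoil trefoil_vec -closed_polygon_opp -!map_comp; congr closed_polygon.
apply: eq_map => q; have z8 : zr (-8) = -8 :> R by [].
have z4 : vec (ZPt 4 4 (-4)) = point3 4 4 (-4) :> V by [].
rewrite /comp /place /mirror_point vecB vecZ z8 z4; move: (vec q) => w.
rewrite /affine /lin /pyramid_frame /pyramid_u1 /pyramid_u2 /pyramid_u3 /=.
by apply: vec3P; rewrite !crdE; field.
Qed.

Lemma nontrivial_threefold_size g (p : pyramid R) ps : threefold_gallery g p ps ->
  knots_nontrivially (gallery_vertices p ps) -> (14 <= size g)%N.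
Proof.
move=> /threefold_gallery_centers[pp cl ->] [sv nu]; rewrite leqNgt; apply/negP => g14.
apply/nu/short_threefold_unknot => //; last exact: simple_polygon_uniq.
by rewrite g14 andbT; case: (g) sv => // -[].
Qed.
End TrefoilGallery.

Theorem theorem3 (R : realType) :
  [/\ is_minimum
        [set l : nat | exists (g : seq color) (p : pyramid R)
                              (ps : seq (pyramid R)),
           [/\ threefold_gallery g p ps,
               knots_nontrivially (gallery_vertices p ps) &
               l = size (g ++ g ++ g)]] 42,
      exists (g : seq color) (p : pyramid R) (ps : seq (pyramid R)),
        [/\ threefold_gallery g p ps, size (g ++ g ++ g) = 42%N,
            knots_nontrivially (gallery_vertices p ps) &
            knots_as_trefoil (gallery_vertices p ps)]
    & is_minimum
        [set k : nat | exists (g : seq color) (p : pyramid R)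
                              (ps : seq (pyramid R)),
           [/\ threefold_gallery g p ps,
               knots_as_trefoil (gallery_vertices p ps) &
               k = size g]] 14].
Proof.
have [p [ps [gps kps]]] := @trefoil_gallery R.
have nps := knots_as_trefoil_nontrivially kps.
split; [split|exists trefoil_word, p, ps; by []|split].
- by exists trefoil_word, p, ps.
- move=> _ [g [q [qs [gq nq ->]]]]; have := nontrivial_threefold_size gq nq.
  by rewrite !size_cat; lia.
- by exists trefoil_word, p, ps.
- move=> _ [g [q [qs [gq /knots_as_trefoil_nontrivially nq ->]]]].
  exact: nontrivial_threefold_size gq nq.
Qed.
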